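(* Let $\Omega\subset\mathbb{C}^2$ be a bounded pseudoconvex domain with smooth boundary and let $\Sigma$ be the Levi-flat set of $\partial\Omega$ (assumed nonempty). Set $$C:=\max\Big\{\max_{z\in\Sigma}|g(\nabla_N\overline{L},\overline{N})|,\ \max_{z\in\Sigma}|g(\nabla_{\overline{L}}L,L)|,\ \max_{z\in\Sigma}|g([N,L],N)|,\ \max_{z\in\Sigma}|g(\nabla_{\overline{L}}N,N)|\Big\}.$$ If the Diederich--Fornæss index of $\Omega$ is $\eta_0$, then for any $\eta<\eta_0$ there exists a smooth defining function $\rho$ of $\Omega$ such that $$2.5+3.75\,C\,\frac{\|\nabla\rho\|}{|\mathrm{Hess}_\rho(N,L)|}+0.5\left|L\left(\frac{\|\nabla\rho\|}{\mathrm{Hess}_\rho(N,L)}\right)\right|\ \ge\ \frac{1}{1-\eta}$$ on $\Sigma$. In particular, if the Diederich--Fornæss index of $\Omega$ is $1$, then there exists a sequence of smooth defining functions $\rho_j$ of $\Omega$ such that $\dfrac{\|\nabla\rho_j\|}{\mathrm{Hess}_{\rho_j}(N,L)}$ diverges to $\infty$ on $\Sigma$ in the holomorphic $C^1$ norm, i.e. $\left\|\dfrac{\|\nabla\rho_j\|}{\mathrm{Hess}_{\rho_j}(N,L)}\right\|_{C^1,L}\to\infty$ as $j\to\infty$.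
   Context: Signed distance: $\delta(z)=-\mathrm{dist}(z,\partial\Omega)$ for $z\in\Omega$ and $\delta(z)=\mathrm{dist}(z,\partial\Omega)$ otherwise; $\delta$ is smooth with $\|\nabla\delta\|=1$ near $\partial\Omega$. Smooth defining function of $\Omega$: a real smooth function $\rho$ on a neighborhood of $\overline\Omega$ with $\Omega=\{\rho<0\}$, vanishing on $\partial\Omega$ with $\nabla\rho\ne0$ there. Diederich--Fornæss index: a number $0<\tau<1$ is a Diederich--Fornæss exponent of $\Omega$ if there is a smooth defining function $\rho$ of $\Omega$ such that $-(-\rho)^\tau$ is plurisubharmonic in $\Omega$. The index is the supremum of all exponents, over all smooth defining functions. With coordinates $(z,w)$ on $\mathbb{C}^2$, near $\partial\Omega$ put $$L=\frac{1}{\sqrt{|\partial_z\delta|^2+|\partial_w\delta|^2}}\Big(\frac{\partial\delta}{\partial w}\frac{\partial}{\partial z}-\frac{\partial\delta}{\partial z}\frac{\partial}{\partial w}\Big),\qquad N=\frac{1}{\sqrt{|\partial_z\delta|^2+|\partial_w\delta|^2}}\Big(\frac{\partial\delta}{\partial\bar z}\frac{\partial}{\partial z}+\frac{\partial\delta}{\partial\bar w}\frac{\partial}{\partial w}\Big).$$ $g$ is the Euclidean metric, extended to complex vector fields as a Hermitian form (complex linear in the first slot, conjugate linear in the second; thus $\sqrt2L,\sqrt2N$ are orthonormal); $\nabla$ is its flat Levi-Civita connection, $\nabla f$ the real gradient of $f$, $\|\nabla f\|^2=g(\nabla f,\nabla f)$. For $(1,0)$ vector fields $Z,W$, $\mathrm{Hess}_f(Z,W)=g(\nabla_Z\nabla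 f,W)=Z(\overline{W}f)-(\nabla_Z\overline{W})f$. The Levi-flat set $\Sigma$ is the set of points of $\partial\Omega$ where the Levi form vanishes, i.e. $\mathrm{Hess}_\rho(L,L)=0$ for one (equivalently any) smooth defining function $\rho$. Holomorphic $C^1$ norm of a function $f$ on $\Sigma$: $\|f\|_{C^1,L}=\sup_\Sigma|f|+\sup_\Sigma|Lf|$. Convention: at points where $\mathrm{Hess}_\rho(N,L)=0$, the quotient $\|\nabla\rho\|/|\mathrm{Hess}_\rho(N,L)|$ is $\infty$, and the displayed inequality is regarded as satisfied there. *)

(* Defs.v *)
From HB Require Import structures.
From mathcomp Require Import all_boot all_order all_algebra.
From mathcomp Require Import complex.
From mathcomp Require Import all_classical all_reals all_analysis.
Set Implicit Arguments.
Unset Strict Implicit.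
Unset Printing Implicit Defensive.
Import Order.TTheory GRing.Theory Num.Theory.
Import numFieldNormedType.Exports.
Local Open Scope classical_set_scope.
Local Open Scope ring_scope.
Local Open Scope complex_scope.

(* Points of C^2 are real row vectors (x0, x1, x2, x3) with z = x0 + i x1 and
   w = x2 + i x3.  The library norm on 'rV[R]_4 is the sup norm, so the
   Euclidean norm is defined separately; the topology is the same. *)
Notation C2 R := 'rV[R]_4.

Definition enorm (R : realType) (x : C2 R) : R :=
  Num.sqrt (\sum_(j < 4) x 0 j ^+ 2).

(* multiplication by i on C^2 *)
Definition muli (R : realType) (v : C2 R) : C2 R :=
  \row_(j < 4) (if odd j then v 0 (inord j.-1) else - v 0 (inord j.+1)).

Definition cmod (R : realType) : R[i] -> R := @ComplexField.Normc.normc R.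

Definition partial (R : realType) (j : 'I_4) (f : C2 R -> R) : C2 R -> R :=
  fun x => 'D_(delta_mx 0 j) f x.

Definition partials (R : realType) (s : seq 'I_4) (f : C2 R -> R) : C2 R -> R :=
  foldr (@partial R) f s.

(* C^oo on the open set U: all iterated partial derivatives exist and are
   continuous on U. *)
Definition smooth_on (R : realType) (U : set (C2 R)) (f : C2 R -> R) : Prop :=
  forall (s : seq 'I_4) (x : C2 R), U x ->
    {for x, continuous (partials s f)} /\
    (forall j : 'I_4, derivable (partials s f) x (delta_mx 0 j)).

Definition rgrad (R : realType) (f : C2 R -> R) (x : C2 R) : C2 R :=
  \row_(j < 4) partial j f x.

(* A complex vector field, i.e. a section of the complexified tangent bundle,
   is given by its four complex components in the frame d/dx0, ..., d/dx3. *)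
Notation vfield R := (C2 R -> 'rV[R[i]]_4).

Definition cpartial (R : realType) (j : 'I_4) (f : C2 R -> R[i]) : C2 R -> R[i] :=
  fun x => partial j (fun y => complex.Re (f y)) x
             +i* partial j (fun y => complex.Im (f y)) x.

Definition vact (R : realType) (X : vfield R) (f : C2 R -> R[i]) : C2 R -> R[i] :=
  fun x => \sum_(j < 4) X x 0 j * cpartial j f x.

Definition vconj (R : realType) (X : vfield R) : vfield R :=
  fun x => map_mx (fun c : R[i] => c^*) (X x).

Definition herm (R : realType) (X Y : vfield R) : C2 R -> R[i] :=
  fun x => \sum_(j < 4) X x 0 j * (Y x 0 j)^*.

(* flat Levi-Civita connection, complex linear in both arguments *)
Definition nabla (R : realType) (X Y : vfield R) : vfield R :=
  fun x => \row_(k < 4) vact X (fun y => Y y 0 k) x.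

Definition lie (R : realType) (X Y : vfield R) : vfield R :=
  fun x => \row_(k < 4)
    (vact X (fun y => Y y 0 k) x - vact Y (fun y => X y 0 k) x).

Definition grad (R : realType) (f : C2 R -> R) : vfield R :=
  fun x => \row_(j < 4) (partial j f x)%:C.

Definition hess (R : realType) (f : C2 R -> R) (Z W : vfield R) : C2 R -> R[i] :=
  herm (nabla Z (grad f)) W.

Definition d_z (R : realType) : vfield R :=
  fun=> \row_(j < 4) nth 0 [:: 2^-1 +i* 0; 0 -i* 2^-1; 0; 0] j.
Definition d_w (R : realType) : vfield R :=
  fun=> \row_(j < 4) nth 0 [:: 0; 0; 2^-1 +i* 0; 0 -i* 2^-1] j.

Definition boundary (R : realType) (A : set (C2 R)) : set (C2 R) :=
  closure A `\` interior A.

Definition edistance (R : realType) (A : set (C2 R)) (x : C2 R) : R :=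
  inf [set enorm (x - y) | y in A].

Definition signed_distance (R : realType) (Omega : set (C2 R)) (x : C2 R) : R :=
  if x \in Omega then - edistance (boundary Omega) x
  else edistance (boundary Omega) x.

(* (X delta) for the signed distance delta, as a complex-valued function *)
Definition dsd (R : realType) (Omega : set (C2 R)) (X : vfield R) : C2 R -> R[i] :=
  vact X (fun y => (signed_distance Omega y)%:C).

Definition LN_factor (R : realType) (Omega : set (C2 R)) (x : C2 R) : R[i] :=
  ((Num.sqrt (cmod (dsd Omega (@d_z R) x) ^+ 2
              + cmod (dsd Omega (@d_w R) x) ^+ 2))^-1)%:C.

Definition Lfield (R : realType) (Omega : set (C2 R)) : vfield R :=
  fun x => LN_factor Omega x *:
    (dsd Omega (@d_w R) x *: d_z x - dsd Omega (@d_z R) x *: d_w x).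

Definition Nfield (R : realType) (Omega : set (C2 R)) : vfield R :=
  fun x => LN_factor Omega x *:
    (dsd Omega (vconj (@d_z R)) x *: d_z x
     + dsd Omega (vconj (@d_w R)) x *: d_w x).

Definition defining_function (R : realType) (Omega : set (C2 R))
    (rho : C2 R -> R) : Prop :=
  exists U : set (C2 R),
    [/\ open U, closure Omega `<=` U, smooth_on U rho,
        (forall x, U x -> (Omega x <-> rho x < 0)) &
        (forall x, boundary Omega x -> rho x = 0 /\ rgrad rho x != 0)].

Definition bounded_domain (R : realType) (Omega : set (C2 R)) : Prop :=
  [/\ open Omega, connected Omega, Omega !=set0 & bounded_set Omega].

Definition smooth_boundary (R : realType) (Omega : set (C2 R)) : Prop :=
  exists rho, defining_function Omega rho.

(* L spans the complex tangent space of the boundary at each boundary point,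
   so this is Levi pseudoconvexity; the sign of the Levi form does not depend
   on the defining function.  In R[i], 0 <= c means that c is real and
   nonnegative. *)
Definition pseudoconvex (R : realType) (Omega : set (C2 R)) : Prop :=
  exists2 rho, defining_function Omega rho &
    forall p, boundary Omega p ->
      0 <= hess rho (Lfield Omega) (Lfield Omega) p.

Definition Levi_flat (R : realType) (Omega : set (C2 R)) : set (C2 R) :=
  [set p | boundary Omega p /\
    exists2 rho, defining_function Omega rho &
      hess rho (Lfield Omega) (Lfield Omega) p = 0].

(* upper semicontinuity, and the sub-mean value property on every closed disc
   a + D v contained in the open set Omega *)
Definition plurisubharmonic_on (R : realType) (Omega : set (C2 R))
    (u : C2 R -> R) : Prop :=
  (forall x, Omega x -> forall e : R, 0 < e -> \forall y \near x, u y < u x + e)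
  /\
  (forall a v : C2 R,
    (forall s t : R, s ^+ 2 + t ^+ 2 <= 1 -> Omega (a + s *: v + t *: muli v)) ->
    ((u a)%:E <= ((2 * pi)^-1)%R%:E *
      \int[@lebesgue_measure R]_(t in `[0%R, (2 * pi)%R])
        (u (a + cos t *: v + sin t *: muli v)%R)%:E)%E).

Definition DF_exponent (R : realType) (Omega : set (C2 R)) (tau : R) : Prop :=
  0 < tau < 1 /\
  exists2 rho, defining_function Omega rho &
    plurisubharmonic_on Omega (fun x => - ((- rho x) `^ tau)).

Definition DF_index (R : realType) (Omega : set (C2 R)) : R :=
  sup [set tau | DF_exponent Omega tau].

(* maximum over Sigma of the modulus of f; Sigma is compact and nonempty and f
   is continuous on it whenever this is used, so the supremum is attained *)
Definition max_on (R : realType) (Sigma : set (C2 R)) (f : C2 R -> R[i]) : R :=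
  sup [set cmod (f p) | p in Sigma].

Definition DF_const (R : realType) (Omega : set (C2 R)) : R :=
  let Sigma := Levi_flat Omega in
  let L := Lfield Omega in
  let N := Nfield Omega in
  Num.max
    (Num.max (max_on Sigma (herm (nabla N (vconj L)) (vconj N)))
             (max_on Sigma (herm (nabla (vconj L) L) L)))
    (Num.max (max_on Sigma (herm (lie N L) N))
             (max_on Sigma (herm (nabla (vconj L) N) N))).

Definition hessNL (R : realType) (Omega : set (C2 R)) (rho : C2 R -> R) :
    C2 R -> R[i] :=
  hess rho (Nfield Omega) (Lfield Omega).

(* |grad rho| / Hess_rho(N, L), with the junk value 0 where Hess_rho(N, L) = 0 *)
Definition quot (R : realType) (Omega : set (C2 R)) (rho : C2 R -> R) :
    C2 R -> R[i] :=
  fun x => (enorm (rgrad rho x))%:C / hessNL Omega rho x.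

Definition abs_quot (R : realType) (Omega : set (C2 R)) (rho : C2 R -> R)
    (x : C2 R) : \bar R :=
  if hessNL Omega rho x == 0 then +oo%E else (cmod (quot Omega rho x))%:E.

(* Holomorphic C^1 norm of the quotient.  It is +oo as soon as Hess_rho(N, L)
   has a zero on the Levi-flat set, whatever the second supremum is, since the
   latter is nonnegative when the Levi-flat set is nonempty. *)
Definition quot_C1_norm (R : realType) (Omega : set (C2 R)) (rho : C2 R -> R) :
    \bar R :=
  (ereal_sup [set abs_quot Omega rho p | p in Levi_flat Omega]
   + ereal_sup [set (cmod (vact (Lfield Omega) (quot Omega rho) p))%:E
               | p in Levi_flat Omega])%E.

(* Main.v *)
Require Import Defs.
From HB Require Import structures.
From mathcomp Require Import all_boot all_order all_algebra.
From mathcomp Require Import complex.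
From mathcomp Require Import all_classical all_reals all_analysis.
From mathcomp Require Import ring lra.
Import Order.TTheory GRing.Theory Num.Theory.
Import numFieldNormedType.Exports.
Local Open Scope classical_set_scope.
Local Open Scope ring_scope.

Set Implicit Arguments.
Unset Strict Implicit.
Unset Printing Implicit Defensive.

(** The theorem follows from a pointwise inequality at Levi-flat points. Let tau be a
    Diederich-Fornaess exponent with defining function rho, let p be a Levi-flat boundary
    point, and write H = Hess_rho (N, L), u = |grad rho| / H and
    m = g (nabla_(conj L) L, L). If H is nonzero at p, then
      1 / (1 - tau) <= 1 + |m| |grad rho| / |H| + |L u| / 2      (levi_flat_estimate).
    Since |m| <= C (connection_le_DF_const), an exponent tau > eta gives the first part. For
    the second part take eta_j = 1 - 1 / (j + 1) and look at one Levi-flat point: the left-hand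
    side tends to infinity, so the C^1 norms do too.

    The inequality comes from a second variation. Plurisubharmonicity of - (- rho)^tau says
    that in Omega
      - rho (D^2 rho (v, v) + D^2 rho (J v, J v))
        + (1 - tau) ((d rho v)^2 + (d rho (J v))^2) >= 0      (psh_DF).
    Take this at the point p - t n, with n the outer unit normal, for v = l + t w, where l is
    the real vector with (1,0) part L. At a Levi-flat point rho, the Levi form and the two linear
    forms vanish at t = 0, so the coefficient of t^2, a quadratic polynomial in w, has to be
    nonnegative. Its minimum over the complex normal line gives a bound of |H|^2 / (1 - tau) by
    second derivatives of rho and the real part of D^3 rho (L, N, conj L)
    (levi_inequality, levi_inequality_complex).

    The third derivative is then traded for L u. Differentiating H = D^2 rho (N, conj L) along L
    produces D^3 rho (L, N, conj L) and the derivatives of N and conj L along L. In C^2, Levi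
    flatness forces these two derivatives to be multiples of N and conj L with a common factor,
    the conjugate of 2 m (frame_L, herm_LbarL), and elementary complex algebra finishes the proof
    (levi_quotient).

    The fields L and N are built from the signed distance delta, so its gradient has to be known
    near the boundary and differentiated once at boundary points. This is done without
    constructing a smooth projection. A defining function yields balls of one radius tangent to
    the boundary from both sides at all boundary points near p (near_tangent_balls), and delta is
    squeezed between the distances to these balls. So delta is differentiable near p, its gradient
    at x is the unit normal at the nearest boundary point x - delta(x) grad delta(x)
    (near_sdist_grad), and this equation can be differentiated at points where delta = 0
    (sdist_second). *)

(** * Differentiability from partial derivatives *)

Section Calculus.
Variable R : realType.
Implicit Types (f : C2 R -> R) (x h v : C2 R).

Definition dotp (u v : C2 R) : R := \sum_(j < 4) u 0 j * v 0 j.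

Lemma is_derive_line f x v (s : R) : derivable f (x + s *: v) v ->
  is_derive s 1 (fun t : R => f (x + t *: v)) ('D_v f (x + s *: v)).
Proof.
have E : (fun k : R => k^-1 *: (((fun t : R => f (x + t *: v)) \o shift s) (k *: 1)
    - f (x + s *: v))) =
   (fun k => k^-1 *: ((f \o shift (x + s *: v)) (k *: v) - f (x + s *: v))).
  apply/funext => k /=; congr (_ *: (f _ - _)).
  by rewrite [k%:A]mulr1 scalerDl addrCA.
move=> df; split; first by rewrite /derivable E.
by rewrite /derive E.
Qed.

Lemma mvt01 (phi dphi : R -> R) :
  (forall s : R, 0 <= s <= 1 -> is_derive s 1 phi (dphi s)) ->
  exists2 s : R, 0 < s < 1 & phi 1 - phi 0 = dphi s.
Proof.
move=> dfv; have [||s] := @MVT R phi dphi 0 1 ltr01.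
- by move=> s; rewrite in_itv /= => /andP[s0 s1]; apply: dfv; rewrite !ltW.
- apply: derivable_within_continuous => s; rewrite in_itv/= => sab.
  by case: (dfv s sab).
by rewrite in_itv /= subr0 mulr1 => s01 e; exists s.
Qed.

Lemma mvt_line f x v (df : R -> R) :
  (forall s : R, 0 <= s <= 1 -> is_derive s 1 (fun t : R => f (x + t *: v)) (df s)) ->
  exists2 s : R, 0 < s < 1 & f (x + v) - f x = df s.
Proof. by move=> /mvt01; rewrite scale1r scale0r addr0. Qed.

Lemma mx_norm_coord v j : `|v 0 j| <= `|v|.
Proof.
rewrite [leRHS]/Num.norm /= mx_normrE.
by apply/bigmax_geP; right => /=; exists (0, j).
Qed.

Lemma mx_norm_le v (e : R) : 0 <= e -> (forall j, `|v 0 j| <= e) -> `|v| <= e.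
Proof.
move=> e0 H; rewrite [leLHS]/Num.norm /= mx_normrE.
apply: bigmax_le => // -[i j] _ /=; rewrite ord1; exact: H.
Qed.

Lemma vec_sum v : v = \sum_(j < 4) v 0 j *: delta_mx 0 j.
Proof. by rewrite [LHS]row_sum_delta. Qed.

Lemma diff_of_littleo f x (g : C2 R) :
  (forall e : R, 0 < e ->
    \forall h \near (0 : C2 R), `|f (h + x) - f x - dotp g h| <= e * `|h|) ->
  differentiable f x /\ forall v, 'd f x v = dotp g v.
Proof.
move=> H.
have lin_df : linear (dotp g : C2 R -> R^o).
  move=> k u w; rewrite /dotp /GRing.scale /= mulr_sumr -big_split /=.
  by apply: eq_bigr => j _; rewrite !mxE; ring.
pose M := GRing.isLinear.Build _ _ _ _ _ lin_df.
pose df : {linear C2 R -> R^o} := HB.pack (dotp g : C2 R -> R^o) M.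
have cdf : continuous df.
  move=> u.
  have -> : (df : C2 R -> R^o) = fun u : C2 R => \sum_(j < 4) g 0 j * u 0 j by [].
  by apply: (@cvg_big R^o _ +%R 0 xpredT (@add_continuous R^o) _ (nbhs u)) => j _; apply: cvgM; [exact: cvg_cst|exact: coord_continuous].
have eqf : (f : C2 R -> R^o) \o shift x = cst (f x : R^o) + (df : C2 R -> R^o) +o_ (0 : C2 R) id.
  apply/eqaddoP => _/posnumP[e].
  near=> h; rewrite opprD addrA.
  rewrite -![(_ + _ : _ -> _) _]/(_ + _) -![(- _ : _ -> _) _]/(- _) /=.
  by near: h; exact: H.
have dE := diff_unique cdf eqf.
split; last by move=> v; rewrite dE.
by apply/diff_locallyP; rewrite dE.
Unshelve. all: by end_near. Qed.

Lemma derive_partials f x v : differentiable f x ->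
  'D_v f x = \sum_(j < 4) v 0 j * partial j f x.
Proof.
move=> df; rewrite deriveE// [in LHS](vec_sum v) linear_sum.
by apply: eq_bigr => j _; rewrite linearZ /= /partial deriveE.
Qed.

(** Moves from 0 to h along one axis after the other: the increment of f over
    each step is governed by a single partial derivative. *)
Let stair h (m : nat) : C2 R := \row_(j < 4) (if (j < m)%N then h 0 j else 0).

(** Smoothness is a condition on partial derivatives along the axes, while
    chain rules need a total differential. The increment of f is split along
    the axes, the mean value theorem is applied to each piece, and continuity
    of the partial derivatives makes all the intermediate values close to
    those at x. *)
Lemma differentiable_C1 f x :
  (\forall y \near x, forall j, derivable f y (delta_mx 0 j)) ->
  (forall j, {for x, continuous (partial j f)}) ->
  differentiable f x.
Proof.
move=> df cf.
suff : forall e : R, 0 < e -> \forall h \near (0 : C2 R),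
    `|f (h + x) - f x - dotp (\row_j partial j f x) h| <= e * `|h|.
  by move=> /diff_of_littleo[].
move=> e e0.
have e40 : 0 < e / 4 by rewrite divr_gt0.
have : \forall y \near x, forall j, `|partial j f y - partial j f x| <= e / 4.
  apply: (@filter_forall _ _ (fun j y => `|partial j f y - partial j f x| <= e / 4) (nbhs x)) => j.
  have /cvgrPdist_le/(_ _ e40) := cf j.
  by apply: filterS => y; rewrite distrC.
move=> cfe.
have [d /= d0 B] := (@nbhs_ballP R (C2 R) x _).1 (filterI df cfe).
near=> h.
have hd : `|h| < d by near: h; exact: (@nbhs0_lt R (C2 R)).
have step (j : 'I_4) : `|f (x + stair h j.+1) - f (x + stair h j)
     - partial j f x * h 0 j| <= e / 4 * `|h|.
  have -> : stair h j.+1 = stair h j + h 0 j *: delta_mx 0 j.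
    apply/rowP => k; rewrite !mxE. rewrite eqxx /= ltnS leq_eqVlt -val_eqE /=.
    by case: ltngtP => //= [_|_|/val_inj ->]; rewrite ?mulr0 ?addr0// mulr1 add0r.
  rewrite addrA.
  have inB s : 0 <= s <= 1 -> ball x d (x + stair h j + s *: (h 0 j *: delta_mx 0 j)).
    move=> /andP[s0 s1].
    rewrite -ball_normE /= distrC -[x + _ + _]addrA [_ - x]addrC addKr.
    apply: (le_lt_trans _ hd); apply: mx_norm_le => // k; rewrite !mxE eqxx/=.
    case: ifPn => [kj|_]; last first.
      rewrite add0r; case: eqP => _; last by rewrite !mulr0 normr0.
      rewrite mulr1 normrM ger0_norm// (le_trans _ (mx_norm_coord h j))//.
      by rewrite ler_piMl.
    have /negbTE -> : k != j by rewrite -val_eqE /= neq_ltn kj.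
    by rewrite !mulr0 addr0 mx_norm_coord.
  have [|s s01 ->] := @mvt_line f (x + stair h j) (h 0 j *: delta_mx 0 j)
    (fun s => h 0 j * partial j f (x + stair h j + s *: (h 0 j *: delta_mx 0 j))).
    move=> s s01; set y := x + stair h j.
    have [/(_ j) dfy _] := B _ (inB s s01).
    have := @is_derive_line f y (delta_mx 0 j) (s * h 0 j).
    rewrite -scalerA => /(_ dfy) D.
    have -> : (fun t : R => f (y + t *: (h 0 j *: delta_mx 0 j))) =
       (fun t => f (y + t *: delta_mx 0 j)) \o (fun t => t * h 0 j).
      by apply/funext => t /=; rewrite scalerA.
    have D2 : is_derive s (1 : R) (fun t : R => t * h 0 j) (h 0 j).
      by apply: is_derive_eq; rewrite scaler0 add0r [LHS]mulr1.
    by rewrite mulrC; apply: is_derive1_comp; rewrite -?scalerA.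
  case/andP: (s01) => s0 s1; have s01' : 0 <= s <= 1 by rewrite (ltW s0) (ltW s1).
  have le := (B _ (inB s s01')).2 j.
  rewrite mulrC -mulrBl normrM ler_pM//; exact: mx_norm_coord.
(* the steps of the staircase add up to the whole increment *)
have -> : f (h + x) - f x = \sum_(j < 4) (f (x + stair h j.+1) - f (x + stair h j)).
  have := telescope_sumr (fun k => f (x + stair h k)) (leq0n 4).
  rewrite big_mkord => ->; congr (f _ - f _).
    by rewrite addrC; congr (_ + _); apply/rowP => k; rewrite !mxE ltn_ord.
  by rewrite -[LHS]addr0; congr (_ + _); apply/rowP => k; rewrite !mxE.
rewrite /dotp -sumrB (le_trans (ler_norm_sum _ _ _))//.
rewrite (_ : e * `|h| = \sum_(j < 4) e / 4 * `|h|); last first.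
  by rewrite sumr_const card_ord -[RHS]mulr_natl; field.
by apply: ler_sum => j _; rewrite !mxE.
Unshelve. all: by end_near. Qed.

End Calculus.

(** * Taylor expansions and symmetry of second derivatives *)

Section SecondOrder.
Variable R : realType.
Implicit Types (f : C2 R -> R) (x y a h v : C2 R).

Lemma diff_eps f x : differentiable f x -> forall e : R, 0 < e ->
  \forall h \near (0 : C2 R), `|f (h + x) - f x - 'd f x h| <= e * `|h|.
Proof.
move=> /(@diff_locally R (C2 R) R^o) E e e0; have /eqaddoP/(_ _ e0) := E.
apply: filterS => h.
rewrite opprD addrA.
by rewrite -![(_ + _ : _ -> _) _]/(_ + _) -![(- _ : _ -> _) _]/(- _) /=.
Qed.

Lemma near_addr (P : set (C2 R)) a : (\forall y \near a, P y) ->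
  \forall h \near (0 : C2 R), P (h + a).
Proof.
by move=> aP; rewrite (near_shift a); apply: filterS aP => y /=; rewrite sub0r subrK.
Qed.

Lemma mx_norm_delta (j : 'I_4) : `|delta_mx 0 j : C2 R| <= 1.
Proof.
apply: mx_norm_le => // k; rewrite mxE eqxx /=.
by case: (k == j); rewrite ?normr1 ?normr0.
Qed.

(** Differentiability of the first derivatives at the single point a suffices:
    after subtraction of the Taylor polynomial, s |-> f (a + s h) has
    derivative sum_j h_j (g_j (a + s h) - g_j a - s dg_j h), which is
    o(|h|^2). *)
Lemma taylor2 f (g : 'I_4 -> C2 R -> R) a :
  (\forall y \near a, differentiable f y /\ forall j, partial j f y = g j y) ->
  (forall j, differentiable (g j) a) ->
  forall e : R, 0 < e -> \forall h \near (0 : C2 R),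
    `|f (a + h) - f a - \sum_j h 0 j * g j a
       - 2^-1 * \sum_j \sum_k h 0 j * h 0 k * partial k (g j) a|
    <= e * `|h| ^+ 2.
Proof.
move=> df dg e e0.
have e40 : 0 < e / 4 by rewrite divr_gt0.
have G : \forall h \near (0 : C2 R), forall j,
    `|g j (h + a) - g j a - 'd (g j) a h| <= e / 4 * `|h|.
  apply: (@filter_forall _ _ (fun j h => `|g j (h + a) - g j a
    - 'd (g j) a h| <= e / 4 * `|h|) (nbhs (0 : C2 R))) => j.
  exact: diff_eps.
have D : \forall h \near (0 : C2 R), differentiable f (h + a) /\
    forall j, partial j f (h + a) = g j (h + a).
  exact: (@near_addr (fun y => differentiable f y /\ forall j, partial j f y = g j y)).
have [d /= d0 B] := (@nbhs_ballP R (C2 R) _ _).1 (filterI G D).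
near=> h.
have hd : `|h| < d by near: h; exact: (@nbhs0_lt R (C2 R)).
have inB (s : R) : 0 <= s <= 1 -> ball (0 : C2 R) d (s *: h).
  move=> /andP[s0 s1]; rewrite -ball_normE /= sub0r normrN normrZ ger0_norm//.
  by apply: le_lt_trans hd; rewrite ler_piMl.
pose D1 := \sum_j h 0 j * g j a.
pose D2 := \sum_j h 0 j * 'd (g j) a h.
have D2E : \sum_j \sum_k h 0 j * h 0 k * partial k (g j) a = D2.
  apply: eq_bigr => j _; rewrite -deriveE// derive_partials// mulr_sumr.
  by apply: eq_bigr => k _; rewrite mulrA.
rewrite D2E -/D1.
pose phi (s : R) := f (a + s *: h) - s * D1 - 2^-1 * s ^+ 2 * D2.
pose dphi (s : R) := \sum_j h 0 j * (g j (s *: h + a) - g j a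
   - s * 'd (g j) a h).
have dphiE (s : R) : 0 <= s <= 1 -> is_derive s 1 phi (dphi s).
  move=> s01; have [_ [dfs gs]] := B _ (inB s s01); rewrite addrC in dfs.
  have F := @is_derive_line R f a h s (diff_derivable dfs).
  rewrite /phi; apply: is_derive_eq.
  rewrite derive_partials// /dphi.
  transitivity ((\sum_(j < 4) h 0 j * partial j f (a + s *: h)) - D1 - s * D2).
    rewrite scaler0 add0r; congr (_ - _ - _); first by rewrite [LHS]mulr1.
    rewrite !scaler0 !add0r /GRing.scale /=. by field.
  rewrite /D1 /D2 mulr_sumr -!sumrB; apply: eq_bigr => j _.
  by rewrite -gs [_ *: h + a]addrC; ring.
have [s /andP[s0 s1]] := mvt01 dphiE.
have -> : phi 1 - phi 0 = f (a + h) - f a - D1 - 2^-1 * D2.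
  by rewrite /phi scale1r scale0r addr0; field.
move=> ->.
have s01 : 0 <= s <= 1 by rewrite (ltW s0) ltW.
have [Gs _] := B _ (inB s s01).
rewrite /dphi (le_trans (ler_norm_sum _ _ _))//.
rewrite (_ : e * `|h| ^+ 2 = \sum_(j < 4) `|h| * (e / 4 * `|h|)); last first.
  by rewrite sumr_const card_ord -[RHS]mulr_natl; field.
apply: ler_sum => j _; rewrite normrM ler_pM//; first exact: mx_norm_coord.
have := Gs j; rewrite linearZ /= => /le_trans; apply.
by rewrite ler_wpM2l ?(ltW e40)// normrZ ger0_norm ?(ltW s0)// ler_piMl// ltW.
Unshelve. all: by end_near. Qed.

(** The increment of f along e_j, seen as a function of the coordinate along
    e_i, has as derivative an increment of the i-th partial derivative, which
    is expanded to first order at a. *)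
Lemma mixed_difference f a (i j : 'I_4) :
  (\forall y \near a, differentiable f y) -> differentiable (partial i f) a ->
  forall e : R, 0 < e -> \forall s \near (0 : R)^'+,
    `|(f (a + s *: delta_mx 0 i + s *: delta_mx 0 j) - f (a + s *: delta_mx 0 i))
      - (f (a + s *: delta_mx 0 j) - f a)
     - s ^+ 2 * partial j (partial i f) a| <= e * s ^+ 2.
Proof.
move=> df dg e e0.
have e30 : 0 < e / 3 by rewrite divr_gt0.
have D : \forall h \near (0 : C2 R), differentiable f (h + a).
  exact: (@near_addr (fun y => differentiable f y)).
have [d /= d0 B] := (@nbhs_ballP R (C2 R) _ _).1 (filterI (diff_eps dg e30) D).
near=> s.
have s0 : 0 < s by near: s; exact: nbhs_right_gt.
have sd : 2 * s < d.
  by rewrite mulrC -ltr_pdivlMr//; near: s; apply: nbhs_right_lt; rewrite divr_gt0.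
set ei := delta_mx 0 i; set ej := delta_mx 0 j.
have bnd (t : R) (u : C2 R) (c : R) : 0 <= t <= 1 -> 0 <= c <= 1 ->
    `|(t * s) *: ei + (c * s) *: ej : C2 R| <= (1 + c) * s.
  move=> /andP[t0 t1] /andP[c0 c1].
  rewrite (le_trans (ler_normD _ _))// !normrZ mulrDl mul1r.
  rewrite !ger0_norm ?mulr_ge0 ?(ltW s0)//.
  rewrite lerD// -[leRHS]mulr1 ler_pM ?mulr_ge0 ?(ltW s0)//; try exact: mx_norm_delta.
  by rewrite ler_piMl // ltW.
pose q (c t : R) : C2 R := (t * s) *: ei + (c * s) *: ej.
have inB c t : 0 <= t <= 1 -> 0 <= c <= 1 -> ball (0 : C2 R) d (q c t).
  move=> t01 c01; rewrite -ball_normE /= sub0r normrN.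
  apply: (le_lt_trans (bnd t 0 c t01 c01)); apply: le_lt_trans sd.
  rewrite ler_pM2r//; move: c01 => /andP[]; lra.
have DZ z : differentiable f z -> 'D_(s *: ei) f z = s * partial i f z.
  move=> dz; rewrite [in LHS]deriveE// [partial i f z]deriveE//.
  by rewrite linearZ.
pose psi t := f (a + (s *: ej) + t *: (s *: ei)) - f (a + t *: (s *: ei)).
pose dpsi t := s * (partial i f (q 1 t + a) - partial i f (q 0 t + a)).
have one01 : 0 <= (1 : R) <= 1 by rewrite ler01 lexx.
have zero01 : 0 <= (0 : R) <= 1 by rewrite ler01 lexx.
have [t /andP[t0 t1]] : exists2 t : R, 0 < t < 1 & psi 1 - psi 0 = dpsi t.
  apply: mvt01 => t t01.
  have q1 : q 1 t + a = a + s *: ej + t *: (s *: ei).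
    by rewrite /q mul1r scalerA addrC [_ *: ei + _]addrC addrA.
  have q0 : q 0 t + a = a + t *: (s *: ei).
    by rewrite /q mul0r scale0r addr0 scalerA addrC.
  have [_ d1] := B _ (inB 1 t t01 one01); have [_ d2] := B _ (inB 0 t t01 zero01).
  rewrite q1 in d1; rewrite q0 in d2.
  have F1 := @is_derive_line R f _ (s *: ei) t (diff_derivable d1).
  have F2 := @is_derive_line R f _ (s *: ei) t (diff_derivable d2).
  have F := is_deriveB F1 F2.
  suff <- : 'D_(s *: ei) f (a + s *: ej + t *: (s *: ei)) - 'D_(s *: ei) f (a + t *: (s *: ei))
    = dpsi t by exact: F.
  by rewrite (DZ _ d1) (DZ _ d2) /dpsi q1 q0 mulrBr.
move=> E.
rewrite (_ : _ - _ - (_ - _) = dpsi t); last first.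
  by rewrite -E /psi !scale1r !scale0r !addr0; congr (f _ - _ - _); rewrite addrAC.
have t01 : 0 <= t <= 1 by rewrite !ltW.
have [g1 _] := B _ (inB 1 t t01 one01); have [g2 _] := B _ (inB 0 t t01 zero01).
have E2 : 'd (partial i f) a (q 1 t) - 'd (partial i f) a (q 0 t)
    = s * partial j (partial i f) a.
  rewrite -linearB /= /q mul1r mul0r scale0r addr0 addrAC subrr add0r linearZ /=.
  by rewrite /partial deriveE.
have := bnd t 0 1 t01 one01; have := bnd t 0 0 t01 zero01.
rewrite -/(q 0 t) -/(q 1 t) addr0 mul1r => n0 n1.
rewrite /dpsi.
rewrite (_ : s * _ - _ = s * ((partial i f (q 1 t + a) - partial i f a - 'd (partial i f) a (q 1 t))
  - (partial i f (q 0 t + a) - partial i f a - 'd (partial i f) a (q 0 t)))); last first.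
  rewrite expr2 -mulrA -E2; ring.
rewrite normrM gtr0_norm// (_ : e * s ^+ 2 = s * (e * s)); last by ring.
rewrite ler_pM2l// (le_trans (ler_normB _ _))//.
rewrite (_ : e * s = e / 3 * ((1 + 1) * s) + e / 3 * s); last by field.
by apply: lerD; [apply: (le_trans g1)|apply: (le_trans g2)];
  rewrite ler_pM2l.
Unshelve. all: by end_near. Qed.

(** The mixed second difference is symmetric in the two directions, and both
    mixed derivatives are limits of it divided by s^2. *)
Lemma partialC f a (i j : 'I_4) :
  (\forall y \near a, differentiable f y) ->
  differentiable (partial i f) a -> differentiable (partial j f) a ->
  partial i (partial j f) a = partial j (partial i f) a.
Proof.
move=> df di dj; apply/eqP; rewrite -subr_eq0 -normr_le0.
apply/ler_addgt0Pl => e e0; rewrite addr0.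
have e20 : 0 < e / 2 by rewrite divr_gt0.
have [s [s0 [Hi Hj]]] := filter_ex (filterI (nbhs_right_gt (0 : R))
  (filterI (mixed_difference j df di e20) (mixed_difference i df dj e20))).
have s20 : 0 < s ^+ 2 by rewrite exprn_gt0.
have alg2 (u v w z : R) : u - v - (w - z) = u - w - (v - z) by ring.
rewrite (addrAC a) alg2 in Hj.
rewrite -(ler_pM2r s20) -[X in _ * X <= _]gtr0_norm// -normrM.
have alg (P Q c d : R) : (P - Q) * c = (d - c * Q) - (d - c * P) by ring.
rewrite (alg _ _ _ (f (a + s *: delta_mx 0 i + s *: delta_mx 0 j)
    - f (a + s *: delta_mx 0 i) - (f (a + s *: delta_mx 0 j) - f a))).
rewrite (_ : e * s ^+ 2 = e / 2 * s ^+ 2 + e / 2 * s ^+ 2); last by field.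
exact: le_trans (ler_normB _ _) (lerD Hi Hj).
Qed.

Lemma ball_segment (p : C2 R) (d : R) x h (s : R) : ball p d x -> ball p d (x + h) ->
  0 <= s <= 1 -> ball p d (x + s *: h).
Proof.
move=> xp hp /andP[s0 s1]; move: xp hp; rewrite -ball_normE /= => xp hp.
have -> : p - (x + s *: h) = (1 - s) *: (p - x) + s *: (p - (x + h)).
  by apply/rowP => k; rewrite !mxE; ring.
apply: (le_lt_trans (ler_normD _ _)); rewrite !normrZ !ger0_norm ?subr_ge0//.
have [->|sn] := eqVneq s 0; first by rewrite subr0 mul1r mul0r addr0.
have s0' : 0 < s by rewrite lt_neqAle eq_sym sn.
have H1 : (1 - s) * `|p - x| <= (1 - s) * d by rewrite ler_wpM2l ?subr_ge0// ltW.
have H2 : s * `|p - (x + h)| < s * d by rewrite ltr_pM2l.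
by have := ler_ltD H1 H2; rewrite -mulrDl addrNK mul1r.
Qed.

Lemma lipschitz_ball f (p : C2 R) (d K : R) : 0 <= K ->
  (forall y, ball p d y -> differentiable f y) ->
  (forall y j, ball p d y -> `|partial j f y| <= K) ->
  forall x h, ball p d x -> ball p d (x + h) -> `|f (x + h) - f x| <= 4 * (K * `|h|).
Proof.
move=> K0 df Kf x h xp hp.
have inB s := @ball_segment p d x h s xp hp.
have [|s s01 ->] := @mvt_line R f x h (fun s => 'D_h f (x + s *: h)).
  by move=> s s01; apply: is_derive_line; apply: diff_derivable; apply: df; exact: inB.
have s01' : 0 <= s <= 1 by case/andP: s01 => ? ?; rewrite !ltW.
rewrite derive_partials; last by apply: df; exact: inB.
rewrite (le_trans (ler_norm_sum _ _ _))//.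
rewrite (_ : 4 * _ = \sum_(j < 4) `|h| * K); last first.
  by rewrite sumr_const card_ord -[RHS]mulr_natl; ring.
apply: ler_sum => j _; rewrite normrM ler_pM//; first exact: mx_norm_coord.
by apply: Kf; exact: inB.
Qed.

(** The constant is the same for all base points of the ball: this uniformity
    gives a common radius to the tangent balls at nearby boundary points. *)
Lemma taylor2_ball f (p : C2 R) (d K : R) : 0 <= K ->
  (forall y, ball p d y -> differentiable f y) ->
  (forall y j, ball p d y -> differentiable (partial j f) y) ->
  (forall y j k, ball p d y -> `|partial k (partial j f) y| <= K) ->
  forall x h, ball p d x -> ball p d (x + h) ->
  `|f (x + h) - f x - \sum_j h 0 j * partial j f x| <= 16 * (K * `|h| ^+ 2).
Proof.
move=> K0 df dg Kf x h xp hp.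
have inB s := @ball_segment p d x h s xp hp.
have [|s s01 ->] := @mvt_line R f x h (fun s => 'D_h f (x + s *: h)).
  by move=> s s01; apply: is_derive_line; apply: diff_derivable; apply: df; exact: inB.
have s01' : 0 <= s <= 1 by case/andP: s01 => ? ?; rewrite !ltW.
rewrite derive_partials; last by apply: df; exact: inB.
rewrite -sumrB (le_trans (ler_norm_sum _ _ _))//.
rewrite (_ : 16 * _ = \sum_(j < 4) `|h| * (4 * (K * `|h|))); last first.
  by rewrite sumr_const card_ord -[RHS]mulr_natl; ring.
apply: ler_sum => j _; rewrite -mulrBr normrM ler_pM//; first exact: mx_norm_coord.
apply: (le_trans (lipschitz_ball K0 (dg^~ j) _ xp (inB s s01'))).
  by move=> y k /Kf.
rewrite ler_pM2l// ler_wpM2l// normrZ.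
by case/andP: s01' => s0 s1; rewrite ger0_norm// ler_piMl.
Qed.

End SecondOrder.

(** * Euclidean geometry *)

Section Euclid.
Variable R : realType.
Implicit Types (x y u v w : C2 R).

Lemma dotpC u v : dotp u v = dotp v u.
Proof. by apply: eq_bigr => j _; rewrite mulrC. Qed.

Lemma dotpDl u v w : dotp (u + v) w = dotp u w + dotp v w.
Proof. by rewrite -big_split; apply: eq_bigr => j _; rewrite mxE mulrDl. Qed.

Lemma dotpZl (a : R) v w : dotp (a *: v) w = a * dotp v w.
Proof. by rewrite mulr_sumr; apply: eq_bigr => j _; rewrite mxE mulrA. Qed.

Lemma dotpDr u v w : dotp w (u + v) = dotp w u + dotp w v.
Proof. by rewrite !(dotpC w) dotpDl. Qed.

Lemma dotpZr (a : R) v w : dotp w (a *: v) = a * dotp w v.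
Proof. by rewrite !(dotpC w) dotpZl. Qed.

Lemma dotpNl v w : dotp (- v) w = - dotp v w.
Proof. by rewrite -scaleN1r dotpZl mulN1r. Qed.

Lemma dotpNr v w : dotp w (- v) = - dotp w v.
Proof. by rewrite !(dotpC w) dotpNl. Qed.

Lemma dotp0l v : dotp 0 v = 0.
Proof. by rewrite /dotp big1 => // j _; rewrite mxE mul0r. Qed.

Lemma dotp0r v : dotp v 0 = 0. Proof. by rewrite dotpC dotp0l. Qed.

Definition dotpE := (dotpDl, dotpDr, dotpNl, dotpNr, dotpZl, dotpZr).

Lemma dotp_ge0 v : 0 <= dotp v v.
Proof. by apply: sumr_ge0 => j _; rewrite -expr2 sqr_ge0. Qed.

Lemma dotp_delta v (j : 'I_4) : dotp v (delta_mx 0 j) = v 0 j.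
Proof.
rewrite /dotp (bigD1 j)//= big1 => [|i ij]; last by rewrite mxE (negbTE ij) andbF mulr0.
by rewrite mxE !eqxx mulr1 addr0.
Qed.

Lemma enorm_sq v : enorm v ^+ 2 = dotp v v.
Proof.
have E : \sum_(j < 4) v 0 j ^+ 2 = dotp v v by apply: eq_bigr => j _; rewrite expr2.
by rewrite /enorm E sqr_sqrtr// dotp_ge0.
Qed.

Lemma enorm_ge0 v : 0 <= enorm v. Proof. exact: sqrtr_ge0. Qed.

Lemma enorm_coord v j : `|v 0 j| <= enorm v.
Proof.
rewrite -sqrtr_sqr ler_wsqrtr// (bigD1 j)//= lerDl.
by apply: sumr_ge0 => i _; exact: sqr_ge0.
Qed.

Lemma norm_le_enorm v : `|v| <= enorm v.
Proof. by apply: mx_norm_le => [|j]; [exact: enorm_ge0|exact: enorm_coord]. Qed.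

Lemma enorm_le_norm v : enorm v <= 2 * `|v|.
Proof.
rewrite -(@ler_pXn2r _ 2)// ?nnegrE ?enorm_ge0 ?mulr_ge0// enorm_sq.
rewrite (_ : (2 * `|v|) ^+ 2 = \sum_(j < 4) `|v| ^+ 2); last first.
  by rewrite sumr_const card_ord -[RHS]mulr_natl; ring.
apply: ler_sum => j _; rewrite -expr2 -real_normK ?num_real//.
by rewrite ler_pXn2r// ?nnegrE// mx_norm_coord.
Qed.

Lemma enorm0_eq0 v : enorm v = 0 -> v = 0.
Proof.
move=> v0; apply/rowP => j; rewrite mxE; apply/eqP; rewrite -normr_le0 -v0.
exact: enorm_coord.
Qed.

Lemma enorm0 : enorm (0 : C2 R) = 0.
Proof.
by apply/eqP; rewrite -sqrf_eq0 enorm_sq dotp0l.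
Qed.

Lemma enormZ (a : R) v : enorm (a *: v) = `|a| * enorm v.
Proof.
apply/eqP; rewrite -(@eqrXn2 _ 2)// ?mulr_ge0 ?enorm_ge0//.
by rewrite exprMn !enorm_sq dotpZl dotpZr real_normK ?num_real// mulrA expr2.
Qed.

Lemma enormN v : enorm (- v) = enorm v.
Proof. by rewrite -scaleN1r enormZ normrN normr1 mul1r. Qed.

Lemma enormB u v : enorm (u - v) = enorm (v - u).
Proof. by rewrite -enormN opprB. Qed.

Lemma cauchy_schwarz u v : dotp u v <= enorm u * enorm v.
Proof.
have [u0|u0] := eqVneq (enorm u) 0.
  by rewrite u0 mul0r (enorm0_eq0 u0) dotp0l.
have [v0|v0] := eqVneq (enorm v) 0.
  by rewrite v0 mulr0 (enorm0_eq0 v0) dotp0r.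
have u1 : 0 < enorm u by rewrite lt_neqAle eq_sym u0 enorm_ge0.
have v1 : 0 < enorm v by rewrite lt_neqAle eq_sym v0 enorm_ge0.
have := dotp_ge0 (enorm v *: u - enorm u *: v).
rewrite !dotpE -!enorm_sq (dotpC v u) => H.
have : 0 <= (enorm u * enorm v) * (enorm u * enorm v - dotp u v) * 2.
  by apply: le_trans H _; rewrite le_eqVlt; apply/orP; left; apply/eqP; ring.
by rewrite pmulr_lge0// pmulr_rge0 ?mulr_gt0// subr_ge0.
Qed.

Lemma enormD u v : enorm (u + v) <= enorm u + enorm v.
Proof.
rewrite -(@ler_pXn2r _ 2)// ?nnegrE ?addr_ge0 ?enorm_ge0//.
rewrite enorm_sq !dotpE -!enorm_sq (dotpC v u).
have := cauchy_schwarz u v; lra.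
Qed.

Lemma enormBD u v w : enorm (u - w) <= enorm (u - v) + enorm (v - w).
Proof. by apply: le_trans (enormD _ _); rewrite addrA subrK. Qed.

Lemma ball_enorm (p : C2 R) (e : R) y : enorm (p - y) < e -> ball p e y.
Proof. by rewrite -ball_normE /=; apply: le_lt_trans; exact: norm_le_enorm. Qed.

Lemma enorm_lt_nbhs (c : C2 R) (r : R) x : enorm (x - c) < r ->
  \forall y \near x, enorm (y - c) < r.
Proof.
move=> xr; have e0 : 0 < (r - enorm (x - c)) / 2 by rewrite divr_gt0 ?subr_gt0.
near=> y; have : `|x - y| < (r - enorm (x - c)) / 2.
  by near: y; apply/nbhs_ballP; exists ((r - enorm (x - c)) / 2) => // z; rewrite -ball_normE.
have := enorm_le_norm (x - y); have := enormBD y x c.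
rewrite (enormB y x); lra.
Unshelve. all: by end_near. Qed.

Lemma continuous_enorm (c : C2 R) : continuous (fun x : C2 R => enorm (c - x)).
Proof.
move=> x; apply/(@cvgrPdist_le R R^o _ (nbhs x)) => e e0.
near=> y; have : `|x - y| <= e / 2.
  near: y; apply/nbhs_ballP; exists (e / 2) => [|z]; first by rewrite /= divr_gt0.
  by rewrite -ball_normE => /ltW.
have := enorm_le_norm (x - y); have := enormBD c x y; have := enormBD c y x.
rewrite (enormB y x) ler_norml; lra.
Unshelve. all: by end_near. Qed.

(** Concavity of the square root: sqrt (a^2 + 2 k) <= a + k / a, with a the
    norm of u. The expansion of the distance to the centre of a ball comes
    from here. *)
Lemma enorm_tangent u v : 0 < enorm u ->
  enorm (u + v) <= enorm u + (dotp u v + enorm v ^+ 2 / 2) / enorm u.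
Proof.
move=> u0; set a := enorm u.
have E : enorm (u + v) ^+ 2 = a ^+ 2 + 2 * (dotp u v + enorm v ^+ 2 / 2).
  by rewrite !enorm_sq !dotpE (dotpC v u); field.
rewrite -(ler_pM2l u0) -/a mulrDr mulrCA divff ?gt_eqF// mulr1.
have := sqr_ge0 (enorm (u + v) - a); rewrite -/a in u0 *; nra.
Qed.
End Euclid.

(** * Smooth functions *)

Section SmoothOn.
Variable R : realType.
Implicit Types (U : set (C2 R)) (f : C2 R -> R).

Lemma smooth_partial U f j : smooth_on U f -> smooth_on U (partial j f).
Proof.
move=> sf s; have -> : partials s (partial j f) = partials (s ++ [:: j]) f.
  by rewrite /partials foldr_cat.
exact: sf.
Qed.

Lemma smooth_differentiable U f x : open U -> smooth_on U f -> U x -> differentiable f x.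
Proof.
move=> oU sf Ux; apply: differentiable_C1.
  have := open_nbhs_nbhs (conj oU Ux); apply: filterS => y Uy j.
  by have [_] := sf [::] y Uy.
by move=> j; have [] := sf [:: j] x Ux.
Qed.

Lemma smooth_continuous U f x : smooth_on U f -> U x -> {for x, continuous f}.
Proof. by move=> sf Ux; have [] := sf [::] x Ux. Qed.

End SmoothOn.

(** * The signed distance between two tangent balls *)

Section Distance.
Variable R : realType.
Variable Omega : set (C2 R).
Hypothesis oOmega : open Omega.
Implicit Types (x y z c : C2 R).

Lemma boundaryE x : boundary Omega x <-> closure Omega x /\ ~ Omega x.
Proof. by rewrite /boundary ((interior_id Omega).1 oOmega); split. Qed.

Lemma boundary_compact : bounded_set Omega -> compact (boundary Omega).
Proof.
move=> [M [Mr bM]]; apply: bounded_closed_compact; last first.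
  apply: closedI; first exact: closed_closure.
  by apply: open_closedC; exact: open_interior.
exists (M + 1); split; first by rewrite num_real.
move=> N MN x [clx _].
have : closed [set y : C2 R | `|y| <= N].
  have -> : [set y : C2 R | `|y| <= N] = (fun y => `|y|) @^-1` [set t : R | t <= N] by [].
  by apply: closed_comp (@closed_le _ N) => y _; exact: norm_continuous.
move=> /closure_id; rewrite /= => E.
suff : closure [set y : C2 R | `|y| <= N] x by rewrite -E.
apply: closure_subset clx => y /= Oy; apply: bM => //.
by apply: lt_trans MN; rewrite ltrDl.
Qed.

(** A segment is connected, and the part of it inside Omega would be both open
    and closed in it if it avoided the boundary. *)
Lemma segment_crosses x y : Omega x -> ~ Omega y ->
  exists2 s : R, 0 <= s <= 1 & boundary Omega (x + s *: (y - x)).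
Proof.
move=> Ox Oy; apply: contrapT => nex.
pose g (s : R) : C2 R := x + s *: (y - x).
have cg : continuous g.
  move=> s; apply: cvgD; first exact: cvg_cst.
  by apply: cvgZr_tmp; exact: cvg_id.
have nb s : 0 <= s <= 1 -> closure Omega (g s) -> Omega (g s).
  move=> s01 cl; apply: contrapT => nO; apply: nex; exists s => //.
  exact/boundaryE.
have := @segment_connected R 0 1; move=> /(_ (`[0, 1] `&` g @^-1` Omega)).
have E : `[0, 1]%classic `&` g @^-1` Omega = `[0, 1]%classic.
  apply: (@segment_connected R 0 1).
  - exists 0; split; first by rewrite /= in_itv /= lexx ler01.
    by rewrite /g /= scale0r addr0.
  - exists (g @^-1` Omega) => //.
    by apply: open_comp oOmega => s _; exact: cg.
  - exists (g @^-1` closure Omega).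
      by apply: closed_comp (@closed_closure _ Omega) => s _; exact: cg.
    apply/seteqP; split => s /= [s01 Os]; split => //; first exact: subset_closure.
    by apply: nb => //; move: s01; rewrite in_itv.
have : (`[0, 1]%classic `&` g @^-1` Omega) 1.
  by rewrite E /= in_itv /= lexx ler01.
by move=> [_]; rewrite /g /= scale1r addrC subrK.
Qed.

Lemma edistance_le x y : boundary Omega y -> edistance (boundary Omega) x <= enorm (x - y).
Proof.
move=> By; apply: ge_inf; last by exists y.
by exists 0 => _ [z _ <-]; exact: enorm_ge0.
Qed.

Lemma edistance_attained x : bounded_set Omega -> boundary Omega !=set0 ->
  exists2 y, boundary Omega y & edistance (boundary Omega) x = enorm (x - y).
Proof.
move=> bO ne.
have [|y] := @compact_EVT_min _ R (fun y => enorm (x - y)) _ ne (boundary_compact bO).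
  by apply: continuous_subspaceT => y; exact: continuous_enorm.
rewrite inE => By H; exists y => //; apply/eqP; rewrite eq_le edistance_le//=.
apply: lb_le_inf; first by exists (enorm (x - y)), y.
by move=> _ [z Bz <-]; apply: H; rewrite inE.
Qed.

Section Balls.
Hypothesis ne : boundary Omega !=set0.
Variables (c : C2 R) (r : R).
Hypothesis r0 : 0 < r.

Lemma edistance_ge_ball x : (forall z, enorm (z - c) < r -> ~ boundary Omega z) ->
  r - enorm (x - c) <= edistance (boundary Omega) x.
Proof.
move=> H; apply: lb_le_inf; first by case: ne => y By; exists (enorm (x - y)), y.
move=> _ [y By <-].
have : r <= enorm (y - c) by rewrite leNgt; apply/negP => /H.
have := enormBD y x c; rewrite (enormB y x); lra.
Qed.

(** The segment from c to x joins the two sides, hence contains a boundary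
    point, and this point is outside the ball. *)
Lemma edistance_le_ball x : (forall z, enorm (z - c) < r -> ~ boundary Omega z) ->
  (Omega c <-> ~ Omega x) -> edistance (boundary Omega) x <= enorm (x - c) - r.
Proof.
move=> H Ocx.
have [s /andP[s0 s1] Bz] : exists2 s : R, 0 <= s <= 1 & boundary Omega (c + s *: (x - c)).
  have [Oc|Oc] := pselect (Omega c); first by apply: segment_crosses => //; exact/Ocx.
  have Ox : Omega x by apply: contrapT => /Ocx.
  have [s s01 Bs] := segment_crosses Ox Oc; exists (1 - s).
    by move: s01 => /andP[? ?]; rewrite subr_ge0 lerBlDr lerDl; apply/andP.
  by congr (boundary Omega _): Bs; apply/rowP => k; rewrite !mxE; ring.
apply: (le_trans (edistance_le x Bz)).
have -> : x - (c + s *: (x - c)) = (1 - s) *: (x - c).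
  by apply/rowP => k; rewrite !mxE; ring.
have : r <= enorm (c + s *: (x - c) - c) by rewrite leNgt; apply/negP => /H.
rewrite addrAC subrr add0r !enormZ !ger0_norm ?subr_ge0//; lra.
Qed.
End Balls.

Lemma boundary_notin y : boundary Omega y -> ~ Omega y.
Proof. by move=> /boundaryE[]. Qed.

Lemma inner_ball_boundary c (r : R) z :
  (forall w, enorm (w - c) < r -> Omega w) -> enorm (z - c) < r -> ~ boundary Omega z.
Proof. by move=> H /H Oz /boundary_notin. Qed.

Lemma outer_ball_boundary c (r : R) z :
  (forall w, enorm (w - c) < r -> ~ Omega w) -> enorm (z - c) < r -> ~ boundary Omega z.
Proof.
move=> H zc /boundaryE[cl _].
by have [w [Ow /H]] := cl _ (enorm_lt_nbhs zc).
Qed.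

Local Notation delta := (signed_distance Omega).

Lemma edistance_ge0 x : 0 <= edistance (boundary Omega) x.
Proof.
have [ne|/nonemptyPn e] := pselect (boundary Omega !=set0).
  apply: lb_le_inf; first by case: ne => y By; exists (enorm (x - y)), y.
  by move=> _ [y _ <-]; exact: enorm_ge0.
by rewrite /edistance e image_set0 inf0.
Qed.

(** A ball inside Omega gives an upper barrier for the signed distance on both
    sides of the boundary; the next lemma is the symmetric lower barrier. *)
Lemma sdist_le_inner c (r : R) x : boundary Omega !=set0 -> 0 < r ->
  (forall w, enorm (w - c) < r -> Omega w) -> delta x <= enorm (x - c) - r.
Proof.
move=> ne r0 H; have Hb z := inner_ball_boundary (z := z) H.
have Oc : Omega c by apply: H; rewrite subrr enorm0.
rewrite /signed_distance; case: ifPn => [|] xO.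
  by have := edistance_ge_ball ne x Hb; lra.
by apply: edistance_le_ball => //; split => // _; move/negP: xO; rewrite inE.
Qed.

Lemma sdist_ge_outer c (r : R) x : boundary Omega !=set0 -> 0 < r ->
  (forall w, enorm (w - c) < r -> ~ Omega w) -> r - enorm (x - c) <= delta x.
Proof.
move=> ne r0 H; have Hb z := outer_ball_boundary (z := z) H.
have Oc : ~ Omega c by apply: H; rewrite subrr enorm0.
rewrite /signed_distance; case: ifPn => [|] xO.
  rewrite inE in xO.
  suff : edistance (boundary Omega) x <= enorm (x - c) - r by lra.
  by apply: edistance_le_ball => //; split => // /(_ xO).
exact: edistance_ge_ball.
Qed.

(** The two balls touch at y, so that the boundary is pinched between them
    there and n is its outer unit normal. *)
Definition tangent_balls y (n : C2 R) (r : R) : Prop :=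
  [/\ enorm n = 1, 0 < r,
    (forall w, enorm (w - (y - r *: n)) < r -> Omega w) &
    (forall w, enorm (w - (y + r *: n)) < r -> ~ Omega w)].

(** The signed distance lies between x |-> r - |x - (y + r n)| and x |-> |x -
    (y - r n)| - r. At the points y + t n of the normal line these two
    functions have the same value t and the same gradient n, and their second
    derivatives are at most 2 / r when |t| <= r / 2. No regularity of the
    signed distance is presupposed. *)
Lemma sdist_taylor y n (r t : R) h : boundary Omega !=set0 -> tangent_balls y n r ->
  `|t| <= r / 2 ->
  `|delta (y + t *: n + h) - t - dotp n h| <= enorm h ^+ 2 / r.
Proof.
move=> ne [n1 r0 bi bo]; rewrite ler_norml => /andP[t1 t2].
have nn : dotp n n = 1 by rewrite -enorm_sq n1 expr1n.
have half : 2^-1 * r <= r + t by lra.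
have up : delta (y + t *: n + h) <= t + dotp n h + enorm h ^+ 2 / r.
  apply: le_trans (sdist_le_inner _ ne r0 bi) _.
  have -> : y + t *: n + h - (y - r *: n) = (r + t) *: n + h.
    by apply/rowP => k; rewrite !mxE; ring.
  have rt : 0 < r + t by lra.
  have E : enorm ((r + t) *: n) = r + t by rewrite enormZ n1 mulr1 gtr0_norm.
  have := @enorm_tangent _ ((r + t) *: n) h; rewrite E dotpZl => /(_ rt).
  have -> : ((r + t) * dotp n h + enorm h ^+ 2 / 2) / (r + t) =
     dotp n h + enorm h ^+ 2 / (2 * (r + t)).
    by field; rewrite gt_eqF.
  suff : enorm h ^+ 2 / (2 * (r + t)) <= enorm h ^+ 2 / r by lra.
  by rewrite ler_wpM2l ?sqr_ge0// lef_pV2 ?posrE//; lra.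
have lo : t + dotp n h - enorm h ^+ 2 / r <= delta (y + t *: n + h).
  apply: le_trans (sdist_ge_outer _ ne r0 bo).
  have -> : y + t *: n + h - (y + r *: n) = (r - t) *: (- n) + h.
    by apply/rowP => k; rewrite !mxE; ring.
  have rt : 0 < r - t by lra.
  have E : enorm ((r - t) *: - n) = r - t by rewrite enormZ enormN n1 mulr1 gtr0_norm.
  have := @enorm_tangent _ ((r - t) *: - n) h; rewrite E dotpZl dotpNl => /(_ rt).
  have -> : ((r - t) * - dotp n h + enorm h ^+ 2 / 2) / (r - t) =
     - dotp n h + enorm h ^+ 2 / (2 * (r - t)).
    by field; rewrite gt_eqF.
  suff : enorm h ^+ 2 / (2 * (r - t)) <= enorm h ^+ 2 / r by lra.
  by rewrite ler_wpM2l ?sqr_ge0// lef_pV2 ?posrE//; lra.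
rewrite ler_norml; lra.
Qed.

(** Otherwise the point dividing the segment of centres in the ratio of the
    radii belongs to both balls. *)
Lemma disjoint_balls c x (r d : R) : 0 < r -> 0 < d ->
  (forall w, enorm (w - c) < r -> enorm (w - x) < d -> False) ->
  d + r <= enorm (x - c).
Proof.
move=> r0 d0 H; rewrite leNgt; apply/negP => lt.
have dr : 0 < d + r by rewrite addr_gt0.
apply: (H (x + (d / (d + r)) *: (c - x))).
  have -> : x + (d / (d + r)) *: (c - x) - c = (r / (d + r)) *: (x - c).
    by apply/rowP => k; rewrite !mxE; field; rewrite gt_eqF.
  rewrite enormZ gtr0_norm ?divr_gt0// mulrAC ltr_pdivrMr//.
  by rewrite ltr_pM2l.
rewrite addrAC subrr add0r enormZ gtr0_norm ?divr_gt0// mulrAC ltr_pdivrMr//.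
by rewrite ltr_pM2l// enormB.
Qed.

(** Equality case of the triangle inequality. *)
Lemma tangency_vec (w n : C2 R) (r d : R) : enorm n = 1 -> 0 < r -> enorm w = d ->
  d + r <= enorm (w - r *: n) -> w = - (d *: n).
Proof.
move=> n1 r0 wd le; have d0 : 0 <= d by rewrite -wd enorm_ge0.
have nn : dotp n n = 1 by rewrite -enorm_sq n1 expr1n.
have ww : dotp w w = d ^+ 2 by rewrite -enorm_sq wd.
have : (d + r) ^+ 2 <= enorm (w - r *: n) ^+ 2.
  by rewrite ler_pXn2r ?nnegrE ?enorm_ge0// addr_ge0// ltW.
rewrite enorm_sq !dotpE nn (dotpC n) ww => le2.
have le3 : dotp w n <= - d by rewrite -(ler_pM2l r0); nra.
apply/eqP; rewrite -addr_eq0; apply/eqP; apply: enorm0_eq0; apply/eqP.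
rewrite -sqrf_eq0 eq_le sqr_ge0 andbT enorm_sq !dotpE nn (dotpC n) ww; nra.
Qed.

Lemma tangency_eq y n x (r d : R) : enorm n = 1 -> 0 < r -> enorm (x - y) = d ->
  d + r <= enorm (x - (y + r *: n)) -> x = y - d *: n.
Proof.
move=> n1 r0 xd; rewrite opprD addrA => le.
by have /eqP := tangency_vec n1 r0 xd le; rewrite subr_eq addrC => /eqP.
Qed.

(** The open ball around x through y contains no boundary point, so that it
    lies on one side and does not meet the tangent ball of the other side. Two
    disjoint balls whose closures share y have their centres aligned with y.
    *)
Lemma sdist_projection x y n (r : R) : boundary Omega y ->
  edistance (boundary Omega) x = enorm (x - y) -> tangent_balls y n r ->
  x = y + delta x *: n.
Proof.
move=> By exy [n1 r0 bi bo].
have [d0|d0] := eqVneq (enorm (x - y)) 0.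
  have -> : delta x = 0 by rewrite /signed_distance exy d0 oppr0 if_same.
  by rewrite scale0r addr0; apply/eqP; rewrite -subr_eq0; apply/eqP; exact: enorm0_eq0.
have {}d0 : 0 < enorm (x - y) by rewrite lt_neqAle eq_sym d0 enorm_ge0.
(* the ball around x through y lies on one side of the boundary *)
have far w : enorm (w - x) < enorm (x - y) -> (Omega w <-> Omega x).
  move=> wx.
  have nB s : 0 <= s <= 1 -> ~ boundary Omega (x + s *: (w - x)).
    move=> /andP[s0 s1] /(edistance_le x); rewrite exy leNgt => /negP; apply.
    rewrite enormB addrAC subrr add0r enormZ ger0_norm//; apply: le_lt_trans wx.
    by rewrite ler_piMl// enorm_ge0.
  split => [Ow|Ox]; apply: contrapT => nO.
    have [s s01 Bs] := segment_crosses Ow nO; apply: (nB (1 - s)).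
      by move: s01 => /andP[? ?]; rewrite subr_ge0 lerBlDr lerDl; apply/andP.
    by congr (boundary Omega _): Bs; apply/rowP => k; rewrite !mxE; ring.
  by have [s s01 Bs] := segment_crosses Ox nO; exact: (nB s).
have [Ox|Ox] := pselect (Omega x).
  have -> : delta x = - enorm (x - y) by rewrite /signed_distance mem_set ?exy.
  rewrite scaleNr; apply: (tangency_eq (r := r)) => //.
  by apply: disjoint_balls => // w wo /far wx; apply: (bo w) => //; exact/wx.
have -> : delta x = enorm (x - y) by rewrite /signed_distance memNset ?exy.
rewrite -[_ *: n]opprK -scalerN; apply: (tangency_eq (r := r)) => //.
  by rewrite enormN.
by rewrite scalerN; apply: disjoint_balls => // w wo /far wx; apply: Ox; apply/wx; exact: bi.
Qed.

End Distance.

(** * Derivatives along lines and curves *)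

Section ChainRules.
Variable R : realType.
Implicit Types (f : C2 R -> R) (x v : C2 R).

Lemma is_derive_lineP f x v (df : R) :
  is_derive x v f df <-> is_derive (0 : R) 1 (fun t : R => f (x + t *: v)) df.
Proof.
have E : (fun k : R => k^-1 *: (((fun t : R => f (x + t *: v)) \o shift 0) (k *: 1)
    - f (x + 0 *: v))) = (fun k => k^-1 *: ((f \o shift x) (k *: v) - f x)).
  apply/funext => k /=; rewrite addr0 scale0r addr0; congr (_ *: (f _ - _)).
  by rewrite [k%:A]mulr1 addrC.
split=> -[dv dE]; split.
- by rewrite /derivable E.
- by rewrite /derive E.
- by move: dv; rewrite /derivable E.
- by move: dE; rewrite /derive E.
Qed.

Lemma is_derive_comp_real (g : R -> R) f x v (a b : R) :
  is_derive x v f a -> is_derive (f x) 1 g b -> is_derive x v (g \o f) (b * a).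
Proof.
move=> /is_derive_lineP fa gb; apply/is_derive_lineP.
by apply: (@is_derive1_comp _ g (fun t : R => f (x + t *: v)) 0); rewrite ?scale0r ?addr0.
Qed.

Lemma is_derive_curve f (Y : R -> C2 R) x v : Y 0 = x -> differentiable f x ->
  is_derive (0 : R) 1 Y v -> is_derive (0 : R) 1 (f \o Y) ('D_v f x).
Proof.
move=> Y0 df [dY EY]; have dY' : differentiable Y 0 by apply/derivable1_diffP.
rewrite -Y0 in df *.
have dfY := @differentiable_comp R R (C2 R) R^o Y f 0 dY' df.
split; first exact/derivable1_diffP.
by rewrite deriveE// diff_comp//= -(deriveE _ dY') EY deriveE.
Qed.

End ChainRules.

Lemma continuous_near (R : realType) (W : normedModType R) (f : C2 R -> W) (x : C2 R) :
  (forall e : R, 0 < e -> \forall y \near x, `|f x - f y| <= e) ->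
  {for x, continuous f}.
Proof.
move=> H; apply/(@cvgrPdist_le R W _ (nbhs x)) => e e0.
by near=> y; near: y; exact: H.
Unshelve. all: by end_near. Qed.

Lemma is_derive_affine (R : realType) (p v : C2 R) :
  is_derive (0 : R) 1 (fun s : R => p + s *: v : C2 R) v.
Proof.
have L : (fun h : R => h^-1 *: (((fun s : R => p + s *: v) \o shift 0) (h *: 1)
    - (p + 0 *: v)) : C2 R) @ 0^' --> v.
  apply: (cvg_near_cst v); near=> h.
  have h0 : h != 0 by near: h; exact: nbhs_dnbhs_neq.
  rewrite /= scale0r !addr0 [h%:A]mulr1 addrC addKr scalerA mulVf// scale1r//.
by split; [apply/cvg_ex; exists v|exact: cvg_lim L].
Unshelve. all: by end_near. Qed.

Lemma cvg_affine (R : realType) (p v : C2 R) :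
  (fun s : R => p + s *: v : C2 R) @ (0 : R) --> p.
Proof.
have [dY _] := is_derive_affine p v.
have dY' : differentiable (fun s : R => p + s *: v : C2 R) 0 by apply/derivable1_diffP.
have E0 : p + (0 : R) *: v = p by rewrite scale0r addr0.
have C : (fun s : R => p + s *: v : C2 R) @ (0 : R) --> (p + (0 : R) *: v : C2 R).
  exact: differentiable_continuous dY'.
by move: C; rewrite E0.
Qed.

(** * The unit normal field of a defining function *)

Section UnitNormal.
Variable R : realType.
Implicit Types (rho : C2 R -> R) (x y v w : C2 R) (U : set (C2 R)).

Definition unit_normal rho y : C2 R := (enorm (rgrad rho y))^-1 *: rgrad rho y.

(** The Hessian matrix of rho at y applied to w. *)
Definition grad_deriv rho y w : C2 R := \row_(k < 4) 'D_w (partial k rho) y.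

Lemma enorm_sqDZ v w (a : R) : dotp w w = 1 ->
  enorm (v + a *: w) ^+ 2 = dotp v v + 2 * a * dotp v w + a ^+ 2.
Proof. by move=> ww; rewrite enorm_sq !dotpE ww (dotpC w); ring. Qed.

Lemma ler_term_sum (F : 'I_4 -> R) j : (forall i, 0 <= F i) -> F j <= \sum_i F i.
Proof. by move=> F0; rewrite (bigD1 j)//= lerDl sumr_ge0. Qed.

Lemma enorm_gt0 v : v != 0 -> 0 < enorm v.
Proof.
move=> v0; rewrite lt_neqAle enorm_ge0 andbT eq_sym; apply: contra_neq v0.
exact: enorm0_eq0.
Qed.

Lemma unit_normal_norm rho y : rgrad rho y != 0 -> enorm (unit_normal rho y) = 1.
Proof.
move=> /enorm_gt0 g0; rewrite enormZ gtr0_norm ?invr_gt0// mulVf// gt_eqF//.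
Qed.

Lemma differentiable_enorm_rgrad rho y :
  (forall j, differentiable (partial j rho) y) -> rgrad rho y != 0 ->
  differentiable (fun z => enorm (rgrad rho z)) y /\
  forall w, 'D_w (fun z => enorm (rgrad rho z)) y = dotp (grad_deriv rho y w) (unit_normal rho y).
Proof.
move=> df g0.
have Eq : (fun z => enorm (rgrad rho z)) =
    Num.sqrt \o (fun z => \sum_(j < 4) partial j rho z ^+ 2).
  by apply/funext => z /=; congr Num.sqrt; apply: eq_bigr => j _; rewrite mxE.
set q := fun z => \sum_(j < 4) partial j rho z ^+ 2.
have qE : q = \sum_(j < 4) (partial j rho * partial j rho).
  by apply/funext => z; rewrite /q fct_sumE; apply: eq_bigr => j _; rewrite expr2.
have dq : differentiable q y.
  by rewrite qE; apply: differentiable_sum => j; apply: differentiableM.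
have q0 : 0 < q y.
  have -> : q y = enorm (rgrad rho y) ^+ 2.
    by rewrite enorm_sq; apply: eq_bigr => j _; rewrite !mxE expr2.
  by rewrite exprn_gt0// enorm_gt0.
have dsq := is_derive1_sqrt q0.
split.
  rewrite Eq; apply: (@differentiable_comp R (C2 R) R^o R^o) => //.
  by apply/derivable1_diffP; case: dsq.
move=> w; rewrite Eq.
have [_ Dq] : is_derive y w q (2 * dotp (grad_deriv rho y w) (rgrad rho y)).
  split; first exact: diff_derivable.
  rewrite qE derive_sum; last by by move=> j; apply/diff_derivable/differentiableM.
  rewrite /dotp mulr_sumr; apply: eq_bigr => j _.
  rewrite deriveM; try exact: diff_derivable.
  by rewrite !mxE /GRing.scale /=; ring.
have Dq' : is_derive y w q (2 * dotp (grad_deriv rho y w) (rgrad rho y)).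
  by split => //; exact: diff_derivable.
have [_ ->] := is_derive_comp_real Dq' dsq.
have -> : Num.sqrt (q y) = enorm (rgrad rho y).
  by have := congr1 (fun g => g y) Eq.
rewrite /unit_normal dotpZr; field.
by rewrite gt_eqF// enorm_gt0.
Qed.

Lemma differentiable_unit_normal rho y k :
  (forall j, differentiable (partial j rho) y) -> rgrad rho y != 0 ->
  differentiable (fun z => unit_normal rho z 0 k) y /\
  forall w, 'D_w (fun z => unit_normal rho z 0 k) y =
    (enorm (rgrad rho y))^-1 *
      (grad_deriv rho y w 0 k - dotp (grad_deriv rho y w) (unit_normal rho y) * unit_normal rho y 0 k).
Proof.
move=> df g0.
have [dG DG] := differentiable_enorm_rgrad df g0.
have G0 : enorm (rgrad rho y) != 0 by rewrite gt_eqF// enorm_gt0.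
have -> : (fun z => unit_normal rho z 0 k) =
    (fun z => (enorm (rgrad rho z))^-1) * partial k rho.
  by apply/funext => z; rewrite !mxE.
have dV : differentiable (fun z => (enorm (rgrad rho z))^-1) y by exact: differentiableV.
split; first exact: differentiableM.
move=> w; rewrite deriveM; try exact: diff_derivable.
rewrite deriveV//; last exact: diff_derivable.
rewrite DG /GRing.scale /= !mxE.
by field.
Qed.

End UnitNormal.

(** * Two derivatives of the signed distance at the boundary *)

Section LocalGeometry.
Variables (R : realType) (Omega : set (C2 R)) (rho : C2 R -> R) (U : set (C2 R)).
Hypothesis oOmega : open Omega.
Hypothesis bOmega : bounded_set Omega.
Hypothesis oU : open U.
Hypothesis clU : closure Omega `<=` U.
Hypothesis srho : smooth_on U rho.
Hypothesis rhoU : forall x, U x -> (Omega x <-> rho x < 0).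
Hypothesis rhoB : forall x, boundary Omega x -> rho x = 0 /\ rgrad rho x != 0.
Implicit Types (p x y w : C2 R).

Local Notation nu := (unit_normal rho).
Local Notation delta := (signed_distance Omega).

Lemma boundary_U p : boundary Omega p -> U p.
Proof. by move=> [cl _]; exact: clU. Qed.

Lemma U_near p : U p -> \forall y \near p, U y.
Proof. by move=> Up; exact: open_nbhs_nbhs. Qed.

Lemma diff_rho y : U y -> differentiable rho y.
Proof. by move=> Uy; exact: smooth_differentiable srho Uy. Qed.

Lemma diff_rho1 j y : U y -> differentiable (partial j rho) y.
Proof. by move=> Uy; exact: (smooth_differentiable oU (smooth_partial j srho)). Qed.

Lemma diff_rho2 j k y : U y -> differentiable (partial j (partial k rho)) y.
Proof.
by move=> Uy; exact: (smooth_differentiable oU (smooth_partial j (smooth_partial k srho))).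
Qed.

(** If y + h is in the ball of radius r tangent at y from inside, then |h|^2 <
    - 2 r h.nu, and rho (y + h) <= G h.nu + 16 K |h|^2 with G the norm of the
    gradient and K a bound of the second derivatives. The first-order term
    wins as soon as 32 K r <= G; K and a positive lower bound of G can be
    chosen for all y near p. *)
Lemma near_tangent_balls p : boundary Omega p -> exists2 r : R, 0 < r &
  \forall y \near p, boundary Omega y -> tangent_balls Omega y (nu y) r.
Proof.
move=> Bp; have Up := boundary_U Bp; have [_ gp] := rhoB Bp.
set g := enorm (rgrad rho p) / 2.
have g0 : 0 < g by rewrite divr_gt0// enorm_gt0.
(* K bounds the second derivatives of rho near p, and g bounds the norm of its
   gradient from below *)
have [K [K1 Kb]] : exists K : R, 1 <= K /\ forall j k, `|partial k (partial j rho) p| + 1 <= K.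
  exists (\sum_j \sum_k `|partial k (partial j rho) p| + 1); split.
    by rewrite lerDr sumr_ge0// => j _; rewrite sumr_ge0.
  move=> j k; rewrite lerD2r.
  apply: le_trans (ler_term_sum j _); last by move=> i; rewrite sumr_ge0.
  exact: (ler_term_sum (F := fun k => `|partial k (partial j rho) p|)).
have n1 : \forall y \near p, forall j, forall k, `|partial k (partial j rho) y| <= K.
  apply: (@filter_forall _ _ (fun j y => forall k, `|partial k (partial j rho) y| <= K) (nbhs p)) => j.
  apply: (@filter_forall _ _ (fun k y => `|partial k (partial j rho) y| <= K) (nbhs p)) => k.
  have /(@cvgrPdist_le R R^o _ (nbhs p))/(_ _ (@ltr01 R)) :=
    smooth_continuous (smooth_partial k (smooth_partial j srho)) Up.
  apply: filterS => y /= le1; have := Kb j k.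
  have := ler_normB (partial k (partial j rho) p)
    (partial k (partial j rho) p - partial k (partial j rho) y).
  rewrite subKr; move: le1.
  generalize (partial k (partial j rho) p) (partial k (partial j rho) y) => a b; lra.
have n2 : \forall y \near p, g <= enorm (rgrad rho y).
  have [dG _] := differentiable_enorm_rgrad (fun j => diff_rho1 j Up) gp.
  have /(@cvgrPdist_le R R^o _ (nbhs p))/(_ _ g0) := differentiable_continuous dG.
  apply: filterS => y /=; rewrite ler_norml /g.
  generalize (enorm (rgrad rho p)) (enorm (rgrad rho y)) => a b; lra.
have [d /= d0 B] := (@nbhs_ballP R (C2 R) _ _).1 (filterI (U_near Up) (filterI n1 n2)).
have K0 : 0 < K by rewrite (lt_le_trans _ K1).
have K32 : 0 < 32 * K by rewrite mulr_gt0.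
have [r [r0 rd rK]] : exists r : R, [/\ 0 < r, r <= d / 8 & 32 * K * r <= g].
  exists (Num.min (d / 8) (g / (32 * K))); split.
  - by rewrite lt_min; apply/andP; split; rewrite divr_gt0.
  - by rewrite ge_min lexx.
  - by rewrite mulrC -ler_pdivlMr// ge_min lexx orbT.
exists r => //.
have d20 : 0 < d / 2 by rewrite divr_gt0.
apply/nbhs_ballP; exists (d / 2) => //= y yp By.
have yB : ball p d y by apply: le_ball yp; lra.
have [Uy [_ gy]] := B y yB.
have [ry0 gy0] := rhoB By.
set G := enorm (rgrad rho y) in gy.
have G0 : 0 < G by rewrite enorm_gt0.
have nn : dotp (nu y) (nu y) = 1 by rewrite -enorm_sq unit_normal_norm// expr1n.
have T h : enorm h < 2 * r -> U (y + h) /\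
    `|rho (y + h) - G * dotp h (nu y)| <= 16 * K * dotp h h.
  move=> h2r; have hB : ball p d (y + h).
    move: yp; rewrite -!ball_normE /= => yp; rewrite opprD addrA.
    have := ler_normB (p - y) h; have := norm_le_enorm h; lra.
  split; first by have [] := B _ hB.
  have := @taylor2_ball _ rho p d K (ltW K0) _ _ _ y h yB hB; rewrite ry0 subr0.
  have -> : \sum_j h 0 j * partial j rho y = G * dotp h (nu y).
    rewrite dotpZr mulrA divff ?gt_eqF// mul1r.
    by apply: eq_bigr => j _; rewrite mxE.
  move=> H; apply: le_trans (H _ _ _) _.
  - by move=> z /B[Uz _]; exact: diff_rho.
  - by move=> z j /B[Uz _]; exact: diff_rho1.
  - by move=> z j k /B[_ []].
  rewrite mulrA ler_wpM2l ?mulr_ge0 ?(ltW K0)// -enorm_sq.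
  by rewrite ler_pXn2r ?nnegrE ?enorm_ge0// norm_le_enorm.
split => //; first exact: unit_normal_norm.
- move=> w wb; set h := w - y; have -> : w = y + h by rewrite addrC subrK.
  have hb : enorm (h + r *: nu y) < r by rewrite /h -addrA (addrC (- y)) -(opprB y).
  have h2 : enorm h < 2 * r.
    have := enormD (h + r *: nu y) (- (r *: nu y)).
    rewrite addrK enormN enormZ unit_normal_norm// gtr0_norm//; lra.
  have [Uh] := T h h2; rewrite ler_norml => /andP[_ le].
  apply/(rhoU Uh).
  have : enorm (h + r *: nu y) ^+ 2 < r ^+ 2.
    by rewrite ltr_pXn2r ?nnegrE ?enorm_ge0// ltW.
  rewrite enorm_sqDZ // => lt.
  have := dotp_ge0 h; move: le lt; generalize (dotp h h) (dotp h (nu y)) => hh hn le lt hh0.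
  have hn1 : hh < - (2 * r * hn) by nra.
  have hn0 : hn < 0 by rewrite -(ltr_pM2l r0); nra.
  have g1 : g * hn >= G * hn by rewrite ler_wnM2r// ltW.
  have g2 : 16 * K * hh < - (g * hn).
    have a1 : 16 * K * hh < 16 * K * - (2 * r * hn) by rewrite ltr_pM2l// mulr_gt0.
    have a2 : 32 * K * r * (- hn) <= g * (- hn) by rewrite ler_wpM2r// oppr_ge0 ltW.
    lra.
  lra.
move=> w wb; set h := w - y; have -> : w = y + h by rewrite addrC subrK.
have hb : enorm (h - r *: nu y) < r by rewrite /h -addrA -opprD.
have h2 : enorm h < 2 * r.
  have := enormD (h - r *: nu y) (r *: nu y).
  rewrite subrK enormZ unit_normal_norm// gtr0_norm//; lra.
have [Uh] := T h h2; rewrite ler_norml => /andP[le _].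
move=> /(rhoU Uh); apply/negP; rewrite -leNgt.
have : enorm (h - r *: nu y) ^+ 2 < r ^+ 2.
  by rewrite ltr_pXn2r ?nnegrE ?enorm_ge0// ltW.
rewrite -scaleNr enorm_sqDZ // => lt.
have := dotp_ge0 h; move: le lt; generalize (dotp h h) (dotp h (nu y)) => hh hn le lt hh0.
have hn1 : hh < 2 * r * hn by nra.
have hn0 : 0 < hn by rewrite -(ltr_pM2l r0); nra.
have g1 : g * hn <= G * hn by rewrite ler_wpM2r// ltW.
have g2 : 16 * K * hh <= g * hn.
  have a1 : 16 * K * hh <= 16 * K * (2 * r * hn) by rewrite ler_wpM2l ?(ltW hn1)// mulr_ge0// ltW.
  have a2 : 32 * K * r * hn <= g * hn by rewrite ler_wpM2r// ltW.
  lra.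
lra.
Qed.

Lemma sdist_abs x : `|delta x| = edistance (boundary Omega) x.
Proof.
rewrite /signed_distance; have d0 := edistance_ge0 Omega x.
by case: ifP => _; rewrite ?(normrN (edistance _ x)) ger0_norm.
Qed.

(** A nearest boundary point y of x is close to p when x is, which makes the
    uniform radius of the tangent balls available at y. *)
Lemma near_projection p : boundary Omega p -> exists2 r : R, 0 < r &
  \forall x \near p, exists y, [/\ boundary Omega y, tangent_balls Omega y (nu y) r,
    `|delta x| <= r / 2, x = y + delta x *: nu y & enorm (y - p) <= 2 * enorm (x - p)].
Proof.
move=> Bp; have [r r0 ntb] := near_tangent_balls Bp.
exists r => //.
have [d /= d0 B] := (@nbhs_ballP R (C2 R) _ _).1 ntb.
pose e := Num.min (d / 4) (r / 4).
have e0 : 0 < e by rewrite /e lt_min; apply/andP; split; rewrite divr_gt0.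
apply/nbhs_ballP; exists e => //= x; rewrite -ball_normE /= /e lt_min => /andP[xd xr].
have xp := enorm_le_norm (x - p); rewrite -(distrC p) in xp.
have ne : boundary Omega !=set0 by exists p.
have [y By yE] := edistance_attained x bOmega ne.
have le1 := edistance_le x Bp; rewrite yE in le1.
have le2 : enorm (y - p) <= 2 * enorm (x - p).
  have := enormBD y x p; rewrite (enormB y x); lra.
have tb : tangent_balls Omega y (nu y) r.
  by apply: B => //; apply: ball_enorm; rewrite enormB; lra.
exists y; split => //; last exact: sdist_projection yE tb.
by rewrite sdist_abs yE; lra.
Qed.

Lemma diff_of_quadratic (f : C2 R -> R) x (g : C2 R) (K : R) : 0 <= K ->
  (forall h, `|f (x + h) - f x - dotp g h| <= K * enorm h ^+ 2) ->
  differentiable f x /\ forall v, 'd f x v = dotp g v.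
Proof.
move=> K0 H; apply: diff_of_littleo => e e0.
have ek : 0 < e / (4 * K + 1) by rewrite divr_gt0// ltr_pwDr// mulr_ge0.
have := @nbhs0_lt R (C2 R) _ ek; apply: filterS => h hk.
rewrite (addrC h x); apply: le_trans (H h) _.
have h2 : enorm h ^+ 2 <= 4 * `|h| ^+ 2.
  rewrite (_ : 4 * `|h| ^+ 2 = (2 * `|h|) ^+ 2); last by ring.
  by rewrite ler_pXn2r ?nnegrE ?enorm_ge0 ?mulr_ge0// enorm_le_norm.
apply: (@le_trans _ _ ((4 * K * `|h|) * `|h|)).
  by apply: (le_trans (ler_wpM2l K0 h2)); rewrite le_eqVlt; apply/orP; left; apply/eqP; ring.
rewrite ler_wpM2r//.
move: hk; rewrite ltr_pdivlMr; last by rewrite ltr_pwDr// mulr_ge0.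
have := normr_ge0 h; move: `|h| => a; nra.
Qed.

(** The point x - delta(x) grad delta(x) is the nearest boundary point of x,
    and the gradient of delta at x is the unit normal there. This implicit
    equation replaces the construction of a smooth projection by the inverse
    function theorem: it can be differentiated once more at boundary points,
    where delta vanishes. *)
Lemma near_sdist_grad p : boundary Omega p ->
  \forall x \near p, [/\ differentiable delta x,
    rgrad delta x = nu (x - delta x *: rgrad delta x),
    enorm (rgrad delta x) = 1,
    `|delta x| <= enorm (x - p) &
    enorm (x - delta x *: rgrad delta x - p) <= 2 * enorm (x - p)].
Proof.
move=> Bp; have [r r0] := near_projection Bp.
apply: filterS => x [y [By tb dr xE yp]].
have ne : boundary Omega !=set0 by exists p.
have [dd dE] : differentiable delta x /\ forall v, 'd delta x v = dotp (nu y) v.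
  apply: (@diff_of_quadratic _ _ _ (r^-1)); first by rewrite invr_ge0 ltW.
  move=> h; rewrite mulrC; have := sdist_taylor oOmega h ne tb dr.
  by rewrite -xE.
have gE : rgrad delta x = nu y.
  by apply/rowP => j; rewrite mxE /partial deriveE// dE dotp_delta.
have yE : x - delta x *: rgrad delta x = y by rewrite gE {1}xE addrK.
rewrite yE; split => //; first by rewrite gE; case: tb.
by rewrite sdist_abs; exact: edistance_le.
Qed.

Lemma sdist_boundary p : boundary Omega p -> delta p = 0.
Proof.
move=> Bp; apply/eqP; rewrite -normr_le0 sdist_abs.
by apply: le_trans (edistance_le p Bp) _; rewrite subrr enorm0.
Qed.

Lemma sdist_grad_boundary p : boundary Omega p ->
  differentiable delta p /\ rgrad delta p = nu p.
Proof.
move=> Bp; have [dd gE _ _ _] := nbhs_singleton (near_sdist_grad Bp).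
by split; [exact: dd|rewrite gE (sdist_boundary Bp) scale0r subr0].
Qed.

Lemma unit_normal_continuous p k : boundary Omega p ->
  {for p, continuous (fun y => nu y 0 k)}.
Proof.
move=> Bp; have Up := boundary_U Bp; have [_ gp] := rhoB Bp.
have [dn _] := differentiable_unit_normal k (fun j => diff_rho1 j Up) gp.
exact: differentiable_continuous dn.
Qed.

Lemma sdist_grad_continuous p k : boundary Omega p ->
  {for p, continuous (partial k delta)}.
Proof.
move=> Bp; apply: (@continuous_near R (R^o)) => e e0.
have /(@cvgrPdist_le R R^o _ (nbhs p))/(_ _ e0) nc := unit_normal_continuous (k := k) Bp.
have [d /= d0 B] := (@nbhs_ballP R (C2 R) _ _).1 nc.
have d40 : 0 < d / 4 by rewrite divr_gt0.
have FF : Filter (nbhs p) := @nbhs_filter (C2 R) p.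
have N : \forall x \near p, ball p (d / 4) x by exact: nbhsx_ballx.
have F := @filterI _ _ FF _ _ N (near_sdist_grad Bp).
apply: filterS F => x [xp [_ gE _ _ yp]].
have -> : partial k delta x = rgrad delta x 0 k by rewrite mxE.
have -> : partial k delta p = rgrad delta p 0 k by rewrite mxE.
rewrite gE (sdist_grad_boundary Bp).2; apply: B.
apply: ball_enorm; rewrite enormB; apply: le_lt_trans yp _.
have A (a b : R) : a < d / 4 -> b <= 2 * a -> 2 * b < d by lra.
move: xp; rewrite -ball_normE /= distrC => xp.
exact: (A _ _ xp (enorm_le_norm (x - p))).
Qed.

(** Since delta vanishes at p, the product of delta and its gradient is
    differentiable at p as soon as the gradient is continuous there. The
    result is the tangential part of e_j. *)
Lemma is_derive_projection p j : boundary Omega p ->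
  is_derive (0 : R) 1 (fun s : R => p + s *: delta_mx 0 j
     - delta (p + s *: delta_mx 0 j) *: rgrad delta (p + s *: delta_mx 0 j))
   (delta_mx 0 j - nu p 0 j *: nu p).
Proof.
move=> Bp; have [dd gE] := sdist_grad_boundary Bp.
have H1 : is_derive (0 : R) 1 (fun s : R => p + s *: delta_mx 0 j : C2 R) (delta_mx 0 j : C2 R).
  exact: is_derive_affine.
have D1 : is_derive (0 : R) 1 (fun s : R => delta (p + s *: delta_mx 0 j)) (nu p 0 j).
  apply/is_derive_lineP; rewrite -gE mxE; apply: derivableP.
  exact: diff_derivable.
have H2 : is_derive (0 : R) 1 (fun s : R => delta (p + s *: delta_mx 0 j)
    *: rgrad delta (p + s *: delta_mx 0 j) : C2 R) (nu p 0 j *: nu p).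
  have L : (fun h : R => h^-1 *: (((fun s : R => delta (p + s *: delta_mx 0 j)
      *: rgrad delta (p + s *: delta_mx 0 j)) \o shift 0) (h *: 1)
     - delta (p + 0 *: delta_mx 0 j) *: rgrad delta (p + 0 *: delta_mx 0 j)) : C2 R) @ 0^'
     --> (nu p 0 j *: nu p : C2 R).
    rewrite scale0r addr0 (sdist_boundary Bp) scale0r.
    have -> : (fun h : R => h^-1 *: (((fun s : R => delta (p + s *: delta_mx 0 j)
      *: rgrad delta (p + s *: delta_mx 0 j)) \o shift 0) (h *: 1) - 0) : C2 R) =
      (fun h : R => (h^-1 *: (delta (p + h *: delta_mx 0 j) - 0)) *:
         rgrad delta (p + h *: delta_mx 0 j)).
      apply/funext => h /=; rewrite !subr0 addr0 [h%:A]mulr1.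
      by rewrite scalerA.
    apply: cvgZ.
      case: D1 => dv <-; rewrite /derive.
      have -> : (fun h : R => h^-1 *: (delta (p + h *: delta_mx 0 j) - 0)) =
        (fun h : R => h^-1 *: (((fun s : R => delta (p + s *: delta_mx 0 j)) \o shift 0) (h *: 1)
          - delta (p + 0 *: delta_mx 0 j))).
        apply/funext => h /=.
        by rewrite scale0r !addr0 (sdist_boundary Bp) [h%:A]mulr1.
      exact: dv.
    have E : (fun h : R => rgrad delta (p + h *: delta_mx 0 j)) =
        rgrad delta \o (fun h : R => p + h *: delta_mx 0 j) by [].
    rewrite E -gE; apply: cvg_comp; last first.
      apply: (@continuous_near R (C2 R)) => e e0.
      have F : \forall x \near p, forall k, `|partial k delta p - partial k delta x| <= e.
        apply: (@filter_forall _ _ (fun k x => `|partial k delta p - partial k delta x| <= e) (nbhs p)) => k.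
        by have /(@cvgrPdist_le R R^o _ (nbhs p))/(_ _ e0) := sdist_grad_continuous (k := k) Bp.
      apply: filterS F => x Hx; apply: mx_norm_le => [|k]; first exact: ltW.
      by rewrite !mxE.
    by apply: cvg_within_filter; exact: cvg_affine.
  by split; [apply/cvg_ex; exists (nu p 0 j *: nu p)|exact: cvg_lim L].
exact: is_deriveB.
Qed.

(** Chain rule for the gradient of delta, which is the unit normal composed
    with the projection: the unit normal of rho is differentiable, and the
    projection is differentiable at p along each axis. *)
Lemma sdist_second p j k : boundary Omega p ->
  is_derive p (delta_mx 0 j) (partial k delta)
    ('D_(delta_mx 0 j - nu p 0 j *: nu p) (fun y => nu y 0 k) p).
Proof.
move=> Bp; apply/is_derive_lineP.
have Up := boundary_U Bp; have [_ gp] := rhoB Bp.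
have [dn _] := differentiable_unit_normal k (fun j => diff_rho1 j Up) gp.
have Y0 : p + (0 : R) *: delta_mx 0 j - delta (p + (0 : R) *: delta_mx 0 j)
    *: rgrad delta (p + (0 : R) *: delta_mx 0 j) = p.
  by rewrite scale0r addr0 (sdist_boundary Bp) scale0r subr0.
have C := @is_derive_curve R (fun y => nu y 0 k) (fun s : R => p + s *: delta_mx 0 j
     - delta (p + s *: delta_mx 0 j) *: rgrad delta (p + s *: delta_mx 0 j)) p
  _ Y0 dn (is_derive_projection j Bp).
apply: (near_eq_is_derive _ C).
have cl : (fun s : R => p + s *: delta_mx 0 j : C2 R) @ (0 : R) --> p.
  exact: cvg_affine.
have F := cl _ (near_sdist_grad Bp); apply: (@filterS R (nbhs (0 : R)) _ _ _ _ F) => s [_ gE _ _ _].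
by rewrite /= -gE mxE.
Qed.

End LocalGeometry.

(** * Plurisubharmonic functions on complex lines *)

Section Plurisubharmonic.
Variable R : realType.
Implicit Types (u : C2 R -> R) (x v w : C2 R).

Local Notation mu := (@lebesgue_measure R).

(** A quadratic polynomial on the unit circle: Taylor majorants of a function
    on a small circle of a complex line have this form. *)
Definition trigpoly (c a b A B D t : R) : R :=
  c + a * cos t + b * sin t + (A * cos t ^+ 2 + B * (cos t * sin t) + D * sin t ^+ 2).

Lemma trigpoly_continuous (c a b A B D : R) : continuous (trigpoly c a b A B D).
Proof.
move=> t; have cc := @continuous_cos R t; have cs := @continuous_sin R t.
rewrite /trigpoly; apply: cvgD.
  by apply: cvgD; [apply: cvgD; [exact: cvg_cst|]|]; apply: cvgM => //; exact: cvg_cst.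
apply: cvgD; first apply: cvgD.
- by apply: cvgM; [exact: cvg_cst|]; rewrite expr2; apply: cvgM.
- by apply: cvgM; [exact: cvg_cst|]; apply: cvgM.
- by apply: cvgM; [exact: cvg_cst|]; rewrite expr2; apply: cvgM.
Qed.

Lemma integral_trigpoly (c a b A B D : R) :
  (\int[mu]_(t in `[0%R, (2 * pi)%R]) (trigpoly c a b A B D t)%:E =
   (2 * pi * c + pi * (A + D))%:E)%E.
Proof.
(* an antiderivative, up to cos^2 + sin^2 = 1 *)
pose F (t : R) := c * t + (a * sin t - b * cos t)
  + ((A + D) / 2 * t + (A - D) / 2 * (sin t * cos t) + B / 2 * (sin t * sin t)).
have dF t : is_derive t (1 : R) F (trigpoly c a b A B D t).
  apply: is_derive_eq; rewrite /GRing.scale /= /trigpoly.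
  have := cos2Dsin2 t; generalize (cos t) (sin t) => x y xy.
  apply/eqP; rewrite -subr_eq0; apply/eqP.
  transitivity ((A + D) / 2 * (1 - (x ^+ 2 + y ^+ 2))); first by field.
  by rewrite xy subrr mulr0.
have cF t : {for t, continuous F}.
  by apply: differentiable_continuous; apply/derivable1_diffP; case: (dF t).
have pi0 : 0 < 2 * pi :> R by rewrite mulr_gt0// pi_gt0.
rewrite (@continuous_FTC2 R (trigpoly c a b A B D) F 0 (2 * pi) pi0).
- rewrite -EFinB; congr EFin; rewrite /F sin0 cos0.
  have -> : cos (2 * pi) = 1 :> R by rewrite mulr_natl cos2pi.
  have -> : sin (2 * pi) = 0 :> R by rewrite mulr_natl sin2pi.
  by field.
- by apply: continuous_subspaceT; exact: trigpoly_continuous.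
- split; first by move=> t _; case: (dF t).
    by apply: cvg_at_right_filter; exact: cF.
  by apply: cvg_at_left_filter; exact: cF.
- by move=> t _; rewrite derive1E; case: (dF t).
Qed.

Definition qform (H : 'I_4 -> 'I_4 -> R) (h : C2 R) : R :=
  \sum_j \sum_k h 0 j * h 0 k * H j k.

Lemma qform_comb H (c s : R) v w : qform H (c *: v + s *: w) =
  c ^+ 2 * qform H v + c * s * (\sum_j \sum_k (v 0 j * w 0 k + w 0 j * v 0 k) * H j k)
   + s ^+ 2 * qform H w.
Proof.
rewrite /qform !mulr_sumr -!big_split; apply: eq_bigr => j _ /=.
rewrite !mulr_sumr -!big_split; apply: eq_bigr => k _ /=.
by rewrite !mxE; ring.
Qed.

Lemma muliZ (a : R) v : muli (a *: v) = a *: muli v.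
Proof. by apply/rowP => j; rewrite !mxE; case: ifP => _; rewrite ?mxE ?mulrN. Qed.

(** If the sum were negative, the mean of u over a small circle around x in
    the complex line of v would be smaller than u x: in the second-order
    Taylor polynomial the linear terms and the mixed term have mean 0, and the
    squares of cos and sin have mean 1/2. *)
Lemma psh_laplacian (Omega : set (C2 R)) u (g : 'I_4 -> C2 R -> R) x v :
  open Omega -> Omega x -> plurisubharmonic_on Omega u ->
  (forall y, Omega y -> {for y, continuous u}) ->
  (\forall y \near x, differentiable u y /\ forall j, partial j u y = g j y) ->
  (forall j, differentiable (g j) x) ->
  0 <= qform (fun j k => partial k (g j) x) v + qform (fun j k => partial k (g j) x) (muli v).
Proof.
move=> oO Ox [_ psh] cu du dg; set Q := qform _.
rewrite leNgt; apply/negP => neg.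
pose C := `|v| + `|muli v|.
have C0 : 0 <= C by rewrite addr_ge0.
(* the error ka * |h|^2 of the Taylor formula will be smaller than the
   negative quadratic part *)
have [ka ka0 kaC] : exists2 ka : R, 0 < ka & 4 * (ka * C ^+ 2) < - (Q v + Q (muli v)).
  have C1 : 0 < C ^+ 2 + 1 by rewrite ltr_pwDr// sqr_ge0.
  exists (- (Q v + Q (muli v)) / (8 * (C ^+ 2 + 1))).
    by rewrite divr_gt0// ?oppr_gt0// mulr_gt0.
  have l0 : 0 < - (Q v + Q (muli v)) by rewrite oppr_gt0.
  have := sqr_ge0 C; move: l0 C1; generalize (- (Q v + Q (muli v))) (C ^+ 2) => q c q0 c1 c0.
  rewrite (_ : 4 * (q / (8 * (c + 1)) * c) = q * (c / (2 * (c + 1)))); last first.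
    by field; rewrite gt_eqF.
  by rewrite gtr_pMr// ltr_pdivrMr ?mulr_gt0//; lra.
have Tay := taylor2 du dg ka0.
have Onear : \forall h \near (0 : C2 R), Omega (h + x).
  by apply: near_addr; exact: open_nbhs_nbhs.
have [d /= d0 B] := (@nbhs_ballP R (C2 R) _ _).1 (filterI Tay Onear).
have [e e0 eC] : exists2 e : R, 0 < e & e * C < d.
  exists (d / (2 * (C + 1))); first by rewrite divr_gt0// mulr_gt0// ltr_pwDr.
  rewrite mulrAC ltr_pdivrMr ?mulr_gt0 ?ltr_pwDr// ltr_pM2l//; lra.
have disc (c s : R) : `|c| <= 1 -> `|s| <= 1 ->
   `|c *: (e *: v) + s *: muli (e *: v)| <= e * C.
  move=> c1 s1; rewrite muliZ (le_trans (ler_normD _ _))// !normrZ (gtr0_norm e0).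
  rewrite /C mulrDr lerD// ler_piMl// mulr_ge0// ltW//.
have inB (c s : R) : `|c| <= 1 -> `|s| <= 1 ->
   ball (0 : C2 R) d (c *: (e *: v) + s *: muli (e *: v)).
  move=> c1 s1; rewrite -ball_normE /= sub0r normrN.
  exact: le_lt_trans (disc c s c1 s1) eC.
have sq1 (a b : R) : a ^+ 2 + b ^+ 2 <= 1 -> `|a| <= 1 /\ `|b| <= 1.
  move=> ab; rewrite -(@expr_le1 _ 2 `|a|)// -(@expr_le1 _ 2 `|b|)// !real_normK ?num_real//.
  have := sqr_ge0 a; have := sqr_ge0 b; split; lra.
have := psh x (e *: v) _; move=> /(_ _) mean.
have {}mean : ((u x)%:E <= ((2 * pi)^-1)%R%:E *
      \int[mu]_(t in `[0%R, (2 * pi)%R])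
        (u (x + cos t *: (e *: v) + sin t *: muli (e *: v))%R)%:E)%E.
  apply: psh => s t st; have [s1 t1] := sq1 _ _ st.
  by have [_] := B _ (inB s t s1 t1); rewrite addrC addrA.
pose a := e * \sum_j v 0 j * g j x.
pose b := e * \sum_j muli v 0 j * g j x.
pose Bm := \sum_j \sum_k (v 0 j * muli v 0 k + muli v 0 j * v 0 k) * partial k (g j) x.
(* Taylor majorant of u on the circle of radius e in the complex line of v *)
pose M := trigpoly (u x + ka * (e * C) ^+ 2) a b (2^-1 * e ^+ 2 * Q v)
  (2^-1 * e ^+ 2 * Bm) (2^-1 * e ^+ 2 * Q (muli v)).
have cs1 t : `|cos t| <= 1 :> R /\ `|sin t| <= 1 :> R.
  by apply: sq1; rewrite cos2Dsin2.
have le t : u (x + cos t *: (e *: v) + sin t *: muli (e *: v)) <= M t.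
  have [c1 s1] := cs1 t; have [T _] := B _ (inB _ _ c1 s1).
  have n1 := disc _ _ c1 s1.
  have eq1 : \sum_j (cos t *: (e *: v) + sin t *: muli (e *: v)) 0 j * g j x
      = a * cos t + b * sin t.
    rewrite /a /b muliZ !mulr_sumr !mulr_suml -big_split; apply: eq_bigr => j _ /=.
    by rewrite !mxE; ring.
  have eq2 : Q (cos t *: (e *: v) + sin t *: muli (e *: v)) =
      e ^+ 2 * (cos t ^+ 2 * Q v + cos t * sin t * Bm + sin t ^+ 2 * Q (muli v)).
    have -> : cos t *: (e *: v) + sin t *: muli (e *: v) =
       (e * cos t) *: v + (e * sin t) *: muli v.
      by rewrite muliZ !scalerA ![e * _]mulrC.
    rewrite /Q qform_comb -/Q -/Bm; ring.
  move: T; rewrite eq1 -/(qform (fun j k => partial k (g j) x) _) -/Q eq2 addrA.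
  rewrite ler_norml => /andP[_ T].
  have n2 : ka * `|cos t *: (e *: v) + sin t *: muli (e *: v)| ^+ 2 <= ka * (e * C) ^+ 2.
    by rewrite ler_pM2l// ler_pXn2r ?nnegrE// mulr_ge0// ltW.
  rewrite /M /trigpoly; lra.
have : (\int[mu]_(t in `[0%R, (2 * pi)%R])
        (u (x + cos t *: (e *: v) + sin t *: muli (e *: v))%R)%:E <=
    \int[mu]_(t in `[0%R, (2 * pi)%R]) (M t)%:E)%E.
  apply: le_integral; first exact: measurable_itv.
  - apply: (@continuous_compact_integrable R
      (fun t => u (x + cos t *: (e *: v) + sin t *: muli (e *: v)))).
      exact: segment_compact.
    apply: continuous_subspaceT => t.
    have cY : {for t, continuous (fun t => x + cos t *: (e *: v) + sin t *: muli (e *: v) : C2 R)}.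
      apply: cvgD; first apply: cvgD; first exact: cvg_cst.
        by apply: cvgZr_tmp; exact: continuous_cos.
      by apply: cvgZr_tmp; exact: continuous_sin.
    apply: (@continuous_comp R (C2 R) R) => //.
    apply: cu; have [c1 s1] := cs1 t; have [_] := B _ (inB _ _ c1 s1).
    by rewrite addrC addrA.
  - apply: (@continuous_compact_integrable R M); first exact: segment_compact.
    by apply: continuous_subspaceT; exact: trigpoly_continuous.
  - by move=> t _; rewrite lee_fin.
rewrite integral_trigpoly => le2.
have pi0 : 0 < pi :> R by exact: pi_gt0.
have ipi : 0 <= (2 * pi)^-1 :> R by rewrite invr_ge0 mulr_ge0// ltW.
have := le_trans mean (lee_wpmul2l _ le2); rewrite lee_fin ipi => /(_ isT).
rewrite -EFinM lee_fin ler_pdivlMl ?mulr_gt0//.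
have e20 : 0 < e ^+ 2 by rewrite exprn_gt0.
rewrite (_ : (e * C) ^+ 2 = e ^+ 2 * C ^+ 2); last by ring.
move: kaC pi0 e20.
generalize (e ^+ 2) (C ^+ 2) (Q v) (Q (muli v)) (u x) => E K q1 q2 ux.
move=> kC p0 E0 H.
have : 0 <= pi * (E * (4 * (ka * K) + (q1 + q2))).
  move: H; rewrite -subr_ge0 => /(mulr_ge0 (ler0n R 2)) H.
  by apply: le_trans H _; rewrite le_eqVlt; apply/orP; left; apply/eqP; field.
rewrite pmulr_rge0// pmulr_rge0//; lra.
Qed.

End Plurisubharmonic.

(** * The inequality forced by a Diederich-Fornaess exponent *)

Section LeviInequality.
Variables (R : realType) (Omega : set (C2 R)) (rho : C2 R -> R) (U : set (C2 R)) (tau : R).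
Hypothesis oOmega : open Omega.
Hypothesis oU : open U.
Hypothesis clU : closure Omega `<=` U.
Hypothesis srho : smooth_on U rho.
Hypothesis rhoU : forall x, U x -> (Omega x <-> rho x < 0).
Hypothesis rhoB : forall x, boundary Omega x -> rho x = 0 /\ rgrad rho x != 0.
Hypothesis tau01 : 0 < tau < 1.
Hypothesis psh : plurisubharmonic_on Omega (fun x => - ((- rho x) `^ tau)).
Implicit Types (p x y v w : C2 R).

Local Notation nu := (unit_normal rho).

Definition hessian x (j k : 'I_4) : R := partial k (partial j rho) x.

Lemma Omega_U x : Omega x -> U x.
Proof. by move=> Ox; apply: clU; exact: subset_closure. Qed.

Lemma is_derive_powRN (a c s : R) : s < 0 ->
  is_derive s 1 (fun t : R => c * (- t) `^ a) (- (c * a * (- s) `^ (a - 1))).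
Proof.
move=> s0; have s1 : 0 < - s by rewrite oppr_gt0.
have D1 : is_derive s (1 : R) (fun t : R => - t) (-1) by apply: is_derive_eq.
have D2 := is_derive1_powR a s1.
have D3 := @is_derive1_comp R (fun t : R => t `^ a) (fun t : R => - t) s _ _ D2 D1.
have := is_deriveZ c D3; rewrite /GRing.scale /= mulrN1 mulrN mulrA.
by [].
Qed.

(** The Hessian of - (- rho)^tau is tau (- rho)^(tau - 2) times the sum of -
    rho times the Hessian of rho and (1 - tau) times the square of the
    differential of rho; the positive factor is divided out. *)
Lemma psh_DF x v : Omega x ->
  0 <= - rho x * (qform (hessian x) v + qform (hessian x) (muli v))
     + (1 - tau) * ((\sum_j v 0 j * partial j rho x) ^+ 2
        + (\sum_j muli v 0 j * partial j rho x) ^+ 2).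
Proof.
move=> Ox; have Ux := Omega_U Ox; have rx := (rhoU Ux).1 Ox.
pose g1 (s : R) := tau * (- s) `^ (tau - 1).
pose g j y := g1 (rho y) * partial j rho y.
pose u := (fun x => - ((- rho x) `^ tau)); have pshu : plurisubharmonic_on Omega u := psh.
have uE : u = (fun t : R => (-1) * (- t) `^ tau) \o rho.
  by apply/funext => y; rewrite /u /= mulN1r.
have du y : Omega y -> differentiable u y /\ forall j, partial j u y = g j y.
  move=> Oy; have Uy := Omega_U Oy; have ry := (rhoU Uy).1 Oy.
  have D := @is_derive_powRN tau (-1) _ ry.
  have dr := diff_rho oU srho Uy.
  rewrite uE; split.
    apply: (@differentiable_comp R (C2 R) R^o R^o) => //.
    by apply/derivable1_diffP; case: D.
  move=> j; have := is_derive_comp_real (derivableP (diff_derivable (v := delta_mx 0 j) dr)) D.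
  by case=> _; rewrite /partial => ->; rewrite /g /g1 /partial mulN1r !mulNr opprK.
have D1 := @is_derive_powRN (tau - 1) tau _ rx.
have dg1 : differentiable (g1 \o rho) x.
  have dr := diff_rho oU srho Ux.
  apply: (@differentiable_comp R (C2 R) R^o R^o) => //.
  by apply/derivable1_diffP; case: D1.
have dg j : differentiable (g j) x.
  have d1 := diff_rho1 oU srho j Ux.
  exact: (@differentiableM _ _ (g1 \o rho) (partial j rho)).
pose c := tau * (1 - tau) * (- rho x) `^ (tau - 1 - 1).
have pg j k : partial k (g j) x =
    c * (partial j rho x * partial k rho x) + g1 (rho x) * hessian x j k.
  have d1 := diff_rho1 oU srho j Ux.
  have -> : partial k (g j) x = 'D_(delta_mx 0 k) ((g1 \o rho) * partial j rho) x by [].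
  rewrite deriveM; try exact: diff_derivable.
  have [_ ->] := is_derive_comp_real
    (derivableP (diff_derivable (v := delta_mx 0 k) (diff_rho oU srho Ux))) D1.
  by rewrite /GRing.scale /= -/(partial k rho x) -/(partial k (partial j rho) x) /hessian /c; ring.
have cu y : Omega y -> {for y, continuous u}.
  by move=> /du[dy _]; exact: differentiable_continuous dy.
have near_du : \forall y \near x, differentiable u y /\ forall j, partial j u y = g j y.
  by apply: filterS (open_nbhs_nbhs (conj oOmega Ox)) => y /du.
have := @psh_laplacian R Omega u g x v oOmega Ox pshu cu near_du dg.
have qE w : qform (fun j k => partial k (g j) x) w =
   c * (\sum_j w 0 j * partial j rho x) ^+ 2 + g1 (rho x) * qform (hessian x) w.
  rewrite expr2 big_distrlr /= /qform !mulr_sumr -big_split; apply: eq_bigr => j _ /=.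
  rewrite !mulr_sumr -big_split; apply: eq_bigr => k _ /=.
  by rewrite pg; ring.
rewrite !qE.
have r0 : 0 < - rho x by rewrite oppr_gt0.
have g1E : g1 (rho x) = tau * (- rho x * (- rho x) `^ (tau - 1 - 1)).
  rewrite /g1 -{2}[- rho x](powRr1 (ltW r0)) -powRD; first by congr (_ * _ `^ _); ring.
  by apply/implyP => _; rewrite gt_eqF.
have P0 : 0 < tau * (- rho x) `^ (tau - 1 - 1).
  by rewrite mulr_gt0 ?powR_gt0//; case/andP: tau01.
rewrite g1E /c.
generalize (qform (hessian x) v) (qform (hessian x) (muli v))
  (\sum_j v 0 j * partial j rho x) (\sum_j muli v 0 j * partial j rho x).
move: P0; generalize ((- rho x) `^ (tau - 1 - 1)) => P P0 q1 q2 s1 s2 H.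
rewrite -(pmulr_rge0 _ P0); apply: le_trans H _.
by rewrite le_eqVlt; apply/orP; left; apply/eqP; ring.
Qed.

(** Divide by t^2 and let t tend to 0. *)
Lemma first_order_limit (A B C D : R -> R) (a b c d k : R) :
  is_derive (0 : R) 1 A a -> is_derive (0 : R) 1 B b ->
  is_derive (0 : R) 1 C c -> is_derive (0 : R) 1 D d ->
  A 0 = 0 -> B 0 = 0 -> C 0 = 0 -> D 0 = 0 ->
  (\forall t \near (0 : R)^'+, 0 <= A t * B t + k * (C t ^+ 2 + D t ^+ 2)) ->
  0 <= a * b + k * (c ^+ 2 + d ^+ 2).
Proof.
move=> dA dB dC dD A0 B0 C0 D0 H.
have L F f : is_derive (0 : R) 1 F f -> F 0 = 0 -> (fun t : R => t^-1 * F t) @ (0 : R)^'+ --> f.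
  move=> [dF <-] F0; rewrite /derive.
  have E : (fun h : R => h^-1 *: ((F \o shift 0) (h *: 1) - F 0)) = (fun t : R => t^-1 * F t).
    by apply/funext => h /=; rewrite F0 subr0 addr0 [h%:A]mulr1.
  rewrite E; apply: cvg_dnbhs_at_right.
  by move: dF; rewrite /derivable E.
have lim : (fun t : R => (t^-1 * A t) * (t^-1 * B t) + k * ((t^-1 * C t) * (t^-1 * C t) + (t^-1 * D t) * (t^-1 * D t)))
   @ (0 : R)^'+ --> a * b + k * (c * c + d * d).
  apply: cvgD; first by apply: cvgM; exact: L.
  by apply: cvgM; [exact: cvg_cst|apply: cvgD; apply: cvgM; exact: L].
rewrite !expr2; apply: (closed_cvg (fun t : R => 0 <= t)) lim; first exact: closed_ge.
apply: filterS H => t; rewrite !expr2 => H.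
have := mulr_ge0 (sqr_ge0 t^-1) H.
by congr (0 <= _); ring.
Qed.

Lemma is_derive_sum4 (x : R) (F : 'I_4 -> R -> R) (f : 'I_4 -> R) :
  (forall j, is_derive x 1 (F j) (f j)) ->
  is_derive x 1 (fun t => \sum_j F j t) (\sum_j f j).
Proof.
move=> H; have -> : (fun t => \sum_j F j t) = \sum_j F j by apply/funext => t; rewrite fct_sumE.
exact: is_derive_sum.
Qed.

Definition bilform (M : 'I_4 -> 'I_4 -> R) v w : R := \sum_j \sum_k v 0 j * w 0 k * M j k.

Lemma bilform_combr M v (a b : R) w w' : bilform M v (a *: w + b *: w') = a * bilform M v w + b * bilform M v w'.
Proof.
rewrite /bilform !mulr_sumr -big_split; apply: eq_bigr => j _ /=.
rewrite !mulr_sumr -big_split; apply: eq_bigr => k _ /=.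
by rewrite !mxE; ring.
Qed.

Lemma bilform_sym M v w : (forall j k, M j k = M k j) -> bilform M v w = bilform M w v.
Proof.
move=> sM; rewrite /bilform exchange_big; apply: eq_bigr => j _; apply: eq_bigr => k _.
by rewrite sM; ring.
Qed.

Lemma hessian_sym x j k : U x -> hessian x j k = hessian x k j.
Proof.
move=> Ux; have d1 i := diff_rho1 oU srho i Ux; apply: partialC => //.
by apply: filterS (U_near oU Ux) => y Uy; have dr := diff_rho oU srho Uy.
Qed.

(** This is D^3 rho (n, v, v). *)
Definition third p (n v : C2 R) : R :=
  \sum_j \sum_k v 0 j * v 0 k * 'D_n (fun x => hessian x j k) p.

Lemma deriveNdir (f : C2 R -> R) p v : differentiable f p -> 'D_(- v) f p = - 'D_v f p.
Proof. by move=> df; rewrite !deriveE// linearN. Qed.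

Lemma is_derive_affine_real (a b : R) : is_derive (0 : R) 1 (fun t : R => a + t * b) b.
Proof. by apply: is_derive_eq; rewrite /GRing.scale /=; ring. Qed.

Lemma is_derive_normal (f : C2 R -> R) p (n : C2 R) : differentiable f p ->
  is_derive (0 : R) 1 (fun t : R => f (p + t *: - n)) (- 'D_n f p).
Proof.
move=> df; apply/is_derive_lineP; rewrite -deriveNdir//.
exact/derivableP/diff_derivable.
Qed.

Lemma is_derive_qform p (n v w : C2 R) : U p ->
  is_derive (0 : R) 1 (fun t : R => qform (hessian (p + t *: - n)) (v + t *: w))
   (bilform (hessian p) w v + bilform (hessian p) v w - third p n v).
Proof.
move=> Up; rewrite /qform.
have -> : bilform (hessian p) w v + bilform (hessian p) v w - third p n v =
   \sum_j \sum_k ((w 0 j * v 0 k + v 0 j * w 0 k) * hessian p j k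
      - v 0 j * v 0 k * 'D_n (fun x => hessian x j k) p).
  rewrite /bilform /third -big_split -sumrB; apply: eq_bigr => j _ /=.
  by rewrite -big_split -sumrB; apply: eq_bigr => k _ /=; ring.
apply: is_derive_sum4 => j; apply: is_derive_sum4 => k.
have dh : differentiable (fun x => hessian x j k) p.
  by have := diff_rho2 oU srho k j Up.
have D := is_derive_normal n dh.
have := @is_deriveM _ _ _ _ _ _ _ _ (@is_deriveM _ _ _ _ _ _ _ _
  (is_derive_affine_real (v 0 j) (w 0 j)) (is_derive_affine_real (v 0 k) (w 0 k))) D.
have -> : (fun t : R => v 0 j + t * w 0 j) * (fun t : R => v 0 k + t * w 0 k) *
     (fun t => hessian (p + t *: - n) j k) =
   (fun t => (v + t *: w) 0 j * (v + t *: w) 0 k * hessian (p + t *: - n) j k).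
  by apply/funext => t; rewrite !mxE.
move=> H; apply: is_derive_eq; rewrite (scale0r (- n)) (addr0 p) /GRing.scale /= !mul0r !addr0.
generalize (hessian p j k) ('D_n (fun x => hessian x j k) p) (v 0 j) (w 0 j) (v 0 k) (w 0 k).
by move=> *; rewrite !fctE; ring.
Qed.

Lemma is_derive_lform p (n v w : C2 R) : U p ->
  is_derive (0 : R) 1 (fun t : R => \sum_j (v + t *: w) 0 j * partial j rho (p + t *: - n))
   (dotp w (rgrad rho p) - bilform (hessian p) v n).
Proof.
move=> Up.
have -> : dotp w (rgrad rho p) - bilform (hessian p) v n =
   \sum_j (w 0 j * partial j rho p - v 0 j * 'D_n (partial j rho) p).
  rewrite /bilform /dotp -sumrB; apply: eq_bigr => j _ /=; rewrite mxE.
  congr (_ - _); have d1 := diff_rho1 oU srho j Up; rewrite derive_partials//.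
  by rewrite mulr_sumr; apply: eq_bigr => k _; rewrite mulrA.
apply: is_derive_sum4 => j.
have D := is_derive_normal n (diff_rho1 oU srho j Up).
have := @is_deriveM _ _ _ _ _ _ _ _ (is_derive_affine_real (v 0 j) (w 0 j)) D.
have -> : (fun t : R => v 0 j + t * w 0 j) * (fun t => partial j rho (p + t *: - n)) =
   (fun t => (v + t *: w) 0 j * partial j rho (p + t *: - n)).
  by apply/funext => t; rewrite !mxE.
move=> H; apply: is_derive_eq; rewrite (scale0r (- n)) (addr0 p) /GRing.scale /= !mul0r !addr0.
generalize (partial j rho p) ('D_n (partial j rho) p) (v 0 j) (w 0 j).
by move=> *; ring.
Qed.

Lemma muliD v w : muli (v + w) = muli v + muli w.
Proof. by apply/rowP => j; rewrite !mxE; case: ifP => _ //; rewrite opprD. Qed.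

Lemma muliK v : muli (muli v) = - v.
Proof.
apply/rowP => j; rewrite !mxE; case: j => -[|[|[|[|//]]]] /= lt;
  rewrite inordK//= ?opprK; congr (- v 0 _); apply: val_inj; rewrite /= inordK//.
Qed.

Lemma normal_approach_in p : boundary Omega p ->
  \forall t \near (0 : R)^'+, Omega (p + t *: - nu p).
Proof.
move=> Bp; have [r r0 ntb] := near_tangent_balls oU clU srho rhoU rhoB Bp.
have [n1 _ bi _] := nbhs_singleton ntb Bp.
near=> t; apply: bi.
have t0 : 0 < t by near: t; exact: nbhs_right_gt.
have tr : t < r by near: t; exact: nbhs_right_lt.
have -> : p + t *: - nu p - (p - r *: nu p) = (r - t) *: nu p.
  by apply/rowP => k; rewrite !mxE; ring.
by rewrite enormZ n1 mulr1 gtr0_norm ?subr_gt0// ltrBlDr ltrDl.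
Unshelve. all: by end_near. Qed.

(** The inequality psh_DF at the point p - t nu for the vector l + t w. At t =
    0 the function rho and the two linear forms vanish, and so does the Levi
    form because p is Levi flat: both terms are O(t^2), and the coefficient of
    t^2 is nonnegative for every w. *)
Lemma levi_variation p (l w : C2 R) : boundary Omega p ->
  dotp l (rgrad rho p) = 0 -> dotp (muli l) (rgrad rho p) = 0 ->
  qform (hessian p) l + qform (hessian p) (muli l) = 0 ->
  0 <= enorm (rgrad rho p) * (2 * bilform (hessian p) l w + 2 * bilform (hessian p) (muli l) (muli w)
         - (third p (nu p) l + third p (nu p) (muli l)))
   + (1 - tau) * ((dotp w (rgrad rho p) - bilform (hessian p) l (nu p)) ^+ 2
       + (dotp (muli w) (rgrad rho p) - bilform (hessian p) (muli l) (nu p)) ^+ 2).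
Proof.
move=> Bp l0 Jl0 levi; set n := nu p; set M := hessian p.
have Up := boundary_U clU Bp; have [rp gp] := rhoB Bp.
have sM j k : M j k = M k j by exact: hessian_sym.
pose X t : C2 R := p + t *: - n.
have X0 : X 0 = p by rewrite /X scale0r addr0.
have dA : is_derive (0 : R) 1 (fun t : R => - rho (X t)) (enorm (rgrad rho p)).
  have dr := diff_rho oU srho Up.
  have D := is_deriveN (is_derive_normal n dr).
  suff <- : - - 'D_n rho p = enorm (rgrad rho p) by exact: D.
  rewrite opprK derive_partials//.
  have -> : \sum_j n 0 j * partial j rho p = dotp n (rgrad rho p).
    by apply: eq_bigr => j _; congr (_ * _); rewrite mxE.
  by rewrite dotpZl -enorm_sq expr2 mulKf// gt_eqF// enorm_gt0.
have dB : is_derive (0 : R) 1 (fun t : R => qform (hessian (X t)) (l + t *: w)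
      + qform (hessian (X t)) (muli (l + t *: w)))
    (2 * bilform M l w + 2 * bilform M (muli l) (muli w) - (third p n l + third p n (muli l))).
  have -> : (fun t : R => qform (hessian (X t)) (l + t *: w)
      + qform (hessian (X t)) (muli (l + t *: w))) =
    (fun t : R => qform (hessian (X t)) (l + t *: w)) \+
     (fun t => qform (hessian (X t)) (muli l + t *: muli w)).
    by apply/funext => t /=; rewrite muliD muliZ.
  have := is_deriveD (is_derive_qform n l w Up) (is_derive_qform n (muli l) (muli w) Up).
  rewrite -/M (bilform_sym w l sM) (bilform_sym (muli w) (muli l) sM) => D.
  apply: is_derive_eq; ring.
have dC := is_derive_lform n l w Up.
have dD := is_derive_lform n (muli l) (muli w) Up.
have := first_order_limit dA dB dC dD; rewrite !scale0r !addr0; apply.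
- by rewrite X0 rp oppr0.
- by rewrite X0 levi.
- by rewrite -[RHS]l0; apply: eq_bigr => j _; rewrite mxE.
- by rewrite -[RHS]Jl0; apply: eq_bigr => j _; congr (_ * _); rewrite mxE.
- have F := normal_approach_in Bp; apply: filterS F => t Ot.
  have := psh_DF (l + t *: w) Ot.
  by rewrite muliD muliZ.
Qed.

(** For w in the complex normal line, levi_variation is a quadratic polynomial
    in the two coordinates of w; this is the statement that its minimum is
    nonnegative. *)
Lemma levi_inequality p (l : C2 R) : boundary Omega p ->
  dotp l (rgrad rho p) = 0 -> dotp (muli l) (rgrad rho p) = 0 ->
  dotp (muli (nu p)) (rgrad rho p) = 0 ->
  qform (hessian p) l + qform (hessian p) (muli l) = 0 ->
  forall B1 B2 : R, B1 = bilform (hessian p) l (nu p) + bilform (hessian p) (muli l) (muli (nu p)) ->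
  B2 = bilform (hessian p) l (muli (nu p)) - bilform (hessian p) (muli l) (nu p) ->
  (B1 ^+ 2 + B2 ^+ 2) / (1 - tau) <=
  - (enorm (rgrad rho p) * (third p (nu p) l + third p (nu p) (muli l)))
    + 2 * (bilform (hessian p) l (nu p) * B1 - bilform (hessian p) (muli l) (nu p) * B2).
Proof.
move=> Bp l0 Jl0 Jn0 levi B1 B2 B1E B2E.
move: B1E B2E; set n := nu p; set M := hessian p => B1E B2E.
have [rp gp] := rhoB Bp.
have G0 := enorm_gt0 gp.
have t0 : 0 < 1 - tau by rewrite subr_gt0; case/andP: tau01.
have nG : dotp n (rgrad rho p) = enorm (rgrad rho p).
  by rewrite dotpZl -enorm_sq expr2 mulKf// gt_eqF.
(* the minimiser, found by completing the squares *)
pose b1 := (bilform M l n - B1 / (1 - tau)) / enorm (rgrad rho p).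
pose b2 := (- bilform M (muli l) n - B2 / (1 - tau)) / enorm (rgrad rho p).
have := levi_variation (b1 *: n + b2 *: muli n) Bp l0 Jl0 levi.
have Jw : muli (b1 *: n + b2 *: muli n) = (- b2) *: n + b1 *: muli n.
  by rewrite muliD (muliZ b1 n) (muliZ b2 (muli n)) muliK scalerN -scaleNr addrC.
have dn (a b : R) : dotp (a *: n + b *: muli n) (rgrad rho p) = a * enorm (rgrad rho p).
  by rewrite dotpDl (dotpZl a n) (dotpZl b (muli n)) nG Jn0 mulr0 addr0.
rewrite -/n -/M Jw !dn !bilform_combr.
rewrite /b1 /b2 B1E B2E; move: t0 G0.
generalize (enorm (rgrad rho p)) (1 - tau) (bilform M l n) (bilform M (muli l) n)
  (bilform M l (muli n)) (bilform M (muli l) (muli n)) (third p n l) (third p n (muli l)).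
move=> G c x1 x2 x3 x4 T1 T2 c0 G0 H.
rewrite -subr_ge0; apply: le_trans H _; rewrite le_eqVlt; apply/orP; left; apply/eqP; field.
by rewrite !gt_eqF.
Qed.

End LeviInequality.

(** * Partial derivatives of complex-valued functions *)

Section ComplexCalculus.
Local Open Scope complex_scope.
Variable R : realType.
Implicit Types (p x : C2 R) (f g : C2 R -> R[i]).

(** As cpartial is a total function, existence of the derivative is recorded
    together with its value. *)
Definition cder (i : 'I_4) f p (d : R[i]) : Prop :=
  is_derive p (delta_mx 0 i) (fun y => complex.Re (f y)) (complex.Re d) /\
  is_derive p (delta_mx 0 i) (fun y => complex.Im (f y)) (complex.Im d).

Lemma cder_cpartial i f p d : cder i f p d -> cpartial i f p = d.
Proof. by case=> -[_ r] [_ m]; rewrite /cpartial /partial r m; case: d {r m}. Qed.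

Lemma cder_uniq i f p d d' : cder i f p d -> cder i f p d' -> d = d'.
Proof. by move=> /cder_cpartial <- /cder_cpartial <-. Qed.

Lemma cder_near_eq i f g p d : (\near p, f p = g p) -> cder i f p d -> cder i g p d.
Proof.
move=> fg [r m]; split; [apply: near_eq_is_derive r|apply: near_eq_is_derive m];
  by apply: filterS fg => y ->.
Qed.

Lemma cder_const i (c : R[i]) p : cder i (fun=> c) p 0.
Proof. by split; exact: is_derive_cst. Qed.

Lemma cder_real i (f : C2 R -> R) p (d : R) : is_derive p (delta_mx 0 i) f d ->
  cder i (fun y => (f y)%:C) p d%:C.
Proof. by move=> df; split => //=; exact: is_derive_cst. Qed.

Lemma ReD (a b : R[i]) : complex.Re (a + b) = complex.Re a + complex.Re b.
Proof. by case: a b => ? ? []. Qed.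

Lemma ImD (a b : R[i]) : complex.Im (a + b) = complex.Im a + complex.Im b.
Proof. by case: a b => ? ? []. Qed.

Lemma cderD i f g p d e : cder i f p d -> cder i g p e ->
  cder i (fun y => f y + g y) p (d + e).
Proof.
move=> [f1 f2] [g1 g2]; split.
  have := is_deriveD f1 g1; rewrite -ReD.
  have -> : (fun y => complex.Re (f y)) + (fun y => complex.Re (g y)) =
    (fun y => complex.Re (f y + g y)) by apply/funext => y; rewrite fctE ReD.
  by [].
have := is_deriveD f2 g2; rewrite -ImD.
have -> : (fun y => complex.Im (f y)) + (fun y => complex.Im (g y)) =
  (fun y => complex.Im (f y + g y)) by apply/funext => y; rewrite fctE ImD.
by [].
Qed.

Lemma ReM (a b : R[i]) : complex.Re (a * b) =
  complex.Re a * complex.Re b - complex.Im a * complex.Im b.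
Proof. by case: a b => ? ? []. Qed.

Lemma ImM (a b : R[i]) : complex.Im (a * b) =
  complex.Re a * complex.Im b + complex.Im a * complex.Re b.
Proof. by case: a b => ? ? []. Qed.

Lemma cderM i f g p d e : cder i f p d -> cder i g p e ->
  cder i (fun y => f y * g y) p (d * g p + f p * e).
Proof.
move=> [f1 f2] [g1 g2]; split.
  have := is_deriveB (is_deriveM f1 g1) (is_deriveM f2 g2).
  have -> : (fun y => complex.Re (f y)) * (fun y => complex.Re (g y)) -
    (fun y => complex.Im (f y)) * (fun y => complex.Im (g y)) = (fun y => complex.Re (f y * g y)).
    by apply/funext => y; rewrite !fctE ReM.
  move=> D; apply: is_derive_eq; rewrite /GRing.scale /= ReD !ReM; ring.
have := is_deriveD (is_deriveM f1 g2) (is_deriveM f2 g1).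
have -> : (fun y => complex.Re (f y)) * (fun y => complex.Im (g y)) +
    (fun y => complex.Im (f y)) * (fun y => complex.Re (g y)) = (fun y => complex.Im (f y * g y)).
  by apply/funext => y; rewrite !fctE ImM.
move=> D; apply: is_derive_eq; rewrite /GRing.scale /= ImD !ImM; ring.
Qed.

Lemma cder_sum i (F : 'I_4 -> C2 R -> R[i]) p (d : 'I_4 -> R[i]) :
  (forall j, cder i (F j) p (d j)) ->
  cder i (fun y => \sum_j F j y) p (\sum_j d j).
Proof.
move=> dF; have := dF; rewrite !big_ord_recl !big_ord0 => _.
have -> : (fun y => \sum_j F j y) = (fun y => F ord0 y + (F (lift ord0 ord0) y +
   (F (lift ord0 (lift ord0 ord0)) y + (F (lift ord0 (lift ord0 (lift ord0 ord0))) y + 0)))).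
  by apply/funext => y; rewrite !big_ord_recl big_ord0.
by do 4 (apply: cderD => //); exact: cder_const.
Qed.

Lemma invc_coord (z : R[i]) :
  complex.Re z^-1 = complex.Re z / (complex.Re z ^+ 2 + complex.Im z ^+ 2) /\
  complex.Im z^-1 = - (complex.Im z / (complex.Re z ^+ 2 + complex.Im z ^+ 2)).
Proof. by case: z. Qed.

Lemma sqnormc_gt0 (z : R[i]) : z != 0 -> 0 < complex.Re z ^+ 2 + complex.Im z ^+ 2.
Proof.
case: z => a b z0 /=; rewrite lt_neqAle addr_ge0 ?sqr_ge0// andbT eq_sym.
apply: contra_neq z0 => /eqP; rewrite paddr_eq0 ?sqr_ge0// !sqrf_eq0.
by move=> /andP[/eqP -> /eqP ->].
Qed.

Lemma cderV i f p d : cder i f p d -> f p != 0 ->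
  cder i (fun y => (f y)^-1) p (- d / f p ^+ 2).
Proof.
move=> df fp; have q0 := sqnormc_gt0 fp; have [[f1 _] [f2 _]] := df.
set q := fun y => complex.Re (f y) ^+ 2 + complex.Im (f y) ^+ 2.
have dq : derivable q p (delta_mx 0 i).
  have -> : q = (fun y => complex.Re (f y)) * (fun y => complex.Re (f y)) +
     (fun y => complex.Im (f y)) * (fun y => complex.Im (f y)).
    by apply/funext => y; rewrite !fctE /q !expr2.
  exact: derivableD (derivableM f1 f1) (derivableM f2 f2).
have dqV : derivable (fun y => (q y)^-1) p (delta_mx 0 i).
  by apply: derivableV => //; rewrite gt_eqF.
have d1 : derivable (fun y => complex.Re (f y)^-1) p (delta_mx 0 i).
  have -> : (fun y => complex.Re (f y)^-1) = (fun y => complex.Re (f y)) * (fun y => (q y)^-1).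
    by apply/funext => y; rewrite fctE (invc_coord (f y)).1.
  exact: derivableM f1 dqV.
have d2 : derivable (fun y => complex.Im (f y)^-1) p (delta_mx 0 i).
  have -> : (fun y => complex.Im (f y)^-1) = - ((fun y => complex.Im (f y)) * (fun y => (q y)^-1)).
    by apply/funext => y; rewrite !fctE (invc_coord (f y)).2.
  exact: derivableN (derivableM f2 dqV).
have dV : cder i (fun y => (f y)^-1) p ('D_(delta_mx 0 i) (fun y => complex.Re (f y)^-1) p
   +i* 'D_(delta_mx 0 i) (fun y => complex.Im (f y)^-1) p).
  by split; [exact: derivableP d1|exact: derivableP d2].
(* differentiating z^-1 = z^-1 * (z * z^-1), which also holds at 0, gives a linear
   equation for the derivative of the inverse *)
have E3 : (fun y => (f y)^-1 * (f y * (f y)^-1)) = (fun y => (f y)^-1).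
  by apply/funext => y; have [->|fy] := eqVneq (f y) 0; rewrite ?invr0 ?mul0r// divff// mulr1.
have := cderM dV (cderM df dV); rewrite E3 => /(cder_uniq dV).
set d' := (X in X = _) => E.
suff <- : d' = - d / f p ^+ 2 by [].
move: E; rewrite divff// mulr1 -[LHS]addr0 => /addrI/esym/eqP.
rewrite mulrDr [in X in _ + X]mulrA mulVf// mul1r addr_eq0 => /eqP E.
by rewrite -[d']opprK -E; field; exact: fp.
Qed.

End ComplexCalculus.

(** * The frame as a function of the gradient *)

Section Frame.
Local Open Scope complex_scope.
Variable R : realType.
Local Notation C := R[i].
Implicit Types (v n : C2 R) (V W : 'rV[C]_4).

Local Notation o0 := (@Ordinal 4 0 isT).
Local Notation o1 := (@Ordinal 4 1 isT).
Local Notation o2 := (@Ordinal 4 2 isT).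
Local Notation o3 := (@Ordinal 4 3 isT).

Lemma sum4 (T : nmodType) (F : 'I_4 -> T) : \sum_j F j = F o0 + F o1 + F o2 + F o3.
Proof.
rewrite !big_ord_recl big_ord0 addr0 !addrA.
by congr (F _ + F _ + F _ + F _); apply: val_inj.
Qed.

Lemma ord4_ind (P : 'I_4 -> Prop) : P o0 -> P o1 -> P o2 -> P o3 -> forall j, P j.
Proof.
by move=> P0 P1 P2 P3 [[|[|[|[|//]]]] lt]; [move: P0|move: P1|move: P2|move: P3];
  congr P; apply: val_inj.
Qed.

Lemma muliE v : (muli v 0 o0 = - v 0 o1) * (muli v 0 o1 = v 0 o0) *
  (muli v 0 o2 = - v 0 o3) * (muli v 0 o3 = v 0 o2).
Proof.
by do !split; rewrite mxE /=; do ?congr (- _); congr (v 0 _); apply: val_inj; rewrite /= inordK.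
Qed.

Definition iC : C := 0 +i* 1.
Local Notation cj := (@conjc R).

Lemma ii : iC * iC = -1.
Proof. by apply/eqP; rewrite eq_complex /= !mul0r !mulr0 mul1r sub0r addr0 oppr0 !eqxx. Qed.

Lemma conj_i : cj iC = - iC.
Proof. by apply/eqP; rewrite eq_complex /= oppr0 !eqxx. Qed.

Lemma conj_real (a : R) : cj (a%:C) = a%:C.
Proof. by apply/eqP; rewrite eq_complex /= oppr0 !eqxx. Qed.

Lemma half_conj : cj ((2 : C)^-1) = 2^-1.
Proof.
have -> : (2 : C)^-1 = (2^-1 : R)%:C by rewrite fmorphV rmorph_nat.
exact: conj_real.
Qed.

Lemma conjM (a b : C) : cj (a * b) = cj a * cj b. Proof. exact: rmorphM. Qed.
Lemma conjD (a b : C) : cj (a + b) = cj a + cj b. Proof. exact: rmorphD. Qed.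
Lemma conjN (a : C) : cj (- a) = - cj a. Proof. exact: rmorphN. Qed.

(** For V the gradient of f, zc V and wc V are twice the derivatives of f in
    the conjugate variables, zb V and wb V twice those in z and w. *)
Definition zc V : C := V 0 o0 + iC * V 0 o1.
Definition wc V : C := V 0 o2 + iC * V 0 o3.
Definition zb V : C := V 0 o0 - iC * V 0 o1.
Definition wb V : C := V 0 o2 - iC * V 0 o3.

Definition row4 (a b c d : C) : 'rV[C]_4 := \row_(j < 4) nth 0 [:: a; b; c; d] j.

(** When V is the gradient of the signed distance and has norm 1, Nmap V, Lmap
    V, Lbmap V and Nbmap V are N, L and their conjugates. Defined for complex
    V they are complex linear, so that the derivative of a frame field is the
    same linear map applied to the derivative of the gradient. *)
Definition Nmap V := 2^-1 *: row4 (zc V) (- iC * zc V) (wc V) (- iC * wc V).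
Definition Lmap V := 2^-1 *: row4 (wb V) (- iC * wb V) (- zb V) (iC * zb V).
Definition Lbmap V := 2^-1 *: row4 (wc V) (iC * wc V) (- zc V) (- iC * zc V).
Definition Nbmap V := 2^-1 *: row4 (zb V) (iC * zb V) (wb V) (iC * wb V).

Definition rC v : 'rV[C]_4 := \row_j (v 0 j)%:C.
Definition cdot V W : C := \sum_j V 0 j * W 0 j.
Definition conjv V : 'rV[C]_4 := map_mx (fun c : C => cj c) V.

Lemma conj_zc v : cj (zc (rC v)) = zb (rC v).
Proof. by rewrite /zc /zb !mxE conjD conjM conj_i !conj_real mulNr. Qed.

Lemma conj_wc v : cj (wc (rC v)) = wb (rC v).
Proof. by rewrite /wc /wb !mxE conjD conjM conj_i !conj_real mulNr. Qed.

Lemma conjv_Nmap v : conjv (Nmap (rC v)) = Nbmap (rC v).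
Proof.
apply/rowP; apply: ord4_ind; rewrite !mxE /= conjM half_conj; congr (_ * _);
  by rewrite ?conjM ?conjN ?conj_i ?opprK ?conj_zc ?conj_wc.
Qed.

Lemma conjv_Lmap v : conjv (Lmap (rC v)) = Lbmap (rC v).
Proof.
apply/rowP; apply: ord4_ind; rewrite !mxE /= conjM half_conj; congr (_ * _);
  by rewrite ?conjM ?conjN ?conj_i ?opprK -?conj_zc -?conj_wc ?conjcK ?mulNr.
Qed.

Lemma cdot_Nb V W : cdot V (Nbmap W) = 2^-1 * (zc V * zb W + wc V * wb W).
Proof. by rewrite /cdot sum4 !mxE /= /zc /wc; ring. Qed.

Lemma cdot_Lb V W : cdot V (Lbmap W) = 2^-1 * (zc V * wc W - wc V * zc W).
Proof. by rewrite /cdot sum4 !mxE /= /zc /wc; ring. Qed.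

Lemma cdot_L V W : cdot V (Lmap W) = 2^-1 * (zb V * wb W - wb V * zb W).
Proof. by rewrite /cdot sum4 !mxE /= /zb /wb; ring. Qed.

Lemma cdotC V W : cdot V W = cdot W V.
Proof. by apply: eq_bigr => j _; rewrite mulrC. Qed.

Lemma NmapD V : Nmap V + Nbmap V = V.
Proof.
apply/rowP; apply: ord4_ind; rewrite !mxE /= /zc /zb /wc /wb.
- by field.
- transitivity (- (iC * iC) * V 0 o1); first by field.
  by rewrite ii opprK mul1r.
- by field.
- transitivity (- (iC * iC) * V 0 o3); first by field.
  by rewrite ii opprK mul1r.
Qed.

Lemma cdotDr V W W' : cdot V (W + W') = cdot V W + cdot V W'.
Proof. by rewrite /cdot -big_split; apply: eq_bigr => j _; rewrite mxE mulrDr. Qed.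

Lemma cdotZr (a : C) V W : cdot V (a *: W) = a * cdot V W.
Proof. by rewrite /cdot mulr_sumr; apply: eq_bigr => j _; rewrite mxE mulrCA. Qed.

Lemma cdot_split V W : cdot V W = cdot V (Nmap W) + cdot V (Nbmap W).
Proof. by rewrite -cdotDr NmapD. Qed.

Lemma unit_zw n : dotp n n = 1 ->
  zb (rC n) * zc (rC n) + wb (rC n) * wc (rC n) = 1.
Proof.
move=> nn; transitivity ((dotp n n)%:C); last by rewrite nn.
rewrite /zb /zc /wb /wc !mxE /dotp sum4.
rewrite (_ : (_ + _)%:C = (n 0 o0)%:C * (n 0 o0)%:C + (n 0 o1)%:C * (n 0 o1)%:C
  + (n 0 o2)%:C * (n 0 o2)%:C + (n 0 o3)%:C * (n 0 o3)%:C); last by rewrite -!rmorphM -!rmorphD.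
transitivity ((n 0 o0)%:C * (n 0 o0)%:C - (iC * iC) * ((n 0 o1)%:C * (n 0 o1)%:C)
  + (n 0 o2)%:C * (n 0 o2)%:C - (iC * iC) * ((n 0 o3)%:C * (n 0 o3)%:C)); first by ring.
by rewrite ii !mulN1r !opprK.
Qed.

Lemma cdot_LmapW W : cdot (Lmap W) W = 0.
Proof. by rewrite cdotC cdot_L; ring. Qed.

Lemma zc_Lmap W : zc (Lmap W) = wb W.
Proof.
rewrite {1}/zc !mxE /=; generalize (wb W) => x.
transitivity (2^-1 * (x - iC * iC * x)); first by ring.
by rewrite ii; field.
Qed.

Lemma wc_Lmap W : wc (Lmap W) = - zb W.
Proof.
rewrite {1}/wc !mxE /=; generalize (zb W) => x.
transitivity (2^-1 * (- x + iC * iC * x)); first by ring.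
by rewrite ii; field.
Qed.

Lemma cdot_LLb n : dotp n n = 1 -> cdot (Lbmap (rC n)) (Lmap (rC n)) = 2^-1.
Proof.
move=> /unit_zw nn; rewrite cdotC cdot_Lb zc_Lmap wc_Lmap -[RHS]mulr1 -nn; ring.
Qed.

(** In two variables, orthogonality of V to conj L is proportionality of (zc
    V, wc V) to (zc n, wc n); the factor is found by pairing with conj N. *)
Lemma zc_wc_levi n V : dotp n n = 1 -> cdot V (Lbmap (rC n)) = 0 ->
  zc V = 2 * cdot V (Nbmap (rC n)) * zc (rC n) /\
  wc V = 2 * cdot V (Nbmap (rC n)) * wc (rC n).
Proof.
move=> /unit_zw nn; rewrite cdot_Lb => /eqP; rewrite mulf_eq0 invr_eq0 pnatr_eq0 /= subr_eq0.
move=> /eqP E; rewrite cdot_Nb; move: nn E.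
generalize (zc V) (wc V) (zb (rC n)) (wb (rC n)) (zc (rC n)) (wc (rC n)) => a b x y z w nn E.
split.
  transitivity (a * (x * z + y * w)); first by rewrite nn mulr1.
  transitivity (x * z * a + y * (a * w)); first by ring.
  by rewrite E; field.
transitivity (b * (x * z + y * w)); first by rewrite nn mulr1.
transitivity (x * (b * z) + y * w * b); first by ring.
by rewrite -E; field.
Qed.

Lemma zcB a V W : zc (V - a *: W) = zc V - a * zc W.
Proof. by rewrite /zc !mxE; ring. Qed.

Lemma wcB a V W : wc (V - a *: W) = wc V - a * wc W.
Proof. by rewrite /wc !mxE; ring. Qed.

Lemma Nmap_scale (c : C) V W : zc V = c * zc W -> wc V = c * wc W ->
  Nmap V = c *: Nmap W /\ Lbmap V = c *: Lbmap W.
Proof.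
move=> z w; rewrite /Nmap /Lbmap z w; generalize (zc W) (wc W) => a b.
by split; apply/rowP; apply: ord4_ind; rewrite !mxE /=; ring.
Qed.

(** For V the Hessian of rho applied to L, the projection of V orthogonal to n
    is, up to the factor |grad rho|, the derivative of the unit normal along
    L, and the hypothesis on V is Levi flatness. So N and conj L are merely
    rescaled to first order along L. *)
Lemma frame_variation n V : dotp n n = 1 -> cdot V (Lbmap (rC n)) = 0 ->
  Nmap (V - cdot V (rC n) *: rC n) =
    (cdot V (Nbmap (rC n)) - cdot V (Nmap (rC n))) *: Nmap (rC n) /\
  Lbmap (V - cdot V (rC n) *: rC n) =
    (cdot V (Nbmap (rC n)) - cdot V (Nmap (rC n))) *: Lbmap (rC n).
Proof.
move=> nn V0; have [z w] := zc_wc_levi nn V0.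
apply: Nmap_scale; rewrite ?zcB ?wcB ?z ?w (cdot_split V (rC n));
  move: (cdot V _) (cdot V _) => x y; [generalize (zc (rC n))|generalize (wc (rC n))] => t; ring.
Qed.

(** The real tangent vector whose (1,0) part vec10 is L. *)
Definition lvec n : C2 R := \row_(j < 4) nth 0 [:: n 0 o2; - n 0 o3; - n 0 o0; n 0 o1] j.

Definition vec10 v : 'rV[C]_4 := \row_j ((v 0 j / 2) -i* (muli v 0 j / 2)).

Lemma Nmap_vec10 n : Nmap (rC n) = vec10 n.
Proof.
have h2 : (2 : C)^-1 = (2^-1 : R)%:C by rewrite fmorphV rmorph_nat.
apply/rowP; apply: ord4_ind; rewrite [RHS]mxE ?muliE !mxE /= /zc /wc !mxE h2;
  apply/eqP; rewrite eq_complex /=; apply/andP; split; apply/eqP; by field.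
Qed.

Lemma Lmap_vec10 n : Lmap (rC n) = vec10 (lvec n).
Proof.
have h2 : (2 : C)^-1 = (2^-1 : R)%:C by rewrite fmorphV rmorph_nat.
apply/rowP; apply: ord4_ind; rewrite [RHS]mxE ?muliE !mxE /= /zb /wb !mxE h2;
  apply/eqP; rewrite eq_complex /=; apply/andP; split; apply/eqP; by field.
Qed.

Lemma dotp_lvec n : dotp (lvec n) n = 0.
Proof. by rewrite /dotp sum4 !mxE /=; ring. Qed.

Lemma dotp_muli_lvec n : dotp (muli (lvec n)) n = 0.
Proof. by rewrite /dotp sum4 !muliE !mxE /=; ring. Qed.

Lemma dotp_muli n : dotp (muli n) n = 0.
Proof. by rewrite /dotp sum4 !muliE; ring. Qed.

Lemma dsd_cdot (Omega : set (C2 R)) (X : vfield R) x :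
  dsd Omega X x = cdot (X x) (rC (rgrad (signed_distance Omega) x)).
Proof.
apply: eq_bigr => j _; rewrite !mxE; congr (_ * _).
by apply/eqP; rewrite eq_complex /= /partial derive_cst !eqxx.
Qed.

Lemma cplx_eqP (a b : C) : complex.Re a = complex.Re b -> complex.Im a = complex.Im b -> a = b.
Proof. by case: a b => ? ? [? ?] /= -> ->. Qed.

Lemma halfC : (2 : C)^-1 = (2^-1 : R)%:C.
Proof. by rewrite fmorphV rmorph_nat. Qed.

Lemma dsd_dz (Omega : set (C2 R)) x :
  dsd Omega (@d_z R) x = 2^-1 * zb (rC (rgrad (signed_distance Omega) x)).
Proof.
rewrite dsd_cdot; move: (rgrad _ _) => g; rewrite /cdot sum4 /d_z /zb !mxE /= halfC.
by apply: cplx_eqP => /=; ring.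
Qed.

Lemma dsd_dw (Omega : set (C2 R)) x :
  dsd Omega (@d_w R) x = 2^-1 * wb (rC (rgrad (signed_distance Omega) x)).
Proof.
rewrite dsd_cdot; move: (rgrad _ _) => g; rewrite /cdot sum4 /d_w /wb !mxE /= halfC.
by apply: cplx_eqP => /=; ring.
Qed.

Lemma dsd_dzb (Omega : set (C2 R)) x :
  dsd Omega (vconj (@d_z R)) x = 2^-1 * zc (rC (rgrad (signed_distance Omega) x)).
Proof.
rewrite dsd_cdot; move: (rgrad _ _) => g; rewrite /cdot sum4 /vconj /d_z /zc !mxE /= halfC.
by apply: cplx_eqP => /=; ring.
Qed.

Lemma dsd_dwb (Omega : set (C2 R)) x :
  dsd Omega (vconj (@d_w R)) x = 2^-1 * wc (rC (rgrad (signed_distance Omega) x)).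
Proof.
rewrite dsd_cdot; move: (rgrad _ _) => g; rewrite /cdot sum4 /vconj /d_w /wc !mxE /= halfC.
by apply: cplx_eqP => /=; ring.
Qed.

Lemma LN_factor_unit (Omega : set (C2 R)) x :
  enorm (rgrad (signed_distance Omega) x) = 1 -> LN_factor Omega x = 2.
Proof.
rewrite /LN_factor dsd_dz dsd_dw; set g := rgrad _ _ => g1.
have gg : dotp g g = 1 by rewrite -enorm_sq g1 expr1n.
have sq (a b : R) : cmod (2^-1 * (a%:C - iC * b%:C)) ^+ 2 = (a ^+ 2 + b ^+ 2) / 4.
  rewrite halfC /cmod /= sqr_sqrtr; first by field.
  by rewrite addr_ge0 // sqr_ge0.
have -> : cmod (2^-1 * zb (rC g)) ^+ 2 + cmod (2^-1 * wb (rC g)) ^+ 2 = (2^-1) ^+ 2.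
  rewrite /zb /wb ![rC _ _ _]mxE !sq.
  move: gg; rewrite /dotp sum4 => gg.
  rewrite (_ : (2^-1) ^+ 2 = (g 0 o0 * g 0 o0 + g 0 o1 * g 0 o1 + g 0 o2 * g 0 o2
     + g 0 o3 * g 0 o3) / 4 :> R); last by rewrite gg; field.
  by field.
by rewrite sqrtr_sqr ger0_norm ?invr_ge0// invrK rmorph_nat.
Qed.

Lemma Lfield_unit (Omega : set (C2 R)) x :
  enorm (rgrad (signed_distance Omega) x) = 1 ->
  Lfield Omega x = Lmap (rC (rgrad (signed_distance Omega) x)).
Proof.
move=> g1; rewrite /Lfield LN_factor_unit// dsd_dz dsd_dw; move: (rgrad _ _) => g.
apply/rowP; apply: ord4_ind; rewrite !mxE /=;
  generalize (zb (rC g)) (wb (rC g)) => -[a b] [c d]; rewrite halfC;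
  apply: cplx_eqP => /=; by field.
Qed.

Lemma Nfield_unit (Omega : set (C2 R)) x :
  enorm (rgrad (signed_distance Omega) x) = 1 ->
  Nfield Omega x = Nmap (rC (rgrad (signed_distance Omega) x)).
Proof.
move=> g1; rewrite /Nfield LN_factor_unit// dsd_dzb dsd_dwb; move: (rgrad _ _) => g.
apply/rowP; apply: ord4_ind; rewrite !mxE /=;
  generalize (zc (rC g)) (wc (rC g)) => -[a b] [c d]; rewrite halfC;
  apply: cplx_eqP => /=; by field.
Qed.

End Frame.

(** * Complex linear maps and moduli *)

Section LinearMaps.
Local Open Scope complex_scope.
Variable R : realType.
Local Notation C := R[i].
Implicit Types (V W : 'rV[C]_4) (Phi : 'rV[C]_4 -> 'rV[C]_4).

Definition clinear Phi := forall (a : C) V W, Phi (a *: V + W) = a *: Phi V + Phi W.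

Lemma clinear_expand Phi V k : clinear Phi ->
  Phi V 0 k = \sum_j V 0 j * Phi (delta_mx 0 j) 0 k.
Proof.
move=> lin; pose M := GRing.isLinear.Build _ _ _ _ _ lin.
pose P : {linear 'rV[C]_4 -> 'rV[C]_4} := HB.pack Phi M.
have E : Phi V = \sum_j V 0 j *: Phi (delta_mx 0 j).
  rewrite {1}(row_sum_delta V) -[Phi]/(P : _ -> _) linear_sum.
  by apply: eq_bigr => j _; rewrite linearZ.
by rewrite E summxE; apply: eq_bigr => j _; rewrite mxE.
Qed.

Lemma clinearZ Phi (a : C) V : clinear Phi -> Phi (a *: V) = a *: Phi V.
Proof.
move=> lin; pose M := GRing.isLinear.Build _ _ _ _ _ lin.
pose P : {linear 'rV[C]_4 -> 'rV[C]_4} := HB.pack Phi M.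
by rewrite -[Phi]/(P : _ -> _) linearZ.
Qed.

Lemma clinear_comb Phi (F : 'I_4 -> 'rV[C]_4) (a : 'I_4 -> C) k : clinear Phi ->
  Phi (\sum_i a i *: F i) 0 k = \sum_i a i * Phi (F i) 0 k.
Proof.
move=> lin; pose M := GRing.isLinear.Build _ _ _ _ _ lin.
pose P : {linear 'rV[C]_4 -> 'rV[C]_4} := HB.pack Phi M.
rewrite -[Phi]/(P : _ -> _) linear_sum summxE.
by apply: eq_bigr => j _; rewrite linearZ mxE.
Qed.

Lemma Nmap_linear : clinear (@Nmap R).
Proof.
by move=> a V W; apply/rowP; apply: ord4_ind; rewrite !mxE /= /zc /wc !mxE; ring.
Qed.

Lemma Lmap_linear : clinear (@Lmap R).
Proof.
by move=> a V W; apply/rowP; apply: ord4_ind; rewrite !mxE /= /zb /wb !mxE; ring.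
Qed.

Lemma Lbmap_linear : clinear (@Lbmap R).
Proof.
by move=> a V W; apply/rowP; apply: ord4_ind; rewrite !mxE /= /zc /wc !mxE; ring.
Qed.

Lemma cder_clinear Phi (g : C2 R -> C2 R) p (s : C2 R) i k : clinear Phi ->
  (forall j, is_derive p (delta_mx 0 i) (fun x => g x 0 j) (s 0 j)) ->
  cder i (fun x => Phi (rC (g x)) 0 k) p (Phi (rC s) 0 k).
Proof.
move=> lin dg; rewrite (clinear_expand _ _ lin).
have -> : (fun x => Phi (rC (g x)) 0 k) =
   (fun x => \sum_j (g x 0 j)%:C * Phi (delta_mx 0 j) 0 k).
  apply/funext => x; rewrite (clinear_expand _ _ lin).
  by apply: eq_bigr => j _; rewrite mxE.
apply: cder_sum => j; rewrite [rC s 0 j]mxE.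
have := cderM (cder_real (dg j)) (cder_const i (Phi (delta_mx 0 j) 0 k) p).
by rewrite mulr0 addr0.
Qed.

Lemma Lmap_conjv V : Lmap (conjv V) = conjv (Lbmap V).
Proof.
have zE : zb (conjv V) = conjc (zc V) by rewrite /zb /zc !mxE conjD conjM conj_i mulNr.
have wE : wb (conjv V) = conjc (wc V) by rewrite /wb /wc !mxE conjD conjM conj_i mulNr.
apply/rowP; apply: ord4_ind; rewrite !mxE /= ?zE ?wE conjM half_conj; congr (_ * _);
  by rewrite ?conjM ?conjN ?conj_i ?opprK.
Qed.

Lemma rC_conjv (v : C2 R) : conjv (rC v) = rC v.
Proof. by apply/rowP => j; rewrite !mxE conj_real. Qed.

Lemma conjvK V : conjv (conjv V) = V.
Proof. by apply/rowP => j; rewrite !mxE conjcK. Qed.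

Lemma conj_sum (F : 'I_4 -> C) : conjc (\sum_j F j) = \sum_j conjc (F j).
Proof. exact: rmorph_sum. Qed.

Lemma cdot_conj V W : conjc (cdot V W) = cdot (conjv V) (conjv W).
Proof. by rewrite /cdot conj_sum; apply: eq_bigr => j _; rewrite conjM !mxE. Qed.

Lemma Num_conj (z : C) : Num.conj z = conjc z. Proof. by []. Qed.

Lemma cmod_conj (z : C) : cmod (conjc z) = cmod z.
Proof. by case: z => a b; rewrite /cmod /= sqrrN. Qed.

Lemma cmodM (z w : C) : cmod (z * w) = cmod z * cmod w.
Proof. exact: ComplexField.Normc.normcM. Qed.

Lemma cmodD (z w : C) : cmod (z + w) <= cmod z + cmod w.
Proof. exact: (@complex.le_normcD R z w). Qed.

Lemma cmodN (z : C) : cmod (- z) = cmod z.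
Proof. exact: (@complex.normcN R z). Qed.

Lemma cmod_ge0 (z : C) : 0 <= cmod z.
Proof. by case: z => a b; exact: sqrtr_ge0. Qed.

Lemma cmod_real (a : R) : cmod a%:C = `|a|.
Proof. by rewrite /cmod /= expr0n /= addr0 sqrtr_sqr. Qed.

Lemma cmod_sq (z : C) : cmod z ^+ 2 = complex.Re z ^+ 2 + complex.Im z ^+ 2.
Proof. by case: z => a b; rewrite /cmod /= sqr_sqrtr// addr_ge0// sqr_ge0. Qed.

Lemma Re_le_cmod (z : C) : complex.Re z <= cmod z.
Proof.
apply: le_trans (ler_norm _) _; rewrite -(@ler_pXn2r _ 2)// ?nnegrE ?cmod_ge0//.
by rewrite cmod_sq real_normK ?num_real// lerDl sqr_ge0.
Qed.

Lemma cmod_eq0 (z : C) : (cmod z == 0) = (z == 0).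
Proof.
rewrite -sqrf_eq0 cmod_sq paddr_eq0 ?sqr_ge0// !sqrf_eq0.
by case: z => a b; rewrite eq_complex.
Qed.

(** Here h, s and H stand for D^2 rho (L, conj N), D^2 rho (L, N) and D^2 rho
    (N, conj L), K for D^3 rho (L, N, conj L), and u for G / H. The two
    equations give G K = (3 s - h) H - H^2 Lu, so that K disappears from the
    right-hand side of the inequality, which becomes 16 |h|^2 + 8 Re ((h - s)
    H) + 8 Re (H^2 Lu). *)
Lemma levi_quotient (t G : R) (h s K LH Lu H : C) : 0 < t -> 0 < G -> H = conjc h -> h != 0 ->
  16 * cmod h ^+ 2 / t <= - (8 * G * complex.Re K) + 16 * complex.Re ((h + s) * H) ->
  LH = K + 2 * ((h - s) / G%:C) * H ->
  Lu = (h + s) / H - G%:C * LH / H ^+ 2 ->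
  1 / t <= 1 + 2^-1 * (cmod (h - s) / cmod H) + 2^-1 * cmod Lu.
Proof.
move=> t0 G0 HE h0 ineq LHE LuE.
have H0 : H != 0 by rewrite HE conjc_eq0.
have G1 : G%:C != 0 by rewrite eq_complex /= gt_eqF.
have HH : cmod H = cmod h by rewrite HE cmod_conj.
have KE : G%:C * K = (3 * s - h) * H - H ^+ 2 * Lu.
  by rewrite LuE LHE; field; rewrite G1 H0.
have ReK : G * complex.Re K = complex.Re ((3 * s - h) * H - H ^+ 2 * Lu).
  rewrite -KE; case: (K) => a b /=; ring.
have hH : complex.Re (h * H) = cmod h ^+ 2.
  by rewrite HE cmod_sq; case: (h) => a b /=; ring.
have E1 : - (8 * G * complex.Re K) + 16 * complex.Re ((h + s) * H) =
   16 * cmod h ^+ 2 + 8 * complex.Re ((h - s) * H) + 8 * complex.Re (H ^+ 2 * Lu).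
  rewrite -mulrA ReK -hH.
  generalize (H ^+ 2 * Lu); move: h s H {ineq LHE LuE H0 HH KE ReK hH HE h0}.
  by move=> [a b] [c d] [e f] [x y] /=; ring.
have b1 : complex.Re ((h - s) * H) <= cmod (h - s) * cmod H.
  by rewrite -cmodM Re_le_cmod.
have b2 : complex.Re (H ^+ 2 * Lu) <= cmod H ^+ 2 * cmod Lu.
  by apply: le_trans (Re_le_cmod _) _; rewrite expr2 !cmodM expr2.
have c0 : 0 < cmod H by rewrite lt_neqAle cmod_ge0 andbT eq_sym cmod_eq0.
rewrite E1 -HH in ineq.
move: ineq b1 b2; generalize (cmod H) (cmod (h - s)) (cmod Lu) (complex.Re ((h - s) * H))
  (complex.Re (H ^+ 2 * Lu)) c0 => x y z r1 r2 x0 ineq b1 b2.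
have x2 : 0 < 16 * x ^+ 2 by rewrite mulr_gt0// exprn_gt0.
rewrite -(ler_pM2l x2).
rewrite (_ : 16 * x ^+ 2 * (1 / t) = 16 * x ^+ 2 / t); last by field; rewrite gt_eqF.
apply: le_trans ineq _.
rewrite (_ : 16 * x ^+ 2 * _ = 16 * x ^+ 2 + 8 * (y * x) + 8 * (x ^+ 2 * z)); last first.
  by field; rewrite gt_eqF.
lra.
Qed.

End LinearMaps.

(** * Derivatives of the frame and of the Hessian at a boundary point *)

Section BoundaryPoint.
Local Open Scope complex_scope.
Variables (R : realType) (Omega : set (C2 R)) (rho : C2 R -> R) (U : set (C2 R)).
Hypothesis oOmega : open Omega.
Hypothesis bOmega : bounded_set Omega.
Hypothesis oU : open U.
Hypothesis clU : closure Omega `<=` U.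
Hypothesis srho : smooth_on U rho.
Hypothesis rhoU : forall x, U x -> (Omega x <-> rho x < 0).
Hypothesis rhoB : forall x, boundary Omega x -> rho x = 0 /\ rgrad rho x != 0.
Variable p : C2 R.
Hypothesis Bp : boundary Omega p.

Local Notation C := R[i].
Local Notation n := (unit_normal rho p).
Local Notation delta := (signed_distance Omega).
Local Notation G := (enorm (rgrad rho p)).
Local Notation M := (hessian rho p).
Local Notation L := (Lmap (rC n)).
Local Notation N := (Nmap (rC n)).
Local Notation Lb := (Lbmap (rC n)).
Local Notation Nb := (Nbmap (rC n)).
Implicit Types (V W : 'rV[C]_4).

(** The Hessian of rho at p applied to V; hessC and thirdC are the complex
    multilinear extensions of the second and third derivatives of rho at p. *)
Definition hessian_row V : 'rV[C]_4 := \row_k \sum_j V 0 j * (M j k)%:C.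
Definition hessC V W : C := cdot (hessian_row V) W.
Definition third_partial i j k : R := partial i (partial j (partial k rho)) p.
Definition thirdC (X V W : 'rV[C]_4) : C :=
  \sum_i \sum_j \sum_k X 0 i * V 0 j * W 0 k * (third_partial i j k)%:C.

Lemma Up : U p. Proof. exact (boundary_U clU Bp). Qed.

Lemma G_gt0 : 0 < G.
Proof. by have [_ gp] := rhoB Bp; exact: enorm_gt0. Qed.

Lemma nn1 : dotp n n = 1.
Proof. by rewrite -enorm_sq unit_normal_norm ?expr1n//; have [] := rhoB Bp. Qed.

Lemma M_sym j k : M j k = M k j.
Proof. exact (hessian_sym oU srho j k Up). Qed.

Lemma third_partial_swap23 i j k : third_partial i j k = third_partial i k j.
Proof.
apply: near_eq_derive; apply: filterS (U_near oU Up) => x Ux.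
exact (hessian_sym oU srho k j Ux).
Qed.

Lemma third_partial_swap12 i j k : third_partial i j k = third_partial j i k.
Proof.
apply: partialC.
- by apply: filterS (U_near oU Up) => y Uy; have := diff_rho1 oU srho k Uy.
- by have := diff_rho2 oU srho i k Up.
- by have := diff_rho2 oU srho j k Up.
Qed.

Lemma thirdC_swap12 X V W : thirdC X V W = thirdC V X W.
Proof.
rewrite /thirdC exchange_big; apply: eq_bigr => j _; apply: eq_bigr => i _.
by apply: eq_bigr => k _; rewrite third_partial_swap12 [X 0 i * _]mulrC.
Qed.

Lemma thirdC_swap23 X V W : thirdC X V W = thirdC X W V.
Proof.
apply: eq_bigr => i _; rewrite exchange_big; apply: eq_bigr => k _.
by apply: eq_bigr => j _; rewrite third_partial_swap23 [X 0 i * _ * _]mulrAC.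
Qed.

Lemma thirdC_conj X V W : conjc (thirdC X V W) = thirdC (conjv X) (conjv V) (conjv W).
Proof.
rewrite /thirdC conj_sum; apply: eq_bigr => i _; rewrite conj_sum; apply: eq_bigr => j _.
rewrite conj_sum; apply: eq_bigr => k _.
by rewrite !conjM conj_real !mxE.
Qed.

Lemma thirdC_lin1 (a b : C) X X' V W : thirdC (a *: X + b *: X') V W = a * thirdC X V W + b * thirdC X' V W.
Proof.
rewrite /thirdC !mulr_sumr -big_split; apply: eq_bigr => i _ /=.
rewrite !mulr_sumr -big_split; apply: eq_bigr => j _ /=.
rewrite !mulr_sumr -big_split; apply: eq_bigr => k _ /=.
by rewrite !mxE; ring.
Qed.

Lemma thirdC_lin2 (a b : C) X V V' W : thirdC X (a *: V + b *: V') W = a * thirdC X V W + b * thirdC X V' W.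
Proof. by rewrite thirdC_swap12 thirdC_lin1 !(thirdC_swap12 _ X). Qed.

Lemma thirdC_lin3 (a b : C) X V W W' : thirdC X V (a *: W + b *: W') = a * thirdC X V W + b * thirdC X V W'.
Proof. by rewrite thirdC_swap23 thirdC_lin2 !(thirdC_swap23 X _ V). Qed.

Lemma thirdC_add X X' V W : thirdC (X + X') V W = thirdC X V W + thirdC X' V W.
Proof. by have := thirdC_lin1 1 1 X X' V W; rewrite !scale1r !mul1r. Qed.

Lemma hessC_sum V W : hessC V W = \sum_j \sum_k V 0 j * W 0 k * (M j k)%:C.
Proof.
rewrite /hessC /cdot exchange_big; apply: eq_bigr => k _ /=; rewrite mxE mulr_suml.
by apply: eq_bigr => j _; rewrite mulrAC.
Qed.

Lemma hessC_sym V W : hessC V W = hessC W V.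
Proof.
rewrite !hessC_sum exchange_big; apply: eq_bigr => k _; apply: eq_bigr => j _.
by rewrite M_sym [V 0 j * _]mulrC.
Qed.

Lemma hessC_lin2 (a b : C) V W W' : hessC V (a *: W + b *: W') = a * hessC V W + b * hessC V W'.
Proof. by rewrite /hessC cdotDr !cdotZr. Qed.

Lemma hessC_lin1 (a b : C) V V' W : hessC (a *: V + b *: V') W = a * hessC V W + b * hessC V' W.
Proof. by rewrite !(hessC_sym _ W) hessC_lin2. Qed.

Lemma hessC_conj V W : conjc (hessC V W) = hessC (conjv V) (conjv W).
Proof.
rewrite !hessC_sum conj_sum; apply: eq_bigr => j _; rewrite conj_sum; apply: eq_bigr => k _.
by rewrite !conjM conj_real !mxE.
Qed.

Lemma hessC_real (v w : C2 R) : hessC (rC v) (rC w) = (bilform M v w)%:C.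
Proof.
rewrite hessC_sum /bilform rmorph_sum; apply: eq_bigr => j _; rewrite rmorph_sum.
by apply: eq_bigr => k _; rewrite !rmorphM !mxE.
Qed.

Lemma vec10E (v : C2 R) : vec10 v = 2^-1 *: rC v + (- iC R * 2^-1) *: rC (muli v).
Proof.
by apply/rowP => j; rewrite !mxE halfC; apply: cplx_eqP => /=; ring.
Qed.

Lemma conj_vec10E (v : C2 R) : conjv (vec10 v) = 2^-1 *: rC v + (iC R * 2^-1) *: rC (muli v).
Proof.
by apply/rowP => j; rewrite !mxE halfC; apply: cplx_eqP => /=; ring.
Qed.

Lemma hessC_vec10_conj (v w : C2 R) : hessC (vec10 v) (conjv (vec10 w)) =
  ((bilform M v w + bilform M (muli v) (muli w)) / 4) +i* ((bilform M v (muli w) - bilform M (muli v) w) / 4).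
Proof.
rewrite conj_vec10E vec10E hessC_lin1 !hessC_lin2 !hessC_real halfC.
by apply: cplx_eqP => /=; field.
Qed.

Lemma hessC_vec10_real (v w : C2 R) : hessC (vec10 v) (rC w) =
  (bilform M v w / 2) -i* (bilform M (muli v) w / 2).
Proof.
rewrite vec10E hessC_lin1 !hessC_real halfC.
by apply: cplx_eqP => /=; field.
Qed.

Lemma thirdC_third (w v : C2 R) : (third rho p w v)%:C = thirdC (rC w) (rC v) (rC v).
Proof.
rewrite thirdC_swap12 thirdC_swap23 /third /thirdC rmorph_sum; apply: eq_bigr => j _; rewrite rmorph_sum.
apply: eq_bigr => k _.
have dh : differentiable (fun x => hessian rho x j k) p by have := diff_rho2 oU srho k j Up.
rewrite derive_partials// mulr_sumr rmorph_sum; apply: eq_bigr => i _.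
rewrite !mxE (_ : partial i (fun x => hessian rho x j k) p = third_partial j k i).
  by rewrite mulrA !rmorphM mulrAC.
by rewrite third_partial_swap23 third_partial_swap12 third_partial_swap23.
Qed.

Lemma conj_L : conjv L = Lb. Proof. exact: conjv_Lmap. Qed.
Lemma conj_N : conjv N = Nb. Proof. exact: conjv_Nmap. Qed.
Lemma conj_Nb : conjv Nb = N. Proof. by rewrite -conj_N conjvK. Qed.
Lemma conj_Lb : conjv Lb = L. Proof. by rewrite -conj_L conjvK. Qed.

Lemma realCD (a b : R) : (a + b)%:C = a%:C + b%:C.
Proof. by apply: cplx_eqP => //=; rewrite addr0. Qed.

(** D^3 rho (l, l) + D^3 rho (J l, J l) is 4 D^3 rho (L, conj L) for any third
    argument; for n = N + conj N the two contributions are conjugate to each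
    other. *)
Lemma third_normal : third rho p n (lvec n) + third rho p n (muli (lvec n)) =
  8 * complex.Re (thirdC L N Lb).
Proof.
have E : (third rho p n (lvec n) + third rho p n (muli (lvec n)))%:C = 4 * thirdC (rC n) L Lb.
  rewrite -conj_L Lmap_vec10 conj_vec10E vec10E thirdC_lin2 !thirdC_lin3 realCD !thirdC_third.
  rewrite (thirdC_swap23 _ (rC (muli _)) (rC (lvec n))).
  generalize (thirdC (rC n) (rC (lvec n)) (rC (lvec n)))
    (thirdC (rC n) (rC (lvec n)) (rC (muli (lvec n))))
    (thirdC (rC n) (rC (muli (lvec n))) (rC (muli (lvec n)))) => a b c.
  transitivity (a - (iC R * iC R) * c); last by field.
  by rewrite ii mulN1r opprK.
have E2 : thirdC (rC n) L Lb = thirdC L N Lb + conjc (thirdC L N Lb).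
  rewrite thirdC_conj conj_L conj_N conj_Lb (thirdC_swap12 Lb) (thirdC_swap23 Nb) (thirdC_swap12 L N).
  by rewrite -thirdC_add NmapD.
have := congr1 (@complex.Re R) E; rewrite E2 /= => ->.
by case: (thirdC _ _ _) => a b /=; ring.
Qed.

Lemma levi_qform : 4 * complex.Re (hessC L Lb) =
  qform M (lvec n) + qform M (muli (lvec n)).
Proof. by rewrite -conj_L Lmap_vec10 hessC_vec10_conj /= /qform /bilform; field. Qed.

Lemma gradE : rgrad rho p = G *: n.
Proof. by rewrite scalerA divff ?scale1r// gt_eqF// G_gt0. Qed.

(** This is levi_inequality for the real vector l = lvec n: the numbers B1 and
    B2 are four times the real and imaginary parts of D^2 rho (L, conj N), and
    D^2 rho (l, n) - i D^2 rho (J l, n) is twice D^2 rho (L, n), where n = N +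
    conj N. *)
Lemma levi_inequality_complex (tau : R) : 0 < tau < 1 ->
  plurisubharmonic_on Omega (fun x => - ((- rho x) `^ tau)) ->
  hessC L Lb = 0 ->
  16 * cmod (hessC L Nb) ^+ 2 / (1 - tau) <=
   - (8 * G * complex.Re (thirdC L N Lb)) + 16 * complex.Re ((hessC L Nb + hessC L N) * hessC N Lb).
Proof.
move=> t01 psh levi.
have dg v : dotp v n = 0 -> dotp v (rgrad rho p) = 0.
  by move=> v0; rewrite gradE dotpZr v0 mulr0.
have l0 : qform M (lvec n) + qform M (muli (lvec n)) = 0.
  by rewrite -levi_qform levi mulr0.
have := levi_inequality oOmega oU clU srho rhoU rhoB t01 psh Bp
  (dg _ (dotp_lvec n)) (dg _ (dotp_muli_lvec n)) (dg _ (dotp_muli n)) l0 erefl erefl.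
rewrite [X in - (_ * X)]third_normal.
have hE : hessC L Nb = ((bilform M (lvec n) n + bilform M (muli (lvec n)) (muli n)) / 4)
   +i* ((bilform M (lvec n) (muli n) - bilform M (muli (lvec n)) n) / 4).
  by rewrite -conj_N Lmap_vec10 Nmap_vec10 hessC_vec10_conj.
have HE : hessC N Lb = conjc (hessC L Nb) by rewrite hessC_conj conj_L conj_Nb hessC_sym.
have sE : hessC L Nb + hessC L N = (bilform M (lvec n) n / 2) -i* (bilform M (muli (lvec n)) n / 2).
  by rewrite -hessC_vec10_real -Lmap_vec10 addrC /hessC -cdotDr NmapD.
rewrite HE sE cmod_sq hE /=.
generalize (bilform M (lvec n) n) (bilform M (muli (lvec n)) (muli n)) (bilform M (lvec n) (muli n))
  (bilform M (muli (lvec n)) n) (complex.Re (thirdC L N Lb)) G => x1 x2 x3 x4 T g.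
have t1 : 1 - tau != 0 by rewrite gt_eqF// subr_gt0; case/andP: t01.
move=> H; apply: le_trans (le_trans H _); rewrite le_eqVlt; apply/orP; left; apply/eqP;
  by field.
Qed.

Definition sigma (i : 'I_4) : C2 R := \row_k partial i (partial k delta) p.

(** The derivative along the axis i of the norm of the gradient of rho. *)
Definition norm_partial (i : 'I_4) : R := dotp (grad_deriv rho p (delta_mx 0 i)) n.

Lemma sigma_coord i k : sigma i 0 k = partial i (partial k delta) p.
Proof. by rewrite /sigma mxE. Qed.

Lemma rC_coord (v : C2 R) k : rC v 0 k = (v 0 k)%:C.
Proof. by rewrite /rC mxE. Qed.

Lemma scale_rC (a : C) (v : C2 R) k : (a *: rC v) 0 k = a * (v 0 k)%:C.
Proof. by rewrite !mxE. Qed.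

Lemma scale_coord (a : C) V k : (a *: V) 0 k = a * V 0 k.
Proof. by rewrite mxE. Qed.

Lemma conjv_coord V k : conjv V 0 k = conjc (V 0 k).
Proof. by rewrite /conjv mxE. Qed.

Lemma hessian_row_coord V k : hessian_row V 0 k = \sum_j V 0 j * (M j k)%:C.
Proof. by rewrite /hessian_row mxE. Qed.

Lemma sigma_derive i k : is_derive p (delta_mx 0 i) (partial k delta) (sigma i 0 k).
Proof.
rewrite mxE; apply: derivableP.
by case: (sdist_second oOmega bOmega oU clU srho rhoU rhoB i k Bp).
Qed.

Lemma grad_derivE (w : C2 R) k : grad_deriv rho p w 0 k = \sum_i w 0 i * M k i.
Proof. by rewrite mxE derive_partials//; have := diff_rho1 oU srho k (Up). Qed.

Lemma grad_derivB (a : R) (v w : C2 R) : grad_deriv rho p (v - a *: w) = grad_deriv rho p v - a *: grad_deriv rho p w.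
Proof.
apply/rowP => k; rewrite grad_derivE [in RHS]mxE grad_derivE [in RHS]mxE [in RHS]mxE grad_derivE.
rewrite mulr_sumr -sumrB; apply: eq_bigr => i _.
by rewrite !mxE; ring.
Qed.

(** The terms with the factor m_i come from removing the normal component of
    the axis i; a tangent vector V does not see them. *)
Lemma contract_sigma (s h : 'I_4 -> C2 R) (hn m : C2 R) (g b : R) (d : 'I_4 -> R) V :
  (forall i k, s i 0 k = g * (h i 0 k - d i * m 0 k - m 0 i * (hn 0 k - b * m 0 k))) ->
  cdot V (rC m) = 0 ->
  \sum_i V 0 i *: rC (s i) =
    g%:C *: (\sum_i V 0 i *: rC (h i) - (\sum_i V 0 i * (d i)%:C) *: rC m).
Proof.
move=> sE V0; apply/rowP => k; rewrite summxE.
have -> : (g%:C *: (\sum_i V 0 i *: rC (h i) - (\sum_i V 0 i * (d i)%:C) *: rC m)) 0 k =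
    g%:C * (\sum_i V 0 i * (h i 0 k)%:C - \sum_i V 0 i * (d i)%:C * (m 0 k)%:C).
  rewrite !mxE summxE mulr_suml; congr (_ * (_ - _)).
  by apply: eq_bigr => i _; rewrite !mxE.
transitivity (\sum_i (g%:C * (V 0 i * (h i 0 k)%:C - V 0 i * (d i)%:C * (m 0 k)%:C)
   - g%:C * (hn 0 k - b * m 0 k)%:C * (V 0 i * rC m 0 i))).
  apply: eq_bigr => i _; rewrite scale_coord !rC_coord sE.
  generalize (h i 0 k) (d i) (m 0 k) (m 0 i) (V 0 i) (hn 0 k).
  by move=> x y z t [v1 v2] r; apply: cplx_eqP => /=; ring.
rewrite sumrB -[X in _ - X]mulr_sumr -/(cdot V (rC m)) V0 mulr0 subr0.
by rewrite -mulr_sumr sumrB.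
Qed.

Lemma sum_grad_deriv V k : \sum_i V 0 i * (grad_deriv rho p (delta_mx 0 i) 0 k)%:C = hessian_row V 0 k.
Proof.
rewrite /hessian_row [RHS]mxE; apply: eq_bigr => i _; rewrite grad_derivE (bigD1 i)//= big1 => [|j ji].
  by rewrite mxE !eqxx mul1r addr0 (M_sym).
by rewrite mxE (negbTE ji) andbF mul0r.
Qed.

Lemma sum_norm_partial V : \sum_i V 0 i * (norm_partial i)%:C = cdot (hessian_row V) (rC n).
Proof.
rewrite /cdot; transitivity (\sum_k \sum_i V 0 i * (grad_deriv rho p (delta_mx 0 i) 0 k)%:C * (n 0 k)%:C).
  rewrite exchange_big; apply: eq_bigr => i _; rewrite /norm_partial /dotp rmorph_sum mulr_sumr.
  by apply: eq_bigr => k _; rewrite rmorphM mulrA.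
by apply: eq_bigr => k _; rewrite -mulr_suml sum_grad_deriv rC_coord.
Qed.

Lemma sigma_second i k :
  sigma i 0 k = 'D_(delta_mx 0 i - n 0 i *: n) (fun y => unit_normal rho y 0 k) p.
Proof.
have [_ D] := sdist_second oOmega bOmega oU clU srho rhoU rhoB i k Bp.
transitivity (partial i (partial k delta) p); first exact: sigma_coord.
exact: D.
Qed.

Lemma sigmaE i k : sigma i 0 k = G^-1 * (grad_deriv rho p (delta_mx 0 i) 0 k - norm_partial i * n 0 k
   - n 0 i * (grad_deriv rho p n 0 k - dotp (grad_deriv rho p n) n * n 0 k)).
Proof.
have [_ gp] := rhoB Bp.
have d1 j := diff_rho1 oU srho j (Up).
have [_ D] := differentiable_unit_normal k d1 gp.
transitivity ('D_(delta_mx 0 i - n 0 i *: n) (fun y => unit_normal rho y 0 k) p).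
  exact: sigma_second.
transitivity (G^-1 * (grad_deriv rho p (delta_mx 0 i - n 0 i *: n) 0 k
   - dotp (grad_deriv rho p (delta_mx 0 i - n 0 i *: n)) n * n 0 k)); first exact: D.
rewrite grad_derivB /norm_partial dotpDl dotpNl dotpZl.
move: (grad_deriv rho p n) (grad_deriv rho p (delta_mx 0 i)) => h1 h2.
generalize (n 0 k) (n 0 i) (dotp h2 n) (dotp h1 n) => *.
by rewrite !mxE; congr (_ * _); ring.
Qed.

(** Along a tangent vector, the gradient of the signed distance varies like
    the normalised gradient of rho. *)
Lemma sigma_contract V : cdot V (rC n) = 0 ->
  \sum_i V 0 i *: rC (sigma i) =
    (G^-1)%:C *: (hessian_row V - cdot (hessian_row V) (rC n) *: rC n).
Proof.
move=> V0; rewrite (contract_sigma sigmaE V0) sum_norm_partial; congr (_ *: (_ - _)).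
by apply/rowP => k; rewrite summxE -sum_grad_deriv; apply: eq_bigr => i _; rewrite scale_coord rC_coord.
Qed.

Lemma near_unit : \forall x \near p, enorm (rgrad delta x) = 1.
Proof.
have F := near_sdist_grad oOmega bOmega oU clU srho rhoU rhoB Bp.
by apply: filterS F => x [].
Qed.

Lemma near_L : \forall x \near p, Lfield Omega x = Lmap (rC (rgrad delta x)).
Proof. by apply: filterS near_unit => x /Lfield_unit. Qed.

Lemma near_N : \forall x \near p, Nfield Omega x = Nmap (rC (rgrad delta x)).
Proof. by apply: filterS near_unit => x /Nfield_unit. Qed.

Lemma sdist_grad_p : rgrad delta p = n.
Proof. by have [_ ->] := sdist_grad_boundary oOmega bOmega oU clU srho rhoU rhoB Bp. Qed.

Lemma LE : Lfield Omega p = L.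
Proof. by rewrite (nbhs_singleton near_L) sdist_grad_p. Qed.

Lemma NE : Nfield Omega p = N.
Proof. by rewrite (nbhs_singleton near_N) sdist_grad_p. Qed.

Lemma cder_field (Phi : 'rV[C]_4 -> 'rV[C]_4) i k : clinear Phi ->
  cder i (fun x => Phi (rC (rgrad delta x)) 0 k) p (Phi (rC (sigma i)) 0 k).
Proof.
move=> lin; apply: cder_clinear => // j.
have -> : (fun x => rgrad delta x 0 j) = partial j delta by apply/funext => x; rewrite mxE.
exact: sigma_derive.
Qed.

Lemma hessE (f : C2 R -> R) (Z W : vfield R) x :
  hess f Z W x = \sum_k (\sum_j Z x 0 j * (partial j (partial k f) x)%:C) * conjc (W x 0 k).
Proof.
apply: eq_bigr => k _; rewrite mxE; congr (_ * _); apply: eq_bigr => j _; congr (_ * _).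
have E (y : C2 R) : grad f y 0 k = (partial k f y)%:C by rewrite mxE.
rewrite /cpartial /partial.
have -> : (fun y => complex.Re (grad f y 0 k)) = partial k f by apply/funext => y; rewrite E.
have -> : (fun y => complex.Im (grad f y 0 k)) = cst 0 by apply/funext => y; rewrite E.
by rewrite derive_cst.
Qed.

Lemma hess_hessC (Z W : vfield R) : hess rho Z W p = hessC (Z p) (conjv (W p)).
Proof.
rewrite hessE /hessC /cdot; apply: eq_bigr => k _; rewrite conjv_coord hessian_row_coord.
apply: (congr1 (fun z : C => z * conjc (W p 0 k))); apply: eq_bigr => j _.
exact: (congr1 (fun r : R => Z p 0 j * r%:C) (M_sym k j)).
Qed.

Lemma hessNL_hessC : hessNL Omega rho p = hessC N Lb.
Proof. by rewrite /hessNL hess_hessC LE NE conjv_Lmap. Qed.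

(** Leibniz rule for D^2 rho (N, conj L), where N and conj L are linear images
    of the gradient of the signed distance. *)
Definition hessNL_partial (i : 'I_4) : C := \sum_k
  ((\sum_j (Nmap (rC (sigma i)) 0 j * (partial j (partial k rho) p)%:C
         + N 0 j * (third_partial i j k)%:C)) * Lb 0 k
   + (\sum_j N 0 j * (partial j (partial k rho) p)%:C) * Lbmap (rC (sigma i)) 0 k).

Lemma cder_hessNL i : cder i (hessNL Omega rho) p (hessNL_partial i).
Proof.
have F : \forall x \near p, \sum_k (\sum_j Nmap (rC (rgrad delta x)) 0 j
     * (partial j (partial k rho) x)%:C) * Lbmap (rC (rgrad delta x)) 0 k = hessNL Omega rho x.
  apply: filterS (filterI near_L near_N) => x [Lx Nx].
  rewrite /hessNL hessE Nx Lx -conjv_Lmap; apply: eq_bigr => k _.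
  by congr (_ * _); rewrite mxE.
apply: (cder_near_eq F); apply: cder_sum => k.
have := cderM (f := fun x => \sum_j Nmap (rC (rgrad delta x)) 0 j * (partial j (partial k rho) x)%:C)
  _ (cder_field i k (@Lbmap_linear R)); rewrite sdist_grad_p; apply.
apply: cder_sum => j.
have d2 : is_derive p (delta_mx 0 i) (partial j (partial k rho)) (third_partial i j k).
  apply: derivableP; apply: diff_derivable.
  by have := diff_rho2 oU srho j k (Up).
have := cderM (cder_field i j (@Nmap_linear R)) (cder_real d2); rewrite sdist_grad_p.
by [].
Qed.

Lemma cder_norm i : cder i (fun x => (enorm (rgrad rho x))%:C) p (norm_partial i)%:C.
Proof.
have [_ gp] := rhoB Bp.
have d1 j := diff_rho1 oU srho j (Up).
have [dG DG] := differentiable_enorm_rgrad d1 gp.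
apply: cder_real; rewrite /norm_partial -DG; apply: derivableP.
exact: diff_derivable.
Qed.

(** Quotient rule; the derivative of |grad rho| along L is D^2 rho (L, n),
    with n = N + conj N. *)
Lemma vact_quot : hessC N Lb != 0 -> vact (Lfield Omega) (quot Omega rho) p =
  (hessC L Nb + hessC L N) / hessC N Lb
   - G%:C * (\sum_i L 0 i * hessNL_partial i) / hessC N Lb ^+ 2.
Proof.
move=> H0; have H0' : hessNL Omega rho p != 0 by rewrite hessNL_hessC.
transitivity (\sum_i L 0 i * ((norm_partial i)%:C / hessC N Lb - G%:C * hessNL_partial i / hessC N Lb ^+ 2)).
  rewrite /vact LE; apply: eq_bigr => i _; congr (_ * _); apply: cder_cpartial.
  have D := cderM (cder_norm i) (cderV (cder_hessNL i) H0').
  have alg (a b c H : C) : a / H - b * c / H ^+ 2 = a / H + b * (- c / H ^+ 2) by ring.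
  rewrite -hessNL_hessC alg; exact: D.
have -> : hessC L Nb + hessC L N = \sum_i L 0 i * (norm_partial i)%:C.
  by rewrite sum_norm_partial (cdot_split _ (rC n)) addrC.
rewrite mulr_suml mulr_sumr mulr_suml -sumrB; apply: eq_bigr => i _.
by rewrite mulrBr !mulrA [L 0 i * G%:C]mulrC.
Qed.

Lemma cdot_Ln : cdot L (rC n) = 0. Proof. exact: cdot_LmapW. Qed.

Lemma cdot_Lbn : cdot Lb (rC n) = 0.
Proof. by rewrite -conjv_Lmap -(rC_conjv n) -cdot_conj rC_conjv cdot_Ln conjc0. Qed.

Lemma frame_L : hessC L Lb = 0 ->
  let c := (hessC L Nb - hessC L N) / G%:C in
  Nmap (\sum_i L 0 i *: rC (sigma i)) = c *: N /\
  Lbmap (\sum_i L 0 i *: rC (sigma i)) = c *: Lb.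
Proof.
move=> levi c; rewrite (sigma_contract cdot_Ln).
have G0 : G != 0 by rewrite gt_eqF// (G_gt0).
have [E1 E2] := frame_variation (nn1) levi.
rewrite (clinearZ _ _ (@Nmap_linear R)) (clinearZ _ _ (@Lbmap_linear R)) E1 E2 !scalerA.
have cE : (G^-1)%:C * (cdot (hessian_row L) Nb - cdot (hessian_row L) N) = c.
  by rewrite /c fmorphV mulrC.
by rewrite cE.
Qed.

(** Both arguments of D^2 rho (N, conj L) are rescaled by the same factor
    along L (frame_L), whence the coefficient 2. *)
Lemma Lfield_hessNL : hessC L Lb = 0 ->
  \sum_i L 0 i * hessNL_partial i = thirdC L N Lb
    + 2 * ((hessC L Nb - hessC L N) / G%:C) * hessC N Lb.
Proof.
move=> levi; have [EN EL] := frame_L levi.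
set c := (_ / _) in EN EL *.
have EN' j : \sum_i L 0 i * Nmap (rC (sigma i)) 0 j = c * N 0 j.
  by rewrite -(clinear_comb _ _ _ (@Nmap_linear R)) EN mxE.
have EL' j : \sum_i L 0 i * Lbmap (rC (sigma i)) 0 j = c * Lb 0 j.
  by rewrite -(clinear_comb _ _ _ (@Lbmap_linear R)) EL mxE.
have cbE : hessC N Lb = \sum_k (\sum_j N 0 j * (partial j (partial k rho) p)%:C) * Lb 0 k.
  apply: eq_bigr => k _; rewrite hessian_row_coord; apply: (congr1 (fun z : C => z * Lb 0 k)).
  apply: eq_bigr => j _; exact: (congr1 (fun r : R => N 0 j * r%:C) (M_sym j k)).
transitivity (\sum_k ((\sum_j (\sum_i L 0 i * Nmap (rC (sigma i)) 0 j)
      * (partial j (partial k rho) p)%:C) * Lb 0 k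
   + (\sum_j N 0 j * (partial j (partial k rho) p)%:C) * (\sum_i L 0 i * Lbmap (rC (sigma i)) 0 k)
   + \sum_i \sum_j L 0 i * N 0 j * Lb 0 k * (third_partial i j k)%:C)).
  under eq_bigr do rewrite mulr_sumr.
  rewrite exchange_big; apply: eq_bigr => k _ /=.
  transitivity (\sum_i ((\sum_j L 0 i * Nmap (rC (sigma i)) 0 j * (partial j (partial k rho) p)%:C) * Lb 0 k
    + (\sum_j N 0 j * (partial j (partial k rho) p)%:C) * (L 0 i * Lbmap (rC (sigma i)) 0 k)
    + \sum_j L 0 i * N 0 j * Lb 0 k * (third_partial i j k)%:C)).
    apply: eq_bigr => i _; rewrite big_split /= mulrDl mulrDr.
    rewrite mulrDr -!addrA; congr (_ + _).
      by rewrite mulrA mulr_sumr; congr (_ * _); apply: eq_bigr => j _; rewrite mulrA.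
    rewrite addrC; congr (_ + _); first by rewrite mulrCA.
    rewrite mulr_suml mulr_sumr; apply: eq_bigr => j _.
    have alg (x y z t : C) : x * (y * t * z) = x * y * z * t by ring.
    exact: alg.
  rewrite !big_split /=; congr (_ + _ + _); last by rewrite mulr_sumr.
  rewrite -mulr_suml; congr (_ * _); rewrite exchange_big; apply: eq_bigr => j _.
  by rewrite mulr_suml.
have triE : thirdC L N Lb = \sum_k \sum_i \sum_j L 0 i * N 0 j * Lb 0 k * (third_partial i j k)%:C.
  rewrite /thirdC [RHS]exchange_big; apply: eq_bigr => i _ /=; exact: exchange_big.
rewrite triE -mulrA mulrA cbE big_split /= addrC; congr (_ + _).
rewrite mulr_sumr; apply: eq_bigr => k _; rewrite EL'.
under eq_bigr do rewrite EN' -mulrA.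
rewrite -mulr_sumr; set X := \sum_j _; move: X => X.
by ring.
Qed.

(** The derivative of L along conj L is conjugate to that of conj L along L,
    which frame_L gives as a multiple of conj L; the squared norm of L is 1/2.
    *)
Lemma herm_LbarL : hessC L Lb = 0 ->
  cmod (herm (nabla (vconj (Lfield Omega)) (Lfield Omega)) (Lfield Omega) p) =
  cmod (hessC L Nb - hessC L N) / (2 * G).
Proof.
move=> levi; have [_ EL] := frame_L levi.
set c := (_ / _) in EL.
have nE k : nabla (vconj (Lfield Omega)) (Lfield Omega) p 0 k = conjc (c * Lb 0 k).
  rewrite mxE /vact.
  have -> : \sum_j vconj (Lfield Omega) p 0 j * cpartial j (fun y => Lfield Omega y 0 k) p =
     \sum_j Lb 0 j * Lmap (rC (sigma j)) 0 k.
    apply: eq_bigr => j _; congr (_ * _).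
      by rewrite -conjv_Lmap /vconj LE.
    apply: cder_cpartial; apply: cder_near_eq (cder_field j k (@Lmap_linear R)).
    by apply: filterS near_L => x ->.
  rewrite -(clinear_comb _ _ _ (@Lmap_linear R)).
  have -> : \sum_i Lb 0 i *: rC (sigma i) = conjv (\sum_i L 0 i *: rC (sigma i)).
    apply/rowP => l; rewrite summxE [in RHS]mxE summxE conj_sum; apply: eq_bigr => i _.
    have E : Lb 0 i = conjc (L 0 i) by rewrite -conjv_Lmap conjv_coord.
    have alg (a : C) (v : C2 R) : (conjc a *: rC v) 0 l = conjc ((a *: rC v) 0 l).
      by rewrite !mxE conjM conj_real.
    by rewrite E alg.
  by rewrite Lmap_conjv EL !mxE.
have -> : herm (nabla (vconj (Lfield Omega)) (Lfield Omega)) (Lfield Omega) p =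
   conjc (c * cdot Lb L).
  rewrite /herm /cdot mulr_sumr conj_sum; apply: eq_bigr => k _.
  by rewrite nE LE Num_conj -conjM mulrA.
rewrite cmod_conj (cdot_LLb (nn1)) !cmodM -fmorphV halfC !cmod_real.
have G0 := G_gt0.
rewrite !gtr0_norm ?invr_gt0//.
by field; rewrite gt_eqF.
Qed.

(** The left-hand side involves the signed distance only: therefore the
    vanishing of the Levi form does not depend on the defining function. *)
Lemma levi_form_sdist :
  \sum_k (\sum_i L 0 i * (sigma i 0 k)%:C) * Lb 0 k = (G^-1)%:C * hessC L Lb.
Proof.
have E k : \sum_i L 0 i * (sigma i 0 k)%:C =
   ((G^-1)%:C *: (hessian_row L - cdot (hessian_row L) (rC n) *: rC n)) 0 k.
  rewrite -(sigma_contract cdot_Ln) summxE; apply: eq_bigr => i _.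
  by rewrite scale_rC.
transitivity (cdot Lb ((G^-1)%:C *: (hessian_row L - cdot (hessian_row L) (rC n) *: rC n))).
  by apply: eq_bigr => k _; rewrite E mulrC.
rewrite cdotZr cdotDr -scaleN1r scalerA cdotZr cdot_Lbn mulr0 addr0.
by rewrite cdotC.
Qed.

Lemma hess_LL : hess rho (Lfield Omega) (Lfield Omega) p = hessC L Lb.
Proof. by rewrite hess_hessC LE conjv_Lmap. Qed.

End BoundaryPoint.

(** * The estimate on the Levi-flat set *)

Section Estimate.
Variables (R : realType) (Omega : set (C2 R)).
Hypothesis oOmega : open Omega.
Hypothesis bOmega : bounded_set Omega.
Implicit Types (rho : C2 R -> R) (p : C2 R).
Local Open Scope complex_scope.
Local Notation C := R[i].

Lemma levi_flat_any rho p : defining_function Omega rho -> Levi_flat Omega p ->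
  hessC rho p (Lmap (rC (unit_normal rho p))) (Lbmap (rC (unit_normal rho p))) = 0.
Proof.
move=> [U [oU clU srho rhoU rhoB]] [Bp [rho' [U' [oU' clU' srho' rhoU' rhoB']] flat]].
have E := levi_form_sdist oOmega bOmega oU clU srho rhoU rhoB Bp.
have E' := levi_form_sdist oOmega bOmega oU' clU' srho' rhoU' rhoB' Bp.
have n1 := sdist_grad_p oOmega bOmega oU clU srho rhoU rhoB Bp.
have n2 := sdist_grad_p oOmega bOmega oU' clU' srho' rhoU' rhoB' Bp.
have F := hess_LL oOmega bOmega oU' clU' srho' rhoU' rhoB' Bp.
rewrite flat in F; rewrite -n1 in E *; rewrite -n2 in E' F.
have G0 : ((enorm (rgrad rho p))^-1)%:C != 0 :> C.
  have := G_gt0 rhoB Bp; move: (enorm _) => G G0.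
  by rewrite eq_complex /= invr_eq0 gt_eqF.
have cancel (s k a k' b : C) : s = k * a -> s = k' * b -> 0 = b -> k != 0 -> a = 0.
  move=> -> /eqP + b0 k0; rewrite -b0 mulr0 mulf_eq0 (negbTE k0).
  by move/eqP.
exact: cancel E E' F G0.
Qed.

(** Combination by levi_quotient of the inequality obtained from
    plurisubharmonicity, the derivative of Hess_rho (N, L) along L and the
    value of the connection coefficient. *)
Lemma levi_flat_estimate rho p (tau : R) : defining_function Omega rho -> 0 < tau < 1 ->
  plurisubharmonic_on Omega (fun x => - ((- rho x) `^ tau)) ->
  Levi_flat Omega p -> hessNL Omega rho p != 0 ->
  1 / (1 - tau) <= 1
    + cmod (herm (nabla (vconj (Lfield Omega)) (Lfield Omega)) (Lfield Omega) p)
       * (enorm (rgrad rho p) / cmod (hessNL Omega rho p))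
    + 2^-1 * cmod (vact (Lfield Omega) (quot Omega rho) p).
Proof.
move=> drho t01 psh Sp; have levi := levi_flat_any drho Sp.
case: drho => U [oU clU srho rhoU rhoB]; have [Bp _] := Sp.
rewrite (hessNL_hessC oOmega bOmega oU clU srho rhoU rhoB Bp) => H0.
have G0 := G_gt0 rhoB Bp.
have ineq := levi_inequality_complex oOmega oU clU srho rhoU rhoB Bp t01 psh levi.
have sE := Lfield_hessNL oOmega bOmega oU clU srho rhoU rhoB Bp levi.
have uE := vact_quot oOmega bOmega oU clU srho rhoU rhoB Bp H0.
have HE : hessC rho p (Nmap (rC (unit_normal rho p))) (Lbmap (rC (unit_normal rho p))) =
    conjc (hessC rho p (Lmap (rC (unit_normal rho p))) (Nbmap (rC (unit_normal rho p)))).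
  by rewrite hessC_conj conj_L conj_Nb (hessC_sym oU clU srho Bp).
have h0 : hessC rho p (Lmap (rC (unit_normal rho p))) (Nbmap (rC (unit_normal rho p))) != 0.
  by move: H0; rewrite HE conjc_eq0.
have t0 : 0 < 1 - tau by rewrite subr_gt0; case/andP: t01.
have := levi_quotient t0 G0 HE h0 ineq sE uE.
rewrite (herm_LbarL oOmega bOmega oU clU srho rhoU rhoB Bp levi).
move: (cmod _) (cmod _) (cmod _) => z y x.
suff -> : 2^-1 * (x / y) = x / (2 * enorm (rgrad rho p)) * (enorm (rgrad rho p) / y) by [].
have G1 : enorm (rgrad rho p) != 0 by rewrite gt_eqF.
move: (y^-1) => w; field; exact: G1.
Qed.

Lemma cmod_sum_le (F : 'I_4 -> C) : cmod (\sum_j F j) <= \sum_j cmod (F j).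
Proof.
rewrite !sum4; do 3 apply: le_trans (cmodD _ _) (lerD _ (lexx _)).
exact: lexx.
Qed.

Lemma hessC_le rho p (V W : 'rV[C]_4) : (forall j, cmod (V 0 j) <= 1) ->
  (forall j, cmod (W 0 j) <= 1) ->
  cmod (hessC rho p V W) <= \sum_j \sum_k `|hessian rho p j k|.
Proof.
move=> V1 W1; rewrite hessC_sum (le_trans (cmod_sum_le _))//; apply: ler_sum => j _.
rewrite (le_trans (cmod_sum_le _))//; apply: ler_sum => k _.
rewrite !cmodM cmod_real -[leRHS]mul1r ler_wpM2r//.
by rewrite -[leRHS]mul1r ler_pM ?cmod_ge0.
Qed.

Lemma vec10_le1 (v : C2 R) j : enorm v <= 1 -> cmod (vec10 v 0 j) <= 1.
Proof.
move=> v1; have c1 i : `|v 0 i| <= 1 := le_trans (enorm_coord v i) v1.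
have c2 : `|muli v 0 j| <= 1 by rewrite mxE; case: ifP => _; rewrite ?normrN.
rewrite mxE -(@expr_le1 _ 2) ?cmod_ge0// cmod_sq /=.
move: (c1 j) c2; rewrite !ler_norml => /andP[a1 a2] /andP[b1 b2].
move: (v 0 j) (muli v 0 j) a1 a2 b1 b2 => a b a1 a2 b1 b2.
have : 0 <= (1 - a) * (1 + a) by rewrite mulr_ge0//; lra.
have : 0 <= (1 - b) * (1 + b) by rewrite mulr_ge0//; lra.
lra.
Qed.

Lemma enorm_lvec (n : C2 R) : enorm (lvec n) = enorm n.
Proof.
apply/eqP; rewrite -(@eqrXn2 _ 2)// ?enorm_ge0// !enorm_sq /dotp !sum4 !mxE /=.
by apply/eqP; ring.
Qed.

Lemma frame_term_bound rho p : enorm (unit_normal rho p) = 1 ->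
  cmod (hessC rho p (Lmap (rC (unit_normal rho p))) (Nbmap (rC (unit_normal rho p)))
    - hessC rho p (Lmap (rC (unit_normal rho p))) (Nmap (rC (unit_normal rho p)))) <=
  2 * \sum_j \sum_k `|hessian rho p j k|.
Proof.
move=> n1; apply: le_trans (cmodD _ _) _.
rewrite cmodN mulr_natl mulr2n.
have L1 j : cmod (Lmap (rC (unit_normal rho p)) 0 j) <= 1.
  by rewrite Lmap_vec10 vec10_le1// enorm_lvec n1.
have N1 j : cmod (Nmap (rC (unit_normal rho p)) 0 j) <= 1.
  by rewrite Nmap_vec10 vec10_le1// n1.
have Nb1 j : cmod (Nbmap (rC (unit_normal rho p)) 0 j) <= 1.
  by rewrite -conjv_Nmap conjv_coord cmod_conj.
exact: lerD (hessC_le _ _ L1 Nb1) (hessC_le _ _ L1 N1).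
Qed.

(** A real supremum bounds the values of a function only if they are bounded
    above. By herm_LbarL they are at most the sum of the absolute second
    derivatives of rho over the norm of its gradient, which is continuous on
    the compact boundary. *)
Lemma connection_le_DF_const rho p : defining_function Omega rho -> Levi_flat Omega p ->
  cmod (herm (nabla (vconj (Lfield Omega)) (Lfield Omega)) (Lfield Omega) p)
    <= DF_const Omega.
Proof.
move=> drho Sp; have [U [oU clU srho rhoU rhoB]] := drho.
set f := herm _ _.
have le_max4 (a b c d : R) : b <= Num.max (Num.max a b) (Num.max c d).
  by rewrite !le_max lexx orbT.
apply: le_trans (le_max4 _ (max_on (Levi_flat Omega) f) _ _).
pose Q x := (\sum_j \sum_k `|hessian rho x j k|) / enorm (rgrad rho x).
have cQ x : boundary Omega x -> {for x, continuous Q}.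
  move=> Bx; have Ux := boundary_U clU Bx; have [_ gx] := rhoB _ Bx.
  have d1 j := diff_rho1 oU srho j Ux.
  have [dG _] := differentiable_enorm_rgrad d1 gx.
  apply: (@cvgM R _ (nbhs x)).
    apply: (@cvg_big R^o _ +%R 0 xpredT (@add_continuous R^o) _ (nbhs x)) => j _.
    apply: (@cvg_big R^o _ +%R 0 xpredT (@add_continuous R^o) _ (nbhs x)) => k _.
    apply: (@cvg_norm R R^o _ (nbhs x)).
    exact: differentiable_continuous (diff_rho2 oU srho k j Ux).
  apply: (@cvgV R _ (nbhs x)); first by rewrite gt_eqF// enorm_gt0.
  exact: differentiable_continuous dG.
have [Bp _] := Sp.
have ne : boundary Omega !=set0 by exists p.
have [|c _ Qc] := @compact_EVT_max _ R Q _ ne (boundary_compact bOmega).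
  by apply: continuous_in_subspaceT => x; rewrite inE; exact: cQ.
apply: ub_le_sup; last by exists p.
exists (Q c) => _ [q Sq <-]; have [Bq _] := Sq.
apply: (le_trans _ (Qc q _)); last by rewrite inE.
rewrite (herm_LbarL oOmega bOmega oU clU srho rhoU rhoB Bq (levi_flat_any drho Sq)).
have G0 := G_gt0 rhoB Bq; have [_ gq] := rhoB _ Bq.
rewrite /Q ler_pdivrMr ?mulr_gt0// mulrA.
apply: le_trans (frame_term_bound (unit_normal_norm gq)) _.
have alg (S g : R) : 0 < g -> 2 * S = S / g * 2 * g by move=> g0; field; rewrite gt_eqF.
by rewrite -(alg _ _ G0).
Qed.

End Estimate.

Theorem theorem1p2 (R : realType) (Omega : set 'rV[R]_4)
    (Omega_domain : bounded_domain Omega)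
    (Omega_smooth : smooth_boundary Omega)
    (Omega_psc : pseudoconvex Omega)
    (Sigma_neq0 : Levi_flat Omega !=set0) :
  (forall eta0 : R, DF_index Omega = eta0 ->
   forall eta : R, eta < eta0 ->
   exists2 rho : 'rV[R]_4 -> R, defining_function Omega rho &
     forall p : 'rV[R]_4, Levi_flat Omega p ->
       hessNL Omega rho p = 0 \/
       1 / (1 - eta) <=
         5 / 2
         + 15 / 4 * DF_const Omega
             * (enorm (rgrad rho p) / cmod (hessNL Omega rho p))
         + 1 / 2 * cmod (vact (Lfield Omega) (quot Omega rho) p))
  /\
  (DF_index Omega = 1 ->
   exists rho : nat -> 'rV[R]_4 -> R,
     (forall j, defining_function Omega (rho j)) /\
     quot_C1_norm Omega (rho j) @[j --> \oo] --> +oo%E).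
Proof.
have [oO _ _ bO] := Omega_domain; have [rho0 drho0] := Omega_smooth.
have C0 : 0 <= DF_const Omega.
  have [p Sp] := Sigma_neq0.
  exact: le_trans (cmod_ge0 _) (connection_le_DF_const oO bO drho0 Sp).
have part1 (eta0 : R) : DF_index Omega = eta0 -> forall eta : R, eta < eta0 ->
   exists2 rho : 'rV[R]_4 -> R, defining_function Omega rho &
     forall p : 'rV[R]_4, Levi_flat Omega p ->
       hessNL Omega rho p = 0 \/
       1 / (1 - eta) <=
         5 / 2
         + 15 / 4 * DF_const Omega
             * (enorm (rgrad rho p) / cmod (hessNL Omega rho p))
         + 1 / 2 * cmod (vact (Lfield Omega) (quot Omega rho) p).
  move=> etaE eta lt.
  (* for eta <= 3/5 the constant 5/2 alone is at least 1 / (1 - eta), and any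
     defining function will do; otherwise the index is positive, so that
     exponents exist (the supremum of the empty set is 0) *)
  have [small|big] := lerP eta (3 / 5).
    exists rho0 => // p _; right.
    have q0 : 0 <= enorm (rgrad rho0 p) / cmod (hessNL Omega rho0 p).
      by rewrite divr_ge0 ?enorm_ge0 ?cmod_ge0.
    have q1 := mulr_ge0 C0 q0.
    have q2 := cmod_ge0 (vact (Lfield Omega) (quot Omega rho0) p).
    apply: (@le_trans _ _ (5 / 2)); last first.
      have alg (c q u : R) : 0 <= c * q -> 0 <= u -> 5 / 2 <= 5 / 2 + 15 / 4 * c * q + 1 / 2 * u.
        by move=> *; lra.
      exact: alg q1 q2.
    have e1 : 0 < 1 - eta by lra.
    by rewrite ler_pdivrMr//; lra.
  have ne : [set tau | DF_exponent Omega tau] !=set0.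
    apply: contrapT => /nonemptyPn e; move: etaE; rewrite /DF_index e sup0; lra.
  have [tau [t01 [rho drho psh]] et] : exists2 tau, DF_exponent Omega tau & eta < tau.
    by apply: sup_gt => //; rewrite -[sup _]/(DF_index Omega) etaE.
  exists rho => // p Sp; have [->|H0] := eqVneq (hessNL Omega rho p) 0; [by left|right].
  have alg (q u m c t e : R) : 0 < t < 1 -> e < t -> 0 <= q -> 0 <= c -> m <= c -> 0 <= u ->
      1 / (1 - t) <= 1 + m * q + 2^-1 * u ->
      1 / (1 - e) <= 5 / 2 + 15 / 4 * c * q + 1 / 2 * u.
    move=> /andP[t0 t1] et' q0 c0 mc u0 H.
    have : 1 / (1 - e) <= 1 / (1 - t) by rewrite !div1r lef_pV2 ?posrE; lra.
    have := mulr_ge0 c0 q0; have := ler_wpM2r q0 mc; lra.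
  have q0 : 0 <= enorm (rgrad rho p) / cmod (hessNL Omega rho p).
    by rewrite divr_ge0 ?enorm_ge0 ?cmod_ge0.
  have est := levi_flat_estimate oO bO drho t01 psh Sp H0.
  exact: alg t01 et q0 C0 (connection_le_DF_const oO bO drho Sp) (cmod_ge0 _) est.
split; first exact: part1.
move=> index1.
(* the choice eta = 1 - 1 / (j + 1) gives 1 / (1 - eta) = j + 1 *)
have ex (j : nat) : exists rho : 'rV[R]_4 -> R, defining_function Omega rho /\
    forall p : 'rV[R]_4, Levi_flat Omega p -> hessNL Omega rho p = 0 \/
       j.+1%:R <=
         5 / 2
         + 15 / 4 * DF_const Omega
             * (enorm (rgrad rho p) / cmod (hessNL Omega rho p))
         + 1 / 2 * cmod (vact (Lfield Omega) (quot Omega rho) p).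
  have lt : 1 - j.+1%:R^-1 < 1 :> R by rewrite ltrBlDr ltrDl invr_gt0.
  have [rho drho H] := part1 1 index1 _ lt; exists rho; split => // p /H.
  by rewrite subKr div1r invrK.
have [rho rhoP] := choice ex.
exists rho; split=> [j|]; first by have [] := rhoP j.
have [p Sp] := Sigma_neq0.
apply/cvgeyPge => A; near=> j.
have [drho /(_ p Sp) Hj] := rhoP j.
have s2 : (0 <= ereal_sup [set (cmod (vact (Lfield Omega) (quot Omega (rho j)) q))%:E
               | q in Levi_flat Omega])%E.
  apply: (@le_trans _ _ (cmod (vact (Lfield Omega) (quot Omega (rho j)) p))%:E).
    by rewrite lee_fin cmod_ge0.
  by apply: ereal_sup_ubound; exists p.
have s1 : (abs_quot Omega (rho j) p <=
   ereal_sup [set abs_quot Omega (rho j) q | q in Levi_flat Omega])%E.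
  by apply: ereal_sup_ubound; exists p.
have s3 : ((cmod (vact (Lfield Omega) (quot Omega (rho j)) p))%:E <=
   ereal_sup [set (cmod (vact (Lfield Omega) (quot Omega (rho j)) q))%:E
               | q in Levi_flat Omega])%E.
  by apply: ereal_sup_ubound; exists p.
rewrite /quot_C1_norm.
have [H0|H0] := eqVneq (hessNL Omega (rho j) p) 0.
  move: s1; rewrite /abs_quot H0 eqxx leye_eq => /eqP ->.
  by rewrite addye ?leey// gt_eqF// (lt_le_trans _ s2)// ltNyr.
case: Hj => [H1|Hj]; first by rewrite H1 eqxx in H0.
apply: le_trans (leeD s1 s3); rewrite /abs_quot (negbTE H0) -EFinD lee_fin.
have quotE : cmod (quot Omega (rho j) p) = enorm (rgrad (rho j) p) / cmod (hessNL Omega (rho j) p).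
  rewrite /quot cmodM cmod_real ger0_norm ?enorm_ge0//; congr (_ * _).
  apply: (mulfI (x := cmod (hessNL Omega (rho j) p))); first by rewrite cmod_eq0.
  by rewrite -cmodM divff// divff ?cmod_eq0// -[1]/(1%:C)%C cmod_real normr1.
rewrite quotE.
have q0 : 0 <= enorm (rgrad (rho j) p) / cmod (hessNL Omega (rho j) p).
  by rewrite divr_ge0 ?enorm_ge0 ?cmod_ge0.
have u0 := cmod_ge0 (vact (Lfield Omega) (quot Omega (rho j)) p).
(* the j-th inequality at p is 5/2 + (15/4 C) q + (1/2) u >= j + 1 with q and
   u below the two suprema, so q + u >= A as soon as j + 1 is large *)
have jA : 5 / 2 + (15 / 4 * DF_const Omega + 1 / 2) * `|A| <= j.+1%:R.
  apply: (@le_trans _ _ j%:R); last by rewrite ler_nat.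
  near: j; exact: nbhs_infty_ger.
move: Hj jA q0 u0; move: (enorm _ / _) (cmod (vact _ _ _)) => q u Hj jA q0 u0.
apply: le_trans (ler_norm A) _.
have k0 : 0 < 15 / 4 * DF_const Omega + 1 / 2 by lra.
have c1 := mulr_ge0 C0 u0.
rewrite -(ler_pM2l k0); lra.
Unshelve. all: by end_near. Qed.
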